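(* Let $(X,p)$ be a complex analytic normal surface germ, let $f,g$ be complex analytic function germs on $(X,p)$ such that $\phi=(f,g):(X,p)\to(\mathbb{C}^2,0)$ is a finite analytic morphism, and let $\pi:(Y,E_Y)\to(X,p)$ be a good resolution of $\phi$. Let $G(Y)$ be its weighted, partially oriented dual graph and let $A(Y)$ be the union of all maximal arcs in $G(Y)$. Then, for every connected component of the closure of $G(Y)\setminus A(Y)$, the Hironaka quotients of $\phi$ on the vertices of this connected component are constant (all equal). Moreover, $G(Y)\setminus A(Y)$ does not contain any arrow.
   Context: A resolution $\pi:(Y,E_Y)\to(X,p)$ of the singularity $(X,p)$, with exceptional divisor $E_Y=\pi^{-1}(p)$, is a good resolution of $\phi=(f,g)$ if the total transform $E_Y^+=((fg)\circ\pi)^{-1}(0)$ is a normal crossings divisor and the irreducible components of $E_Y$ are non-singular. A curvetta $c_i$ of an irreducible component $E_i$ of $E_Y$ is a smooth curve germ that intersects $E_i$ transversally at a smooth point of the total transform. The Hironaka quotient of $(f,g)$ on $E_i$ is $q_{E_i}=V_{f\circ\pi}(c_i)/V_{g\circ\pi}(c_i)$, where $V_h(c_i)$ denotes the order of $h$ on $c_i$. The weighted dual graph $G(Y)$: to each irreducible component $E_i$ of $E_Y$ corresponds a vertex $(i)$ weighted by $q_{E_i}$. When two components of $E_Y$ intersect, their vertices are joined by as many edges as there are intersection points. When $k$ irreducible components of the strict transform of $\{fg=0\}$ meet $E_i$, $k$ edges are added to the vertex $(i)$; if such an edge represents the intersection point of $E_i$ with a component of the strict transform of $\{f=0\}$ (resp.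 $\{g=0\}$), it is endowed with a going-out arrow (resp. a going-in arrow, i.e. a reverse arrow). By convention the Hironaka quotient of a going-in arrow is $0$ and that of a going-out arrow is infinite. Partial orientation: let $(e_{ij})$ be an edge representing a point of $E_i\cap E_j$. If $q_{E_i}=q_{E_j}$ the edge is not oriented; if $q_{E_i}<q_{E_j}$ the edge is oriented from $(i)$ to $(j)$ and is said to be positively oriented. Likewise (by the convention on arrows) an edge with a going-in arrow is oriented towards its vertex and an edge with a going-out arrow is oriented away from its vertex. A maximal arc in $G(Y)$ is a subgraph homeomorphic to a segment such that: (1) it begins with a going-in arrow and ends with a going-out arrow; (2) it is a sequence of positively oriented edges; (3) the orientation of the edges induces a compatible positive orientation on the whole segment. Closures and connected components are taken in $G(Y)$ viewed as a topological graph. *)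

(* Defs.v *)
From HB Require Import structures.
From mathcomp Require Import all_boot all_order all_algebra.
From mathcomp Require Import all_classical all_reals all_analysis.
From mathcomp Require Import complex.

Set Implicit Arguments.
Unset Strict Implicit.
Unset Printing Implicit Defensive.

Import Order.TTheory GRing.Theory Num.Theory numFieldNormedType.Exports.
Local Open Scope classical_set_scope.
Local Open Scope ring_scope.

(* [R[i]] carries its topology through the alias [R[i]^o]. *)
Notation CC R := (complex R)^o.
Notation Cn R n := 'rV[CC R]_n.

Section AnalyticFunctions.
Variables (R : realType) (n : nat).

(* The sum over multi-indices is the limit of the sums over the cubes
   {0,...,N-1}^n; the bound makes the power series absolutely convergent on a
   closed polydisc of radius [r]. *)
Definition analytic_at (x : Cn R n) (f : Cn R n -> CC R) : Prop :=
  exists (a : ('I_n -> nat) -> CC R) (r M : CC R),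
    [/\ 0 < r,
        forall N : nat,
          \sum_(al : {ffun 'I_n -> 'I_N})
             `|a (fun i => al i)| * r ^+ (\sum_i al i)%N <= M &
        \forall z \near x,
          (fun N : nat => \sum_(al : {ffun 'I_n -> 'I_N})
             a (fun i => al i) *
             \prod_i ((z : Cn R n) ord0 i - x ord0 i) ^+ al i : CC R) @ \oo --> f z].

Definition analytic_set (A : set (Cn R n)) : Prop :=
  forall x, A x -> exists (k : nat) (F : 'I_k -> Cn R n -> CC R),
    (forall j, analytic_at x (F j)) /\
    \forall z \near x, A z <-> forall j, F j z = 0.

Definition analytic_on (A : set (Cn R n)) (x : Cn R n) (f : Cn R n -> CC R) :
    Prop :=
  exists F : Cn R n -> CC R,
    analytic_at x F /\ \forall z \near x, A z -> f z = F z.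

End AnalyticFunctions.

(* A reduced complex space is encoded as a topological space with its sheaf of
   holomorphic functions, which is a subsheaf of the sheaf of all functions:
   [hol x f] means that [f] is holomorphic at [x]. The values of [f] away from
   [x] are irrelevant, so [f] stands for a germ at [x]. *)
Record fspace (R : realType) := FSpace {
  points :> topologicalType;
  hol : points -> (points -> CC R) -> Prop }.

Section ComplexSpaces.
Variable R : realType.
Implicit Types S T : fspace R.

Definition affine n : fspace R := @FSpace R (Cn R n) (@analytic_at R n).

(* [i] maps a neighbourhood of [x] isomorphically, as a space with a sheaf of
   functions, onto an open subset of [A]. *)
Definition local_model S n (A : set (Cn R n)) (x : S) (i : S -> Cn R n) :
    Prop :=
  exists (U : set S) (W : set (Cn R n)) (s : Cn R n -> S),
    [/\ open U /\ U x,
        open W /\ i @` U = A `&` W,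
        forall z, U z -> s (i z) = z,
        {within U, continuous i} /\ {within A `&` W, continuous s} &
        forall z h, U z -> hol z h <-> analytic_on A (i z) (h \o s)].

Definition complex_space S : Prop :=
  hausdorff_space S /\
  forall x : S, exists n (A : set (Cn R n)) (i : S -> Cn R n),
    analytic_set A /\ local_model A x i.

Definition coordinates S n (x : S) (i : S -> Cn R n) : Prop :=
  local_model [set: Cn R n] x i /\ i x = 0.

Definition smooth_point S n (x : S) : Prop :=
  exists i : S -> Cn R n, coordinates x i.

Definition complex_manifold S n : Prop :=
  hausdorff_space S /\ forall x : S, smooth_point n x.

Definition holomorphic_at S T (F : S -> T) (x : S) : Prop :=
  {for x, continuous F} /\ forall h, hol (F x) h -> hol x (h \o F).

Definition holomorphic S T (F : S -> T) : Prop :=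
  forall x, holomorphic_at F x.

(* The local ring of germs at [p] is an integral domain, integrally closed in
   its field of fractions: a fraction a / b which is a root of a monic
   polynomial with coefficients [c k] is a germ [h]. *)
Definition normal_at S (p : S) : Prop :=
  (forall a b, hol p a -> hol p b -> (\forall z \near p, a z * b z = 0) ->
     (\forall z \near p, a z = 0) \/ (\forall z \near p, b z = 0)) /\
  (forall a b (d : nat) (c : nat -> S -> CC R),
     hol p a -> hol p b -> (forall k, hol p (c k)) ->
     ~ (\forall z \near p, b z = 0) ->
     (\forall z \near p,
        a z ^+ d + \sum_(k < d) c k z * a z ^+ k * b z ^+ (d - k) = 0) ->
     exists h, hol p h /\ \forall z \near p, a z = b z * h z).

Definition pure_dim_at S (n : nat) (p : S) : Prop :=
  \forall z \near p, closure [set x : S | smooth_point n x] z.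

Definition normal_surface_germ S (p : S) : Prop :=
  [/\ complex_space S, pure_dim_at 2 p & normal_at p].

(* (f, g) restricts to a proper holomorphic map with finite fibres between
   neighbourhoods of [p] and of the origin of C^2. *)
Definition finite_germ S (p : S) (f g : S -> CC R) : Prop :=
  [/\ hol p f /\ hol p g, f p = 0 /\ g p = 0 &
  exists (U : set S) (V : set (CC R * CC R)),
    [/\ open U /\ U p, open V /\ V (0, 0),
        forall x, U x -> [/\ hol x f, hol x g & V (f x, g x)],
        forall K, K `<=` V -> compact K ->
          compact (U `&` [set x | K (f x, g x)]) &
        forall w, V w -> finite_set (U `&` [set x | (f x, g x) = w])]].

End ComplexSpaces.

Section CurvesOnSurfaces.
Variables (R : realType) (Y : fspace R).
Implicit Types (D E : set Y) (y : Y).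

Definition local_zero_set D y (h : Y -> CC R) : Prop :=
  \forall z \near y, D z <-> h z = 0.

Definition fst_coord (i : Y -> Cn R 2) : Y -> CC R := fun z => i z ord0 ord0.
Definition snd_coord (i : Y -> Cn R 2) : Y -> CC R := fun z => i z ord0 ord_max.

Definition smooth_curve_at D y : Prop :=
  exists i, coordinates y i /\ local_zero_set D y (fst_coord i).

Definition normal_crossings_at D y : Prop :=
  exists i, coordinates y i /\
    (local_zero_set D y (fst_coord i) \/
     local_zero_set D y (fun z => fst_coord i z * snd_coord i z)).

(* The support of a divisor: [D] is a curve or is empty. *)
Definition divisor D : Prop :=
  closed D /\
  forall y, D y -> exists h,
    [/\ hol y h, ~ (\forall z \near y, h z = 0) & local_zero_set D y h].

(* The irreducible components of an analytic set are the closures of the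
   connected components of its regular locus. *)
Definition irreducible_component D E : Prop :=
  exists y, smooth_curve_at D y /\
    E = closure (connected_component [set z | smooth_curve_at D z] y).

End CurvesOnSurfaces.

Section Resolutions.
Variables (R : realType) (X Y : fspace R) (p : X) (pi : Y -> X).

Definition exceptional : set Y := pi @^-1` [set p].

Definition resolution : Prop :=
  [/\ complex_manifold Y 2,
      holomorphic pi,
      forall K, compact K -> compact (pi @^-1` K),
      divisor exceptional /\ dense (~` exceptional) &
      exists r : X -> Y,
        [/\ forall y, ~ exceptional y -> r (pi y) = y,
            forall x, x <> p -> pi (r x) = x &
            forall x, x <> p -> holomorphic_at r x]].

Definition component (E : set Y) : Prop := irreducible_component exceptional E.

Variables f g : X -> CC R.

Definition total_transform : set Y := [set y | f (pi y) * g (pi y) = 0].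

(* Only the germs of [f] and [g] at [p] are given: normal crossings is a
   condition on a neighbourhood of the exceptional divisor. *)
Definition good_resolution : Prop :=
  [/\ resolution,
      forall y, exceptional y -> normal_crossings_at total_transform y &
      forall E, component E -> forall y, E y -> smooth_curve_at E y].

Definition strict_transform (h : X -> CC R) : set Y :=
  closure ([set y | h (pi y) = 0] `\` exceptional).

Definition has_order (u : Cn R 1 -> CC R) (k : nat) : Prop :=
  exists w : Cn R 1 -> CC R,
    [/\ analytic_at 0 w, w 0 <> 0 &
        \forall t \near (0 : Cn R 1), u t = t ord0 ord0 ^+ k * w t].

(* A curve germ is given by a parametrization [c]; the last condition says
   that c'(0) is not tangent to [E], so [c] is an immersion. *)
Definition curvetta (E : set Y) (c : Cn R 1 -> Y) : Prop :=
  [/\ @holomorphic_at R (affine R 1) Y c 0,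
      E (c 0),
      smooth_curve_at total_transform (c 0) &
      exists i, [/\ coordinates (c 0) i,
                    local_zero_set E (c 0) (fst_coord i) &
                    has_order (fst_coord i \o c) 1]].

Definition hironaka_quotient (E : set Y) : R :=
  xget 0 [set q | exists c m n,
    [/\ curvetta E c, has_order (f \o pi \o c) m, has_order (g \o pi \o c) n &
        q = m%:R / n%:R]].

(* The vertices of the dual graph are the [Vertex E] with [E] a component; the
   free end of an arrow is an additional node, labelled by the point of the
   exceptional divisor that the arrow represents. *)
Inductive node :=
  | Vertex of set Y
  | InTip of Y
  | OutTip of Y.

Definition weight (n : node) : \bar R :=
  match n with
  | Vertex E => (hironaka_quotient E)%:E
  | InTip _ => 0%E
  | OutTip _ => +oo%E
  end.

(* [edge y a b]: the point [y] represents an edge with ends [a] and [b]. With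
   normal crossings and smooth components, a point represents at most one edge,
   and each point of the strict transform on the exceptional divisor lies on a
   single local branch, hence carries a single arrow. *)
Definition edge (y : Y) (a b : node) : Prop :=
  match a, b with
  | Vertex E, Vertex F => [/\ component E, component F, E <> F, E y & F y]
  | InTip z, Vertex E => [/\ z = y, component E, E y & strict_transform g y]
  | Vertex E, OutTip z => [/\ z = y, component E, E y & strict_transform f y]
  | _, _ => False
  end.

Definition arrow (y : Y) (a b : node) : Prop :=
  edge y a b /\ ((exists z, a = InTip z) \/ (exists z, b = OutTip z)).

(* The topological graph is realized in the space of real functions on nodes
   and edges, with the pointwise topology: a node is its own basis vector, and
   the edge [y] from [a] to [b] is bent along the basis vector [y], so that
   distinct edges meet only at common ends. *)
Definition ambient := {ptws (node + Y)%type -> R}.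

Definition node_point (a : node) : ambient :=
  fun k => \1_[set inl a] k.

Definition edge_point (y : Y) (a b : node) (t : R) : ambient :=
  fun k => (1 - t) * \1_[set inl a] k + t * \1_[set inl b] k
           + t * (1 - t) * \1_[set inr y] k.

Definition segment (y : Y) (a b : node) : set ambient :=
  [set edge_point y a b t | t in `[0, 1]%classic].

Definition dual_graph : set ambient :=
  [set x | (exists2 E, component E & x = node_point (Vertex E)) \/
           (exists y a b, edge y a b /\ segment y a b x)].

Definition positive_edge (y : Y) (a b : node) : Prop :=
  edge y a b /\ (weight a < weight b)%E.

(* A path is given by its first node and the list of its successive edges, each
   one with its terminal node. Weights increase strictly along it, so it does
   not visit a node twice and is homeomorphic to a segment. *)
Fixpoint positive_path (a : node) (s : seq (Y * node)) : Prop :=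
  if s is (y, b) :: s' then positive_edge y a b /\ positive_path b s'
  else True.

Fixpoint path_support (a : node) (s : seq (Y * node)) : set ambient :=
  if s is (y, b) :: s' then segment y a b `|` path_support b s' else set0.

Definition maximal_arc (a : node) (s : seq (Y * node)) : Prop :=
  [/\ positive_path a s, exists y, a = InTip y &
      exists y, last a (map snd s) = OutTip y].

Definition maximal_arcs : set ambient :=
  [set x | exists a s, maximal_arc a s /\ path_support a s x].

Definition off_arcs : set ambient := dual_graph `\` maximal_arcs.

Definition off_arcs_closure : set ambient := dual_graph `&` closure off_arcs.

End Resolutions.

(* Main.v *)
Require Import Defs.
From HB Require Import structures.
From mathcomp Require Import all_boot all_order all_algebra.
From mathcomp Require Import all_classical all_reals all_analysis.
From mathcomp Require Import complex.
From mathcomp Require Import ring lra zify.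
Import Order.TTheory GRing.Theory Num.Theory numFieldNormedType.Exports.

(** Write [F] and [G] for the pull-backs of the two functions to the resolution,
    and let [E] be an exceptional component, along which they vanish to orders
    [m] and [n]; the Hironaka quotient of [E] is [m / n], because the order of
    [F] on a curvetta is its vanishing order along [E]. At a point of [E] there
    are coordinates with [E = {u = 0}], [F = u ^ m * v ^ b * F1] and
    [G = u ^ n * v ^ d * G1], where [F1] and [G1] do not vanish. The exponents
    describe the edge at that point: [b] and [d] both positive mean that [v = 0]
    is another component, of quotient [b / d]; only [b] (only [d]) positive means
    that the strict transform of [f] (of [g]) passes there; and the edge leaves
    [E] exactly when [d * m < b * n] and enters [E] exactly when
    [b * n < d * m].

    The function [h = F ^ n / G ^ m] restricts on [E] to [v ^ (b * n - d * m)]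
    times a non-vanishing factor. If no edge enters [E], then [|h|] is a
    continuous function on the compact connected curve [E] which satisfies the
    maximum principle, so it is constant; it is not zero at a general point of
    [E], but it vanishes where an edge leaves [E], so no edge does ([balance]). Exchanging [f] and [g], an edge
    enters [E] if and only if one leaves it. There are finitely many components
    and weights increase along oriented edges, so every oriented edge extends
    in both directions to a maximal arc ([positive_edge_in_arcs]). Arrows are
    oriented edges. Outside the arcs there remain only vertices and edges whose
    ends have equal weights. For every [w], the function on the graph that is
    linear on edges, 1 on the vertices of weight [w] and 0 on the other nodes
    takes only the values 0 and 1 there ([weight_indicator]); it extends
    continuously to the ambient space, so it is constant on each connected
    subset of the closure.

    The local form of [F] and [G] is obtained from power series: after division
    by the largest monomial, a germ whose zeros lie on the axes is a unit
    ([analytic2_factor]), since otherwise its slices [H (u, .)] would have zeros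
    off the axes, by a minimum principle. The maximum principle follows from the
    leading term of a power series, and the minimum principle from polynomial
    approximation and the factorization of complex polynomials; neither uses
    integration. *)

Set Implicit Arguments.
Unset Strict Implicit.
Unset Printing Implicit Defensive.
Local Open Scope classical_set_scope.
Local Open Scope ring_scope.

(** * Modulus and neighbourhoods in C *)

Lemma exists_small3 (F : realFieldType) (a b c : F) : 0 < a -> 0 < b -> 0 < c ->
  exists t, [/\ 0 < t, t < a, t < b & t < c].
Proof.
move=> a0 b0 c0; exists (Num.min a (Num.min b c) / 2).
have half (x : F) : 0 < x -> x / 2 < x by lra.
have m0 : 0 < Num.min a (Num.min b c) by rewrite !lt_min a0 b0.
by split; [lra|..]; apply: lt_le_trans (half _ m0) _; rewrite !ge_min lexx ?orbT.
Qed.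

Section Modulus.
Variable R : realType.
Local Notation C := (CC R).
Implicit Types x y z : C.

(** The modulus with values in [R]: the norm of [CC R] takes its values in [CC R],
    whose order is only partial. *)
Definition nrm x : R := Normc.normc x.

Lemma nrmE x : `|x| = (nrm x)%:C%C. Proof. by []. Qed.

Lemma nrmM x y : nrm (x * y) = nrm x * nrm y.
Proof. exact: Normc.normcM. Qed.
Lemma nrmD x y : nrm (x + y) <= nrm x + nrm y.
Proof. exact: le_normcD. Qed.
Lemma nrmN x : nrm (- x) = nrm x.
Proof. exact: normcN. Qed.
Lemma nrm_ge0 x : 0 <= nrm x.
Proof. by have := normr_ge0 x; rewrite nrmE ler0c. Qed.
Lemma nrm0 : nrm 0 = 0. Proof. exact: Normc.normc0. Qed.
Lemma nrm1 : nrm 1 = 1. Proof. exact: Normc.normc1. Qed.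
Lemma nrm_eq0 x : (nrm x == 0) = (x == 0).
Proof. by rewrite -[RHS]normr_eq0 nrmE (inj_eq (@complexI R)). Qed.
Lemma nrm_gt0 x : (0 < nrm x) = (x != 0).
Proof. by rewrite lt_neqAle nrm_ge0 andbT eq_sym nrm_eq0. Qed.
Lemma nrmB x y : nrm (x - y) = nrm (y - x).
Proof. by rewrite -nrmN opprB. Qed.
Lemma nrmX x n : nrm (x ^+ n) = nrm x ^+ n.
Proof. by elim: n => [|n IH]; rewrite ?expr0 ?nrm1 // !exprS nrmM IH. Qed.
Lemma nrmC (r : R) : nrm r%:C%C = `|r|.
Proof. by rewrite /nrm /= expr0n /= addr0 sqrtr_sqr. Qed.
Lemma nrm_sum I (s : seq I) (P : pred I) (F : I -> C) :
  nrm (\sum_(i <- s | P i) F i) <= \sum_(i <- s | P i) nrm (F i).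
Proof.
elim/big_rec2: _ => [|i y1 y2 _ le12]; first by rewrite nrm0.
by apply: le_trans (nrmD _ _) _; rewrite lerD2l.
Qed.
Lemma nrm_prod I (s : seq I) (P : pred I) (F : I -> C) :
  nrm (\prod_(i <- s | P i) F i) = \prod_(i <- s | P i) nrm (F i).
Proof.
elim/big_rec2: _ => [|i y1 y2 _ <-]; first by rewrite nrm1.
by rewrite nrmM.
Qed.
Lemma nrm_dist x y : `|nrm x - nrm y| <= nrm (x - y).
Proof.
rewrite ler_norml; have := nrmD (x - y) y; have := nrmD (y - x) x.
by rewrite !subrK (nrmB y x); lra.
Qed.
Lemma nrm_tri x y z : nrm (x - z) <= nrm (x - y) + nrm (y - z).
Proof. by rewrite (_ : x - z = (x - y) + (y - z)) ?nrmD //; ring. Qed.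

Lemma nearC x (P : set C) :
  (\forall z \near x, P z) <->
  exists2 e : R, 0 < e & forall z, nrm (z - x) < e -> P z.
Proof.
split.
  move=> /nbhs_ballP[e /= e0 eP]; exists (complex.Re e).
    by move: e0; rewrite ltcE /= => /andP[].
  move=> z zx; apply: eP; rewrite /ball /= -opprB normrN nrmE.
  by rewrite ltcE /= zx andbT; move: e0; rewrite ltcE /= => /andP[].
move=> [e e0 eP]; apply/nbhs_ballP; exists e%:C%C => /=; first by rewrite ltcR.
by move=> z; rewrite /ball /= -opprB normrN nrmE ltcR => /eP.
Qed.

Lemma nearCC (x : C * C) (P : set (C * C)) :
  (\forall z \near x, P z) <->
  exists2 e : R, 0 < e &
    forall z : C * C, nrm (z.1 - x.1) < e -> nrm (z.2 - x.2) < e -> P z.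
Proof.
split.
  move=> [[A B]] /= [/nearC[e1 e10 A1] /nearC[e2 e20 B2]] AB.
  exists (Num.min e1 e2); first by rewrite lt_min e10.
  move=> [z1 z2] /=; rewrite !lt_min => /andP[h1 _] /andP[_ h2].
  by apply: AB; split => /=; [apply: A1|apply: B2].
move=> [e e0 eP]; exists ([set z : C | nrm (z - x.1) < e], [set z : C | nrm (z - x.2) < e]).
  by split; apply/nearC; exists e.
by move=> [z1 z2] /= [h1 h2]; apply: eP.
Qed.

Lemma nearCn n (x : Cn R n) (P : set (Cn R n)) :
  (\forall z \near x, P z) <->
  exists2 e : R, 0 < e &
    forall z : Cn R n, (forall i, nrm (z ord0 i - x ord0 i) < e) -> P z.
Proof.
split.
  move=> /nbhs_ballP[e /= e0 eP]; exists (complex.Re e).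
    by move: e0; rewrite ltcE /= => /andP[].
  move=> z zx; apply: eP; split=> // i j; rewrite /ball /= -opprB normrN nrmE.
  rewrite ord1 ltcE /=; apply/andP; split; last exact: zx.
  by move: e0; rewrite ltcE /= => /andP[].
move=> [e e0 eP]; apply/nbhs_ballP; exists e%:C%C => /=; first by rewrite ltcR.
move=> z [_ zx]; apply: eP => i; have := zx ord0 i.
by rewrite /ball /= -opprB normrN nrmE ltcR.
Qed.

Lemma cvgC (u : nat -> C) (l : C) :
  (u @ \oo --> l) <->
  forall e : R, 0 < e -> exists N, forall n, (N <= n)%N -> nrm (u n - l) < e.
Proof.
split.
  move=> ul e e0.
  have /ul : \forall z \near l, nrm (z - l) < e by apply/nearC; exists e.
  by move=> [N _ NP]; exists N.
move=> ul A /nearC[e e0 eA]; have [N NP] := ul _ e0.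
by exists N => // n /= Nn; apply/eA/NP.
Qed.

(** Real and imaginary parts reduce the completeness of C to that of R. *)
Lemma cauchyC (u : nat -> C) :
  (forall e : R, 0 < e -> exists N, forall m n, (N <= m)%N -> (N <= n)%N ->
    nrm (u m - u n) < e) -> exists l : C, u @ \oo --> l.
Proof.
move=> uC.
have leRe (z : C) : `|complex.Re z| <= nrm z.
  case: z => a b; rewrite /nrm /= -sqrtr_sqr ler_wsqrtr // lerDl sqr_ge0 //.
have leIm (z : C) : `|complex.Im z| <= nrm z.
  case: z => a b; rewrite /nrm /= -sqrtr_sqr ler_wsqrtr // lerDr sqr_ge0 //.
have leC (z : C) : nrm z <= `|complex.Re z| + `|complex.Im z|.
  rewrite [z in nrm z]complexE (le_trans (nrmD _ _)) // nrmM nrmC.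
  have -> : nrm 'i%C = 1 by rewrite /nrm /= expr0n add0r expr1n sqrtr1.
  by rewrite mul1r nrmC.
have ReB (x y : C) : complex.Re (x - y) = complex.Re x - complex.Re y.
  by case: x => ? ?; case: y.
have ImB (x y : C) : complex.Im (x - y) = complex.Im x - complex.Im y.
  by case: x => ? ?; case: y.
have key (p : C -> R) : (forall x y, p (x - y) = p x - p y) ->
    (forall z, `|p z| <= nrm z) -> exists l : R, (p \o u) @ \oo --> l.
  move=> pB pn; exists (lim ((p \o u) @ \oo)).
  apply: R_complete; apply: cauchy_exP => _/posnumP[e].
  have [N NP] := uC e%:num (gt0 e).
  exists (p (u N)); exists N => //= n Nn; rewrite /ball /= -pB.
  exact: le_lt_trans (pn _) (NP _ _ (leqnn _) Nn).
have [a ua] := key _ ReB leRe; have [b ub] := key _ ImB leIm.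
exists (Complex a b); apply/cvgC => e e0.
have e2 : 0 < e / 2 by lra.
have /cvgrPdist_lt/(_ _ e2)[N1 _ h1] := ua.
have /cvgrPdist_lt/(_ _ e2)[N2 _ h2] := ub.
exists (maxn N1 N2) => n; rewrite geq_max => /andP[n1 n2].
apply: le_lt_trans (leC _) _; rewrite ReB ImB /=.
have /= := h1 n n1; have /= := h2 n n2.
rewrite distrC => i2; rewrite distrC => i1; lra.
Qed.

End Modulus.
Arguments nrm : simpl never.

(** * Analytic germs of one variable *)

Section OneVariable.
Variable R : realType.
Local Notation C := (CC R).
Implicit Types (v c : C) (h : C -> C) (P Q : {poly C}) (r : R).

Lemma small_geo (K t e : R) : 0 <= K -> 0 <= t < 1 -> 0 < e ->
  exists N, K * t ^+ N < e.
Proof.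
move=> K0 /andP[t0 t1] e0.
have tn : `|t| < 1 by rewrite ger0_norm.
have K1 : 0 < e / (K + 1) by rewrite divr_gt0 //; lra.
have /cvgrPdist_lt/(_ _ K1)[N _ /(_ N (leqnn _))] := cvg_expr tn.
rewrite /= sub0r normrN ger0_norm ?exprn_ge0 // ltr_pdivlMr; last by lra.
by move=> ?; exists N; have := exprn_ge0 N t0; nra.
Qed.

Lemma le0_geo (x K t : R) : 0 <= K -> 0 <= t < 1 ->
  (forall N, x <= K * t ^+ N) -> x <= 0.
Proof.
move=> K0 t01 xN; rewrite leNgt; apply/negP => x0.
by have [N] := small_geo K0 t01 x0; rewrite ltNge xN.
Qed.

Definition pnorm P r : R := \sum_(k < size P) nrm P`_k * r ^+ k.

Lemma pnormE n P r : (size P <= n)%N ->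
  pnorm P r = \sum_(k < n) nrm P`_k * r ^+ k.
Proof.
move=> Pn; rewrite /pnorm (big_ord_widen _ (fun k => nrm P`_k * r ^+ k) Pn).
rewrite big_mkcond /=; apply: eq_bigr => i _; case: ltnP => // Pi.
by rewrite nth_default // nrm0 mul0r.
Qed.

Lemma pnorm_ge0 P r : 0 <= r -> 0 <= pnorm P r.
Proof. by move=> r0; apply: sumr_ge0 => i _; rewrite mulr_ge0 ?nrm_ge0 ?exprn_ge0. Qed.

Lemma pnorm_mono P r1 r2 : 0 <= r1 <= r2 -> pnorm P r1 <= pnorm P r2.
Proof.
move=> /andP[r0 r12]; apply: ler_sum => i _; rewrite ler_wpM2l ?nrm_ge0 //.
by rewrite lerXn2r ?nnegrE // (le_trans r0).
Qed.

Lemma pnormB P Q r : 0 <= r -> pnorm (P - Q) r <= pnorm P r + pnorm Q r.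
Proof.
move=> r0; set n := maxn (size P) (size Q).
have sPQ : (size (P - Q)%R <= n)%N.
  by rewrite (leq_trans (size_polyD _ _)) // size_polyN.
rewrite (pnormE _ sPQ) (pnormE _ (leq_maxl _ _ : _ <= n)%N).
rewrite (pnormE _ (leq_maxr _ _ : _ <= n)%N) -big_split /=.
apply: ler_sum => i _; rewrite -mulrDl ler_wpM2r ?exprn_ge0 // coefB.
by rewrite (le_trans (nrmD _ _)) // nrmN.
Qed.

Lemma pnorm_horner P r : pnorm P r = (\poly_(i < size P) nrm P`_i).[r].
Proof. by rewrite horner_poly. Qed.

Lemma pnormM P Q r : 0 <= r -> pnorm (P * Q) r <= pnorm P r * pnorm Q r.
Proof.
move=> r0; rewrite !pnorm_horner -hornerM.
set A := \poly_(i < size P) _; set B := \poly_(i < size Q) _.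
set n := maxn (size (P * Q)) (size (A * B)).
rewrite (horner_coef_wide r (leq_trans (size_poly _ _) (leq_maxl _ _ : _ <= n)%N)).
rewrite (horner_coef_wide r (leq_maxr _ _ : _ <= n)%N).
have coefA (T : {poly C}) i : (\poly_(i < size T) nrm T`_i)`_i = nrm T`_i.
  by rewrite coef_poly; case: ltnP => // ?; rewrite nth_default // nrm0.
apply: ler_sum => i _; rewrite coefA ler_wpM2r ?exprn_ge0 // !coefM.
apply: le_trans (nrm_sum _ _ _) _; apply: ler_sum => j _.
by rewrite nrmM !coefA.
Qed.

Lemma pnorm_tail P r N v : 0 < r -> nrm v <= r ->
  (forall k, (k < N)%N -> P`_k = 0) -> nrm P.[v] <= pnorm P r * (nrm v / r) ^+ N.
Proof.
move=> r0 vr PN; rewrite horner_coef (le_trans (nrm_sum _ _ _)) // mulr_suml.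
apply: ler_sum => i _; rewrite nrmM nrmX.
case: (ltnP i N) => [/PN ->|Ni]; first by rewrite nrm0 !mul0r.
rewrite -mulrA ler_wpM2l ?nrm_ge0 //.
have e : nrm v = r * (nrm v / r) by rewrite mulrC divfK // gt_eqF.
rewrite [X in X ^+ i]e exprMn ler_wpM2l ?exprn_ge0 ?(ltW r0) //.
apply: ler_wiXn2l => //; first by rewrite divr_ge0 ?nrm_ge0 ?ltW.
by rewrite ler_pdivrMr // mul1r.
Qed.

Lemma pnorm_bound P r v : 0 < r -> nrm v <= r -> nrm P.[v] <= pnorm P r.
Proof.
by move=> r0 vr; have := @pnorm_tail P r 0 v r0 vr; rewrite expr0 mulr1; apply.
Qed.

(** The remainder estimates characterize convergent power series; asking for
    polynomials with a common bound, rather than for the Taylor polynomials,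
    makes the stability under products immediate. *)
Definition analytic1_with h (K r : R) : Prop :=
  0 < r /\ forall N, exists P, pnorm P r <= K /\
    forall v, nrm v <= r -> nrm (h v - P.[v]) <= K * (nrm v / r) ^+ N.

Definition analytic1 h : Prop := exists K r, analytic1_with h K r.

Lemma analytic1_shrink h K r r' : analytic1_with h K r -> 0 < r' <= r ->
  analytic1_with h K r'.
Proof.
move=> [r0 hN] /andP[r'0 rr]; split=> // N; have [P [PK hP]] := hN N.
have K0 : 0 <= K by apply: le_trans (pnorm_ge0 P (ltW r0)) PK.
exists P; split; first by apply: le_trans PK; rewrite pnorm_mono // (ltW r'0).
move=> v vr; apply: le_trans (hP v (le_trans vr rr)) _.
have rr' : nrm v / r <= nrm v / r' by rewrite ler_wpM2l ?nrm_ge0 // lef_pV2.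
by rewrite ler_wpM2l // lerXn2r // nnegrE divr_ge0 ?nrm_ge0 // ltW.
Qed.

Lemma analytic1_common h1 h2 : analytic1 h1 -> analytic1 h2 ->
  exists K1 K2 r, [/\ 0 <= K1, 0 <= K2, analytic1_with h1 K1 r & analytic1_with h2 K2 r].
Proof.
move=> [K1 [r1 h1r]] [K2 [r2 h2r]]; exists K1, K2, (Num.min r1 r2).
have [r10 r20] : 0 < r1 /\ 0 < r2 by case: h1r h2r => ? _ [? _].
have m0 : 0 < Num.min r1 r2 by rewrite lt_min r10.
have ge0 h K r : analytic1_with h K r -> 0 <= K.
  by move=> [r0 /(_ 0%N)[P [PK _]]]; apply: le_trans (pnorm_ge0 P (ltW r0)) PK.
split; [exact: (ge0 h1 _ r1)|exact: (ge0 h2 _ r2)| |].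
- by apply: analytic1_shrink h1r _; rewrite m0 ge_min lexx.
- by apply: analytic1_shrink h2r _; rewrite m0 ge_min lexx orbT.
Qed.

Lemma analytic1M h1 h2 : analytic1 h1 -> analytic1 h2 ->
  analytic1 (fun v => h1 v * h2 v).
Proof.
move=> a1 a2; have [K1 [K2 [r [K10 K20 [r0 b1] [_ b2]]]]] := analytic1_common a1 a2.
exists (3 * (K1 * K2)), r; split=> // N.
have [P [PK hP]] := b1 N; have [Q [QK hQ]] := b2 N.
have K12 := mulr_ge0 K10 K20.
exists (P * Q); split.
  apply: le_trans (pnormM P Q (ltW r0)) _.
  apply: (@le_trans _ _ (K1 * K2)); last by lra.
  by rewrite ler_pM // pnorm_ge0 // ltW.
move=> v vr; rewrite hornerM.
have -> : h1 v * h2 v - P.[v] * Q.[v] =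
  (h1 v - P.[v]) * (h2 v - Q.[v]) + (h1 v - P.[v]) * Q.[v] +
   P.[v] * (h2 v - Q.[v]) by ring.
have t1 : (nrm v / r) ^+ N <= 1.
  by rewrite exprn_ile1 ?divr_ge0 ?nrm_ge0 ?(ltW r0) // ler_pdivrMr // mul1r.
have t0 : 0 <= (nrm v / r) ^+ N by rewrite exprn_ge0 // divr_ge0 ?nrm_ge0 ?ltW.
have bP := le_trans (pnorm_bound P r0 vr) PK.
have bQ := le_trans (pnorm_bound Q r0 vr) QK.
have eQ := hQ v vr; have eP := hP v vr.
apply: le_trans (nrmD _ _) _.
apply: le_trans (lerD (nrmD _ _) (lexx _)) _.
rewrite !nrmM; move: t1 t0 bP bQ eQ eP; set t := _ ^+ N.
move: (nrm_ge0 (h1 v - P.[v])) (nrm_ge0 (h2 v - Q.[v])) (nrm_ge0 P.[v]) (nrm_ge0 Q.[v]).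
set a := nrm (h1 v - P.[v]); set b := nrm (h2 v - Q.[v]).
set p := nrm P.[v]; set q := nrm Q.[v] => a0 b0 p0 q0 t1 t0 pK qK bt at_.
have e1 : a * b <= K1 * t * K2.
  by apply: ler_pM => //; apply: le_trans bt _; rewrite ler_piMr.
have e2 : a * q <= K1 * t * K2 by apply: ler_pM.
have e3 : p * b <= K1 * (K2 * t) by apply: ler_pM.
by nra.
Qed.

Lemma analytic1B h1 h2 : analytic1 h1 -> analytic1 h2 ->
  analytic1 (fun v => h1 v - h2 v).
Proof.
move=> a1 a2; have [K1 [K2 [r [K10 K20 [r0 b1] [_ b2]]]]] := analytic1_common a1 a2.
exists (K1 + K2), r; split=> // N.
have [P [PK hP]] := b1 N; have [Q [QK hQ]] := b2 N.
exists (P - Q); split; first by apply: le_trans (pnormB _ _ (ltW r0)) (lerD _ _).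
move=> v vr; rewrite hornerD hornerN.
have -> : h1 v - h2 v - (P.[v] - Q.[v]) = (h1 v - P.[v]) - (h2 v - Q.[v]) by ring.
by rewrite mulrDl (le_trans (nrmD _ _)) // nrmN lerD ?hP ?hQ.
Qed.

Lemma analytic1_poly P : analytic1 (fun v => P.[v]).
Proof.
exists (pnorm P 1), 1; split=> // N; exists P; split=> // v _.
rewrite subrr nrm0 mulr_ge0 ?pnorm_ge0 // exprn_ge0 // divr_ge0 ?nrm_ge0 //.
Qed.

Lemma analytic1_ext h1 h2 : h1 =1 h2 -> analytic1 h1 -> analytic1 h2.
Proof. by move=> /funext ->. Qed.

Lemma analytic1_cst c : analytic1 (fun=> c).
Proof.
by apply: analytic1_ext (analytic1_poly c%:P) => v; rewrite hornerC.
Qed.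

Lemma analytic1X h n : analytic1 h -> analytic1 (fun v => h v ^+ n).
Proof.
move=> ah; elim: n => [|n IH]; first exact: analytic1_cst.
by apply: analytic1_ext (analytic1M ah IH) => v; rewrite exprS.
Qed.

Lemma analytic1_id : analytic1 id.
Proof. by apply: analytic1_ext (analytic1_poly 'X) => v; rewrite hornerX. Qed.

Definition leading_term h c j : Prop :=
  exists (K r : R), [/\ 0 <= K, 0 < r &
    forall v, nrm v <= r -> nrm (h v - c * v ^+ j) <= K * nrm v ^+ j.+1].

(** A germ without a leading term is flat, hence vanishes by the remainder
    estimates at all orders. *)
Lemma analytic1_leading_term h : analytic1 h ->
  (exists2 r, 0 < r & forall v, nrm v < r -> h v = 0) \/
  exists c j, c != 0 /\ leading_term h c j.
Proof.
move=> [K [r [r0 hN]]].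
have K0 : 0 <= K.
  by case: (hN 0%N) => P [PK _]; apply: le_trans (pnorm_ge0 P (ltW r0)) PK.
have [flat|/existsNP[N nflat]] := pselect (forall N, exists P, [/\ pnorm P r <= K,
    forall v, nrm v <= r -> nrm (h v - P.[v]) <= K * (nrm v / r) ^+ N &
    forall k, (k < N)%N -> P`_k = 0]).
  left; exists r => // v vr; apply/eqP; rewrite -nrm_eq0 eq_le nrm_ge0 andbT.
  have t01 : 0 <= nrm v / r < 1.
    by rewrite divr_ge0 ?nrm_ge0 ?ltW // ltr_pdivrMr // mul1r.
  apply: (@le0_geo _ (2 * K) _ _ t01); first by lra.
  move=> N; have [P [PK hP P0]] := flat N.
  have := hP v (ltW vr); have := pnorm_tail r0 (ltW vr) P0.
  have : pnorm P r * (nrm v / r) ^+ N <= K * (nrm v / r) ^+ N.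
    by rewrite ler_wpM2r // exprn_ge0 //; case/andP: t01.
  have := nrmD (h v - P.[v]) P.[v]; rewrite subrK; lra.
right; have [P [PK hP]] := hN N.
have ex : exists k, (k < N)%N && (P`_k != 0).
  apply: contrapT => all0; apply: nflat; exists P; split=> // k kN.
  by apply: contrapT => /eqP Pk; apply: all0; exists k; rewrite kN.
case: (ex_minnP ex) => j /andP[jN cj] jmin; exists P`_j, j; split=> //.
exists (3 * K / r ^+ j.+1), r; split=> //.
  by rewrite divr_ge0 ?exprn_ge0 ?(ltW r0) //; lra.
move=> v vr.
set Q := P - P`_j *: 'X^j.
have Q0 k : (k < j.+1)%N -> Q`_k = 0.
  rewrite ltnS coefB coefZ coefXn leq_eqVlt => /orP[/eqP ->|kj].
    by rewrite eqxx mulr1 subrr.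
  rewrite (ltn_eqF kj) mulr0 subr0; apply/eqP/negP => /negP Pk.
  by have := jmin k; rewrite Pk (ltn_trans kj jN) leqNgt kj => /(_ isT).
have QK : pnorm Q r <= 2 * K.
  apply: le_trans (pnormB _ _ (ltW r0)) _.
  suff : pnorm (P`_j *: 'X^j) r <= pnorm P r by lra.
  have sP : (j < size P)%N.
    by rewrite ltnNge; apply: contra cj => ?; rewrite nth_default.
  have sX : (size (P`_j *: 'X^j) <= size P)%N.
    by rewrite (leq_trans (size_scale_leq _ _)) // size_polyXn.
  rewrite (pnormE _ sX); apply: ler_sum => i _.
  rewrite coefZ coefXn ler_wpM2r ?exprn_ge0 ?(ltW r0) //.
  by case: eqP => [->|_]; rewrite ?mulr1 ?mulr0 ?nrm0 ?nrm_ge0.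
have t01 : 0 <= nrm v / r <= 1.
  by rewrite divr_ge0 ?nrm_ge0 ?(ltW r0) // ler_pdivrMr // mul1r.
have e1 := pnorm_tail r0 vr Q0.
have e2 : pnorm Q r * (nrm v / r) ^+ j.+1 <= 2 * K * (nrm v / r) ^+ j.+1.
  by rewrite ler_wpM2r // exprn_ge0 //; case/andP: t01.
have e3 : K * (nrm v / r) ^+ N <= K * (nrm v / r) ^+ j.+1.
  by rewrite ler_wpM2l // ler_wiXn2l //; case/andP: t01.
have -> : h v - P`_j * v ^+ j = (h v - P.[v]) + Q.[v].
  by rewrite /Q hornerD hornerN hornerZ hornerXn; ring.
have -> : 3 * K / r ^+ j.+1 * nrm v ^+ j.+1 = 3 * K * (nrm v / r) ^+ j.+1.
  by rewrite expr_div_n; ring.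
by apply: le_trans (nrmD _ _) _; have := hP v vr; lra.
Qed.

Lemma analytic1_lipschitz h : analytic1 h ->
  exists K r : R, [/\ 0 <= K, 0 < r &
    forall v, nrm v <= r -> nrm (h v - h 0) <= K * nrm v].
Proof.
move=> ah; have [[r r0 h0]|[c [j [c0 [K [r [K0 r0 hv]]]]]]] :=
  analytic1_leading_term (analytic1B ah (analytic1_cst (h 0))).
  exists 0, (r / 2); split=> //; first by rewrite divr_gt0.
  by move=> v vr; rewrite h0 ?nrm0 ?mul0r //; apply: le_lt_trans vr _; lra.
case: j hv => [|j] hv.
  have := hv 0; rewrite nrm0 (ltW r0) subrr expr0 mulr1 sub0r nrmN expr1 mulr0 => /(_ isT).
  by rewrite leNgt nrm_gt0 c0.
exists (K * r ^+ j.+1 + nrm c * r ^+ j), r; split=> //.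
  by rewrite addr_ge0 ?mulr_ge0 ?nrm_ge0 ?exprn_ge0 ?(ltW r0).
move=> v vr; rewrite -[h v - h 0](subrK (c * v ^+ j.+1)).
apply: le_trans (nrmD _ _) _; apply: le_trans (lerD (hv v vr) (lexx _)) _.
rewrite nrmM nrmX mulrDl; have v0 := nrm_ge0 v.
have rj k : nrm v ^+ k <= r ^+ k by rewrite lerXn2r ?nnegrE // ltW.
apply: lerD.
  by rewrite exprSr mulrA ler_wpM2r // ler_wpM2l.
by rewrite exprSr mulrA ler_wpM2r // ler_wpM2l ?nrm_ge0.
Qed.

End OneVariable.

(** * Maximum and minimum principles *)

Section ExtremumPrinciples.
Variable R : realType.
Local Notation C := (CC R).
Implicit Types (v c : C) (h : C -> C) (P Q : {poly C}) (r : R).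

Lemma prodr_const_seq (K : pzSemiRingType) (I : Type) (s : seq I) (x : K) :
  \prod_(i <- s) x = x ^+ size s.
Proof. by elim: s => [|i s IH]; rewrite ?big_nil // big_cons IH exprS. Qed.

(** In particular the zero at the origin is isolated or absent. *)
Lemma leading_term_lower h c j : c != 0 -> leading_term h c j ->
  exists2 r, 0 < r & forall v, nrm v < r -> nrm c / 2 * nrm v ^+ j <= nrm (h v).
Proof.
rewrite -nrm_gt0 => c0 [K [r [K0 r0 hv]]].
have K1 : 0 < 2 * (K + 1) by lra.
exists (Num.min r (nrm c / (2 * (K + 1)))); first by rewrite lt_min r0 divr_gt0.
move=> v; rewrite lt_min => /andP[vr vc].
have {}vc : nrm v * (2 * (K + 1)) < nrm c by rewrite -ltr_pdivlMr.
have v0 := nrm_ge0 v.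
have e1 : K * nrm v ^+ j.+1 <= nrm c / 2 * nrm v ^+ j.
  by rewrite exprS mulrA ler_wpM2r ?exprn_ge0 //; nra.
have := hv v (ltW vr); have := nrmD (h v) (c * v ^+ j - h v).
by rewrite subrKC nrmB nrmM nrmX; lra.
Qed.

(** The statement is about [a / b], freed from denominators. A non-constant [a / b]
    is a constant plus [c * v ^+ j] up to higher order terms, and [v] can be
    chosen so that this term points in the direction of the constant, which
    increases the modulus. *)
Lemma maximum_principle (a b : C -> C) r : analytic1 a -> analytic1 b -> 0 < r ->
  (forall v, nrm v < r -> nrm (a v) * nrm (b 0) <= nrm (a 0) * nrm (b v)) ->
  b 0 != 0 ->
  exists2 r', 0 < r' & forall v, nrm v < r' -> a v * b 0 = a 0 * b v.
Proof.
move=> aa ab r0 max b0.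
have aD := analytic1B (analytic1M aa (analytic1_cst (b 0)))
                      (analytic1M (analytic1_cst (a 0)) ab).
have [[r' r'0 D0]|[c [j [c0 lt]]]] := analytic1_leading_term aD.
  by exists r' => // v /D0/eqP; rewrite subr_eq0 => /eqP.
exfalso; have [r1 r10 lower] := leading_term_lower c0 lt.
have nc0 : 0 < nrm c by rewrite nrm_gt0.
have nb0 : 0 < nrm (b 0) by rewrite nrm_gt0.
have jpos : (0 < j)%N.
  rewrite lt0n; apply/negP => /eqP j0; have := lower 0; rewrite nrm0 => /(_ r10).
  by rewrite j0 expr0 mulr1 mulrC subrr nrm0; lra.
have small (A B : R) : 0 <= A -> 0 < B -> exists2 t : R, 0 < t & t * A < B.
  move=> A0 B0; exists (B / (A + 1)); first by rewrite divr_gt0 //; lra.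
  by rewrite -mulrAC ltr_pdivrMr; nra.
have [a0|a0] := eqVneq (a 0) 0.
  have m0 : 0 < Num.min r r1 by rewrite lt_min r0.
  have [t t0] := small 1 _ ler01 m0; rewrite mulr1 lt_min => /andP[tr tr1].
  have nt : nrm (t%:C%C : C) = t by rewrite nrmC ger0_norm // ltW.
  have := max t%:C%C; rewrite nt a0 nrm0 mul0r => /(_ tr).
  rewrite pmulr_lle0 // => at0.
  have /eqP : nrm (a t%:C%C) = 0 by apply/eqP; rewrite eq_le at0 nrm_ge0.
  rewrite nrm_eq0 => /eqP {}at0; have := lower t%:C%C.
  rewrite nt at0 a0 !mul0r subrr nrm0 => /(_ tr1).
  by rewrite leNgt mulr_gt0 ?exprn_gt0 // divr_gt0.
have [L [r2 [L0 r20 lip]]] := analytic1_lipschitz ab.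
have [K [r3 [K0 r30 ltD]]] := lt.
(* Along the real multiples of [zeta], the leading term is a positive multiple of [a 0 * b 0]. *)
pose zeta : C := j.-root (a 0 * b 0 / c : R[i]).
have zj : c * zeta ^+ j = a 0 * b 0.
  by rewrite /zeta (rootCK jpos) mulrC divfK.
pose z := nrm zeta; have z0 : 0 <= z := nrm_ge0 _.
pose X0 := a 0 * b 0; have X00 : 0 < nrm X0 by rewrite nrm_gt0 mulf_neq0.
pose G := nrm (a 0) * L * z + K * z ^+ j.+1.
have a00 := nrm_ge0 (a 0).
have G1 : 0 <= nrm (a 0) * L * z by rewrite !mulr_ge0.
have G2 : 0 <= K * z ^+ j.+1 by rewrite mulr_ge0 // exprn_ge0.
have m0 : 0 < Num.min (Num.min r r2) (Num.min r3 (nrm X0)) by rewrite !lt_min r0 r20 r30.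
have A0 : 0 <= z + 2 * G by rewrite /G; lra.
have [t t0] := small _ _ A0 m0.
rewrite !lt_min => /andP[/andP[tr tr2] /andP[tr3 tX]].
have tz : t * z <= t * (z + 2 * G) by rewrite ler_wpM2l ?(ltW t0) // /G; lra.
pose v : C := t%:C%C * zeta.
have nv : nrm v = t * z by rewrite nrmM nrmC ger0_norm // ltW.
have vr : nrm v < r by rewrite nv; apply: le_lt_trans tr.
have vr2 : nrm v <= r2 by rewrite nv; apply: le_trans (ltW tr2).
have vr3 : nrm v <= r3 by rewrite nv; apply: le_trans (ltW tr3).
pose X := a 0 * b v.
have XX0 : nrm (X - X0) <= t * (nrm (a 0) * L * z).
  rewrite -mulrBr nrmM; apply: le_trans (ler_wpM2l a00 (lip v vr2)) _.
  by rewrite nv; lra.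
have cv : c * v ^+ j = (t ^+ j)%:C%C * X0.
  rewrite /v /X0 -zj exprMn rmorphXn /=; ring.
have := ltD v vr3; rewrite cv; set E := _ - _ => leE.
have tj0 : 0 < t ^+ j by rewrite exprn_gt0.
have {}leE : nrm E <= t ^+ j * (t * (K * z ^+ j.+1)).
  by apply: le_trans leE _; rewrite nv exprMn exprS; lra.
have eqX : a v * b 0 + ((t ^+ j)%:C%C * (X - X0) - E) = (1 + t ^+ j)%:C%C * X.
  by rewrite /E /X rmorphD /=; ring.
have := nrmD (a v * b 0) ((t ^+ j)%:C%C * (X - X0) - E).
rewrite eqX [nrm (_%:C%C * X)]nrmM nrmC ger0_norm; last by lra.
have := nrmD ((t ^+ j)%:C%C * (X - X0)) (- E); rewrite nrmN.
rewrite [nrm (_%:C%C * _)]nrmM nrmC (ger0_norm (ltW tj0)).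
have := max v vr; rewrite -!nrmM -/X => leX.
have e1 : t ^+ j * nrm (X - X0) <= t ^+ j * (t * (nrm (a 0) * L * z)).
  by rewrite ler_wpM2l // ltW.
move=> e2 e3.
have : t ^+ j * nrm X <= t ^+ j * (t * G).
  by move: e1 e2 e3 leX leE; rewrite /G; clear => *; lra.
rewrite ler_pM2l // => e4.
have := nrmD X (X0 - X); rewrite subrKC nrmB => e5.
have e6 : t * (2 * G) <= t * (z + 2 * G) by rewrite ler_wpM2l ?(ltW t0) // lerDr.
have : 0 <= t * (K * z ^+ j.+1) by rewrite mulr_ge0 // ltW.
by move: tX e4 e5 e6 XX0; rewrite /G; clear => *; lra.
Qed.

(** The product of the values of [P] at the roots of ['X^N - r^N], all of modulus
    [r], is at least [d ^ N] in modulus. It equals, up to sign, the [N]-th power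
    of the leading coefficient times the product of [z ^ N - r ^ N] over the
    roots [z] of [P], which is at most [2 ^ deg P * |P(0)| ^ N] when all [z] lie
    outside the disc. The power of 2 is negligible for large [N]. *)
Lemma poly_minimum_principle P r (d : R) : 0 < r -> 0 < d ->
  (forall v, nrm v <= r -> P.[v] != 0) ->
  (forall v, nrm v = r -> d <= nrm P.[v]) -> d <= nrm P.[0].
Proof.
move=> r0 d0 Pn0 Pd; rewrite leNgt; apply/negP => P0d.
have P00 : 0 < nrm P.[0] by rewrite nrm_gt0 Pn0 // nrm0 ltW.
have [zs Pzs] := closed_field_poly_normal P.
move: (lead_coef P) Pzs => lc Pzs.
have Pz z : z \in zs -> r < nrm z.
  move=> zzs; rewrite ltNge; apply/negP => /Pn0.
  rewrite Pzs hornerZ horner_prod (big_rem z) //= hornerXsubC subrr mul0r mulr0.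
  by rewrite eqxx.
have bound N : (0 < N)%N -> d ^+ N <= 2 ^+ size zs * nrm P.[0] ^+ N.
  move=> N0; pose q : {poly C} := 'X^N - (r%:C%C ^+ N)%:P.
  have [ws qws] := closed_field_poly_normal q.
  have lq : lead_coef q = 1.
    exact: lead_coefXnsubC.
  rewrite lq scale1r in qws.
  have sws : size ws = N.
    by apply: succn_inj; rewrite -(size_prod_XsubC ws id) -qws size_XnsubC.
  have qE z : q.[z] = z ^+ N - r%:C%C ^+ N by rewrite /q !hornerE.
  have nr : nrm (r%:C%C : C) = r by rewrite nrmC ger0_norm // ltW.
  have wr w : w \in ws -> nrm w = r.
    move=> wws; have : q.[w] = 0.
      by rewrite qws horner_prod (big_rem w) //= hornerXsubC subrr mul0r.
    rewrite qE => /eqP; rewrite subr_eq0 => /eqP /(congr1 (@nrm R)).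
    rewrite !nrmX nr => /eqP; rewrite eqrXn2 ?nrm_ge0 ?(ltW r0) //.
    by move/eqP.
  have e1 : d ^+ N <= \prod_(w <- ws) nrm P.[w].
    rewrite -sws -prodr_const_seq; rewrite big_seq [leRHS]big_seq.
    by apply: ler_prod => w wws; rewrite (ltW d0) Pd // wr.
  apply: (le_trans e1); rewrite -nrm_prod.
  have -> : \prod_(w <- ws) P.[w] = lc ^+ N * \prod_(z <- zs) \prod_(w <- ws) (w - z).
    rewrite (eq_bigr (fun w => lc * \prod_(z <- zs) (w - z))); last first.
      move=> w _; rewrite Pzs hornerZ horner_prod; congr (_ * _).
      by apply: eq_bigr => z _; rewrite hornerXsubC.
    rewrite big_split /= prodr_const_seq sws; congr (_ * _).
    exact: exchange_big.
  have -> : nrm P.[0] = nrm lc * \prod_(z <- zs) nrm z.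
    rewrite {1}Pzs hornerZ horner_prod nrmM nrm_prod; congr (_ * _).
    by apply: eq_bigr => z _; rewrite hornerXsubC sub0r nrmN.
  rewrite nrmM nrmX exprMn [2 ^+ _ * _]mulrCA ler_wpM2l ?exprn_ge0 ?nrm_ge0 //.
  rewrite nrm_prod -prodrXl -prodr_const_seq -big_split /=.
  rewrite big_seq [leRHS]big_seq; apply: ler_prod => z zzs; rewrite nrm_ge0 /=.
  have -> : nrm (\prod_(w <- ws) (w - z)) = nrm q.[z].
    rewrite qws horner_prod !nrm_prod; apply: eq_bigr => w _.
    by rewrite hornerXsubC nrmB.
  rewrite qE; apply: le_trans (nrmD _ _) _; rewrite nrmN !nrmX nr.
  have : r ^+ N <= nrm z ^+ N by rewrite lerXn2r ?nnegrE ?nrm_ge0 ?ltW // Pz.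
  lra.
have t01 : 0 <= nrm P.[0] / d < 1.
  by rewrite divr_ge0 ?nrm_ge0 ?(ltW d0) // ltr_pdivrMr // mul1r.
have two0 : 0 <= 2 ^+ size zs :> R by rewrite exprn_ge0.
have [[|N]] := small_geo two0 t01 ltr01.
  by rewrite expr0 mulr1 ltNge exprn_ege1 // ler1n.
rewrite expr_div_n mulrA ltr_pdivrMr ?exprn_gt0 // mul1r ltNge.
by rewrite bound.
Qed.

Definition poly_approximable h r : Prop :=
  forall e : R, 0 < e -> exists P, forall v, nrm v <= r -> nrm (h v - P.[v]) < e.

Lemma poly_continuous P v : {for v, continuous (fun x : C => P.[x])}.
Proof.
have := analytic1_lipschitz (analytic1_poly (P \Po ('X + v%:P))).
move=> [K [r [K0 r0 lip]]].
move=> A /nearC[e e0 eA]; apply/nearC.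
exists (Num.min r (e / (K + 1))); first by rewrite lt_min r0 divr_gt0 //; lra.
move=> w; rewrite lt_min => /andP[wr we]; apply: eA.
have := lip (w - v) (ltW wr); rewrite !horner_comp !hornerE subrK ?add0r.
have we' : nrm (w - v) * (K + 1) < e by rewrite -ltr_pdivlMr //; lra.
by have := nrm_ge0 (w - v); nra.
Qed.

(** A positive lower bound of the modulus transfers the absence of zeros from [h] to
    its polynomial approximations. It is obtained by compactness on a square
    containing the disc, hence the radius [2 * r] in the hypotheses. *)
Lemma minimum_principle h r (d : R) : 0 < r -> 0 < d ->
  poly_approximable h (2 * r) ->
  (forall v, nrm v <= 2 * r -> h v != 0) ->
  (forall v, nrm v = r -> d <= nrm (h v)) -> d <= nrm (h 0).
Proof.
move=> r0 d0 happ hn0 hd.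
pose A : set (R * R) := `[- r, r]%classic `*` `[- r, r]%classic.
pose toC (p : R * R) : C := Complex p.1 p.2.
have toCD (p q : R * R) : nrm (toC p - toC q) <= `|p.1 - q.1| + `|p.2 - q.2|.
  have -> : toC p - toC q = (p.1 - q.1)%:C%C + 'i%C * (p.2 - q.2)%:C%C.
    by apply/eqP; rewrite eq_complex /= ; apply/andP; split; apply/eqP; ring.
  apply: le_trans (nrmD _ _) _; rewrite nrmM !nrmC.
  by have -> : nrm ('i%C : C) = 1 by [rewrite /nrm /= expr0n add0r expr1n sqrtr1]; rewrite mul1r.
have cA : compact A by apply: compact_setX; apply: segment_compact.
have toCr p : A p -> nrm (toC p) <= 2 * r.
  case: p => x y [] /=; rewrite !in_itv /= -!ler_norml => xr yr.
  have := toCD (x, y) (0, 0); rewrite -[toC (0, 0)]/(0 : C) /= !subr0.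
  lra.
have ch : {within A, continuous (fun p => nrm (h (toC p)))}.
  apply/subspace_continuousP => p Ap; apply/cvgrPdist_lt => e e0.
  have e3 : 0 < e / 3 by lra.
  have [P hP] := happ _ e3.
  have : \forall w \near toC p, nrm (P.[w] - P.[toC p]) < e / 3.
    have := @poly_continuous P (toC p) [set w : C | nrm (w - P.[toC p]) < e / 3].
    by apply; apply/nearC; exists (e / 3).
  move=> /nearC[s s0 sP]; have s2 : 0 < s / 2 by lra.
  rewrite near_withinE; near=> q => Aq.
  have pq : nrm (toC q - toC p) < s.
    apply: le_lt_trans (toCD _ _) _.
    have q1 : `|p.1 - q.1| < s / 2.
      near: q; have /cvgrPdist_lt/(_ _ s2) : fst @ nbhs p --> p.1 by exact: cvg_fst.
      by [].
    have q2 : `|p.2 - q.2| < s / 2.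
      near: q; have /cvgrPdist_lt/(_ _ s2) : snd @ nbhs p --> p.2 by exact: cvg_snd.
      by [].
    by rewrite distrC [X in _ + X]distrC; lra.
  apply: le_lt_trans (nrm_dist _ _) _.
  have := hP _ (toCr _ Ap); have := hP _ (toCr _ Aq); have := sP _ pq => /=.
  have := nrm_tri (h (toC p)) P.[toC p] (h (toC q)).
  have := nrm_tri P.[toC p] P.[toC q] (h (toC q)).
  rewrite (nrmB P.[toC p] P.[toC q]) (nrmB P.[toC q] (h _)); lra.
have A0 : A !=set0 by exists (0, 0); split; rewrite /= in_itv /=; lra.
have [p pA pmin] := compact_EVT_min A0 cA ch.
set eta := nrm (h (toC p)) in pmin.
have eta0 : 0 < eta by rewrite nrm_gt0 hn0 // toCr //; apply/set_mem.
have hmin v : nrm v <= r -> eta <= nrm (h v).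
  move=> vr; have -> : v = toC (complex.Re v, complex.Im v) by case: v vr.
  apply: pmin; apply/mem_set.
  have le2 (x y : R) : Num.sqrt (x ^+ 2 + y ^+ 2) <= r -> `|x| <= r.
    by apply: le_trans; rewrite -sqrtr_sqr ler_wsqrtr // lerDl sqr_ge0.
  case: v vr => x y; rewrite /nrm /= => vr.
  split; rewrite /= in_itv /= -ler_norml; first exact: le2 vr.
  by apply: le2; rewrite addrC; exact: vr.
rewrite leNgt; apply/negP => h0d.
have dh0 : 0 < d - nrm (h 0) by rewrite subr_gt0.
have [e [e0 e1 e2 e3]] : exists e : R,
    [/\ 0 < e, 2 * e <= eta, 2 * e <= d & 2 * e <= d - nrm (h 0)].
  have [t [t0 t1 t2 t3]] := exists_small3 eta0 d0 dh0.
  by exists (t / 2); clear - t0 t1 t2 t3; split; lra.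
have [P hP] := happ _ e0.
have hP' v : nrm v <= r -> nrm (h v) - e < nrm P.[v] /\ nrm P.[v] < nrm (h v) + e.
  move=> vr; have vr2 : nrm v <= 2 * r by lra.
  have := hP v vr2; have := nrm_dist (h v) P.[v]; rewrite ler_norml => /andP[]; lra.
have z_r : nrm (0 : C) <= r by rewrite nrm0 ltW.
have de0 : 0 < d - e by lra.
have : d - e <= nrm P.[0].
  apply: (@poly_minimum_principle P r) => //.
    move=> v vr; rewrite -nrm_gt0; have [] := hP' v vr; have := hmin v vr; lra.
  by move=> v vr; have [] := hP' v; [rewrite vr|have := hd v vr; lra].
by have [] := hP' 0 z_r; lra.
Unshelve. all: by end_near.
Qed.

End ExtremumPrinciples.

(** * Power series in two variables *)

Section TwoVariables.
Variable R : realType.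
Local Notation C := (CC R).
Implicit Types (w : C * C) (H : C * C -> C) (a b : nat -> nat -> C) (r M rho : R).

Definition sum2 a K L w : C := \sum_(k < K) \sum_(l < L) a k l * (w.1 ^+ k * w.2 ^+ l).

Definition norm2 a K L r : R := \sum_(k < K) \sum_(l < L) nrm (a k l) * r ^+ (k + l).

Definition summable2 a r M : Prop := 0 < r /\ forall K L, norm2 a K L r <= M.

Definition in_bidisc w rho : Prop := nrm w.1 <= rho /\ nrm w.2 <= rho.

(** Rectangular partial sums are allowed because dividing by a monomial shifts the
    two indices differently. The bound on [w] is a free parameter, so that the
    estimate yields at once continuity, Lipschitz bounds and slices. *)
Definition expansion H a r M : Prop := summable2 a r M /\
  forall rho w N K L, rho <= r -> in_bidisc w rho -> (N <= K)%N -> (N <= L)%N ->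
    nrm (H w - sum2 a K L w) <= M * (rho / r) ^+ N.

Definition analytic2 H : Prop := exists a r M, expansion H a r M.

(** Sums over nested rectangles are compared inside the larger one. *)
Lemma widen2 (T : nmodType) (F : nat -> nat -> T) K L K' L' :
  (K <= K')%N -> (L <= L')%N ->
  \sum_(k < K) \sum_(l < L) F k l =
  \sum_(k < K') \sum_(l < L') (if (k < K)%N && (l < L)%N then F k l else 0).
Proof.
move=> KK LL; rewrite (big_ord_widen K' (fun k => \sum_(l < L) F k l) KK) big_mkcond /=.
apply: eq_bigr => k _; case: (k < K)%N => /=; last by rewrite big1.
by rewrite (big_ord_widen L' (fun l => F k l) LL) big_mkcond.
Qed.

Lemma in_bidisc_ge0 w rho : in_bidisc w rho -> 0 <= rho.
Proof. by move=> [+ _]; apply: le_trans; exact: nrm_ge0. Qed.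

Lemma norm2_ge0 a K L r : 0 <= r -> 0 <= norm2 a K L r.
Proof.
move=> r0; apply: sumr_ge0 => k _; apply: sumr_ge0 => l _.
by rewrite mulr_ge0 ?nrm_ge0 ?exprn_ge0.
Qed.

Lemma summable2_ge0 a r M : summable2 a r M -> 0 <= M.
Proof. by move=> [r0 /(_ 0 0)%N]; apply: le_trans; rewrite norm2_ge0 // ltW. Qed.

Lemma summable2_shrink a r M r' : summable2 a r M -> 0 < r' <= r -> summable2 a r' M.
Proof.
move=> [r0 aM] /andP[r'0 rr]; split=> // K L; apply: le_trans (aM K L).
apply: ler_sum => k _; apply: ler_sum => l _.
by rewrite ler_wpM2l ?nrm_ge0 // lerXn2r ?nnegrE ?(ltW r0) ?(ltW r'0).
Qed.

(** Each monomial beyond the rectangle has degree at least [N], hence the factor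
    [(rho / r) ^ N]. *)
Lemma sum2_tail a r M rho w N K L K' L' : summable2 a r M -> rho <= r ->
  in_bidisc w rho -> (N <= K <= K')%N -> (N <= L <= L')%N ->
  nrm (sum2 a K' L' w - sum2 a K L w) <= M * (rho / r) ^+ N.
Proof.
move=> [r0 aM] rr w_rho /andP[NK KK] /andP[NL LL].
have rho0 := in_bidisc_ge0 w_rho; case: w_rho => w1 w2.
rewrite {2}/sum2 (widen2 (fun k l => a k l * (w.1 ^+ k * w.2 ^+ l)) KK LL) -sumrB.
have t0 : 0 <= rho / r by rewrite divr_ge0 // ltW.
have t1 : rho / r <= 1 by rewrite ler_pdivrMr // mul1r.
apply: le_trans (ler_wpM2r (exprn_ge0 N t0) (aM K' L')).
rewrite /norm2 mulr_suml; apply: le_trans (nrm_sum _ _ _) _; apply: ler_sum => k _.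
rewrite mulr_suml -sumrB; apply: le_trans (nrm_sum _ _ _) _; apply: ler_sum => l _.
have rt : rho = r * (rho / r) by rewrite mulrC divfK // gt_eqF.
case: ifPn => [_|kl].
  by rewrite subrr nrm0 mulr_ge0 ?exprn_ge0 // mulr_ge0 ?nrm_ge0 // exprn_ge0 // ltW.
rewrite subr0 nrmM -mulrA ler_wpM2l ?nrm_ge0 // nrmM !nrmX.
apply: (@le_trans _ _ (rho ^+ (k + l))).
  by rewrite exprD ler_pM ?exprn_ge0 ?nrm_ge0 // lerXn2r ?nnegrE ?nrm_ge0.
rewrite {1}rt exprMn ler_wpM2l ?exprn_ge0 ?(ltW r0) // ler_wiXn2l //.
by move: kl; rewrite negb_and -!leqNgt => /orP[]; lia.
Qed.

Lemma expansion_of_limit H a r M r' : summable2 a r M -> 0 < r' <= r ->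
  (forall w, in_bidisc w r' -> (fun N => sum2 a N N w) @ \oo --> H w) ->
  expansion H a r' M.
Proof.
move=> aM rr lim; have aM' := summable2_shrink aM rr; split=> //.
move=> rho w N K L rho_r w_rho NK NL; apply/ler_addgt0Pr => e e0.
have w_r : in_bidisc w r' by case: w_rho => w1 w2; split; apply: le_trans rho_r.
have /cvgC/(_ e e0)[N0 hN0] := lim w w_r.
have := hN0 (maxn N0 (maxn K L)) (leq_maxl _ _).
set N1 := maxn N0 _ => h1.
have KN : (N <= K <= N1)%N by rewrite NK /N1 !leq_max leqnn orbT.
have LN : (N <= L <= N1)%N by rewrite NL /N1 !leq_max leqnn !orbT.
have := sum2_tail aM' rho_r w_rho KN LN.
have := nrm_tri (H w) (sum2 a N1 N1 w) (sum2 a K L w).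
by rewrite (nrmB (H w) (sum2 a N1 N1 w)); lra.
Qed.

Lemma summable2_cvg a r M w rho : summable2 a r M -> rho < r -> in_bidisc w rho ->
  exists l : C, (fun N => sum2 a N N w) @ \oo --> l.
Proof.
move=> aM rho_r w_rho; apply: cauchyC => e e0.
have r0 := aM.1; have rho0 := in_bidisc_ge0 w_rho.
have t01 : 0 <= rho / r < 1.
  by rewrite divr_ge0 ?(ltW r0) // ltr_pdivrMr // mul1r.
have [N hN] := small_geo (summable2_ge0 aM) t01 e0.
exists N => m n; wlog mn : m n / (m <= n)%N => [wl|] Nm Nn.
  by case/orP: (leq_total m n) => mn; [|rewrite nrmB]; apply: wl.
rewrite nrmB; apply: le_lt_trans hN.
by apply: (sum2_tail aM (ltW rho_r) w_rho); rewrite Nm.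
Qed.

Lemma summable2_expansion a r M : summable2 a r M ->
  exists H r', expansion H a r' M.
Proof.
move=> aM; have r0 := aM.1.
have rr : r / 2 < r by lra.
have /choice[H HP] : forall w, exists l : C, in_bidisc w (r / 2) ->
    (fun N => sum2 a N N w) @ \oo --> l.
  move=> w; have [w_r|nw] := pselect (in_bidisc w (r / 2)).
    by have [l hl] := summable2_cvg aM rr w_r; exists l.
  by exists 0.
by exists H, (r / 2); apply: (expansion_of_limit aM) => //; lra.
Qed.

Definition swap w : C * C := (w.2, w.1).

Lemma expansion_swap H a r M : expansion H a r M ->
  expansion (H \o swap) (fun k l => a l k) r M.
Proof.
have n2 K L r' : norm2 (fun k l => a l k) K L r' = norm2 a L K r'.
  rewrite /norm2 exchange_big; apply: eq_bigr => k _; apply: eq_bigr => l _.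
  by rewrite addnC.
have s2 K L w : sum2 (fun k l => a l k) K L w = sum2 a L K (swap w).
  rewrite /sum2 exchange_big; apply: eq_bigr => k _; apply: eq_bigr => l _.
  by rewrite /= [w.1 ^+ _ * _]mulrC.
move=> [[r0 aM] HM]; split; first by split=> // K L; rewrite n2.
move=> rho w N K L rr [w1 w2] NK NL; rewrite s2; exact: HM.
Qed.

Lemma analytic2_swap H : analytic2 H -> analytic2 (H \o swap).
Proof. by move=> [a [r [M /expansion_swap]]]; exists (fun k l => a l k), r, M. Qed.

Lemma sum2_00 a w : sum2 a 1 1 w = a 0%N 0%N.
Proof. by rewrite /sum2 !big_ord1 !expr0 !mulr1. Qed.

Lemma analytic2_lipschitz H : analytic2 H -> exists K r, [/\ 0 <= K, 0 < r &
  forall w rho, rho <= r -> in_bidisc w rho -> nrm (H w - H (0, 0)) <= K * rho].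
Proof.
move=> [a [r [M [aM HM]]]]; have r0 := aM.1; have M0 := summable2_ge0 aM.
have H0 : H (0, 0) = a 0%N 0%N.
  have d0 : in_bidisc (0, 0) 0 by split; rewrite /= nrm0.
  have := HM 0 (0, 0) 1%N 1%N 1%N (ltW r0) d0 isT isT.
  rewrite sum2_00 mul0r expr1 mulr0 => h; apply/eqP; rewrite -subr_eq0 -nrm_eq0.
  by rewrite eq_le h nrm_ge0.
exists (M / r), r; split=> //; first by rewrite divr_ge0 // ltW.
move=> w rho rr w_rho; have := HM rho w 1%N 1%N 1%N rr w_rho isT isT.
by rewrite sum2_00 H0 expr1 mulrA mulrAC.
Qed.

Lemma sum2_poly1 a K L (v : C) :
  sum2 a K.+1 L (0, v) = (\poly_(l < L) a 0%N l).[v].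
Proof.
rewrite horner_poly /sum2 big_ord_recl /= [X in _ + X]big1 ?addr0.
  by apply: eq_bigr => l _; rewrite expr0 mul1r.
by move=> k _; rewrite big1 // => l _; rewrite expr0n /= mul0r mulr0.
Qed.

Lemma analytic2_slice H : analytic2 H -> analytic1 (fun v => H (0, v)).
Proof.
move=> [a [r [M [aM HM]]]]; have r0 := aM.1; have M0 := summable2_ge0 aM.
exists M, r; split=> // N; exists (\poly_(l < N) a 0%N l); split.
  rewrite (pnormE _ (size_poly _ _)); apply: le_trans (aM.2 1%N N).
  rewrite /norm2 big_ord1 le_eqVlt; apply/orP; left; apply/eqP.
  by apply: eq_bigr => l _; rewrite coef_poly ltn_ord.
move=> v vr; rewrite -(sum2_poly1 _ N); apply: HM => //.
by split=> //=; rewrite nrm0 nrm_ge0.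
Qed.

Lemma sum2_poly2 a K L (u v : C) :
  sum2 a K L (u, v) = (\poly_(l < L) \sum_(k < K) a k l * u ^+ k).[v].
Proof.
rewrite horner_poly /sum2 exchange_big; apply: eq_bigr => l _.
by rewrite mulr_suml; apply: eq_bigr => k _; rewrite mulrA.
Qed.

Lemma expansion_approximable H a r M u r' : expansion H a r M -> nrm u <= r' ->
  r' < r -> poly_approximable (fun v => H (u, v)) r'.
Proof.
move=> [aM HM] ur' rr e e0.
have r0 := aM.1; have r'0 := le_trans (nrm_ge0 u) ur'.
have t01 : 0 <= r' / r < 1.
  by rewrite divr_ge0 ?(ltW r0) // ltr_pdivrMr // mul1r.
have [N hN] := small_geo (summable2_ge0 aM) t01 e0.
exists (\poly_(l < N) \sum_(k < N) a k l * u ^+ k) => v vr.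
by rewrite -sum2_poly2; apply: le_lt_trans hN; apply: HM => //; exact: ltW.
Qed.

(** Uniform in [v], which allows one circle in [v] to serve for all small [u]. The
    bound holds for every partial sum, term by term. *)
Lemma expansion_lipschitz1 H a r M u v : expansion H a r M ->
  nrm u < r -> nrm v < r -> nrm (H (u, v) - H (0, v)) <= M * (nrm u / r).
Proof.
move=> [aM HM] ur vr; apply/ler_addgt0Pr => e e0.
have r0 := aM.1; have M0 := summable2_ge0 aM.
pose rho := Num.max (nrm u) (nrm v).
have rho_r : rho < r by rewrite /rho gt_max ur.
have rho0 : 0 <= rho by rewrite /rho le_max nrm_ge0.
have t01 : 0 <= rho / r < 1 by rewrite divr_ge0 ?(ltW r0) // ltr_pdivrMr // mul1r.
have e2 : 0 < e / 2 by lra.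
have [N hN] := small_geo M0 t01 e2.
have d1 : in_bidisc (u, v) rho by split; rewrite /= le_max lexx ?orbT.
have d0 : in_bidisc (0, v) rho.
  by split; rewrite /= ?nrm0 // le_max lexx ?orbT.
have h1 := HM rho _ N N.+1 N.+1 (ltW rho_r) d1 (leqnSn _) (leqnSn _).
have h0 := HM rho _ N N.+1 N.+1 (ltW rho_r) d0 (leqnSn _) (leqnSn _).
suff hs : nrm (sum2 a N.+1 N.+1 (u, v) - sum2 a N.+1 N.+1 (0, v)) <= M * (nrm u / r).
  have := nrm_tri (H (u, v)) (sum2 a N.+1 N.+1 (u, v)) (H (0, v)).
  have := nrm_tri (sum2 a N.+1 N.+1 (u, v)) (sum2 a N.+1 N.+1 (0, v)) (H (0, v)).
  have := nrmB (H (0, v)) (sum2 a N.+1 N.+1 (0, v)).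
  move: h0 h1 hs; move: (sum2 _ _ _ (u, v)) (sum2 _ _ _ (0, v)) (H (u, v)) (H (0, v)).
  move: (nrm u / r) => ur' S1 S0 H1 H0 *; lra.
apply: le_trans (ler_wpM2r _ (aM.2 N.+1 N.+1)); last by rewrite divr_ge0 ?nrm_ge0 ?(ltW r0).
rewrite /sum2 -sumrB /norm2 mulr_suml; apply: le_trans (nrm_sum _ _ _) _.
apply: ler_sum => k _; rewrite -sumrB mulr_suml; apply: le_trans (nrm_sum _ _ _) _.
apply: ler_sum => l _; rewrite -mulrBr -mulrBl /= nrmM -mulrA ler_wpM2l ?nrm_ge0 //.
rewrite nrmM nrmX exprD mulrAC.
case: (k : nat) => [|k'].
  by rewrite !expr0 subrr nrm0 mul0r mul1r mulr_ge0 ?exprn_ge0 ?divr_ge0 ?nrm_ge0 ?(ltW r0).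
rewrite expr0n /= subr0 nrmX ler_pM ?exprn_ge0 ?nrm_ge0 //.
  rewrite !exprSr -mulrA [r * _]mulrC divfK ?gt_eqF //.
  by rewrite ler_wpM2r ?nrm_ge0 // lerXn2r ?nnegrE ?nrm_ge0 ?(ltW r0) ?(ltW ur) ?(ltW vr).
by rewrite lerXn2r ?nnegrE ?nrm_ge0 ?(ltW r0) ?(ltW ur) ?(ltW vr).
Qed.

Lemma expansion_leading_term H a r M l : expansion H a r M ->
  (forall l', (l' < l)%N -> a 0%N l' = 0) ->
  leading_term (fun v => H (0, v)) (a 0%N l) l.
Proof.
move=> [aM HM] a0; have r0 := aM.1; have M0 := summable2_ge0 aM.
exists (M / r ^+ l.+1), r; split=> //; first by rewrite divr_ge0 ?exprn_ge0 ?(ltW r0).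
move=> v vr; have dv : in_bidisc (0, v) (nrm v) by split=> //=; rewrite nrm0 nrm_ge0.
have := HM _ _ l.+1 l.+1 l.+1 vr dv (leqnn _) (leqnn _).
rewrite sum2_poly1 horner_poly big_ord_recr /= big1 ?add0r.
  by rewrite expr_div_n mulrA mulrAC.
by move=> i _; rewrite a0 // mul0r.
Qed.

(** If [H (0, 0) = 0], then for a small [u != 0] the slice [H (u, .)] is bounded below
    on a small circle, uniformly in [u], because [H (0, .)] is not flat, while its
    value at 0 is small; by the minimum principle it has a zero. As [H (., 0)] is
    not flat, this zero is not at 0, hence is off the axes. *)
Lemma unit_of_no_zeros H c1 j1 c2 j2 : analytic2 H ->
  c1 != 0 -> leading_term (fun v => H (0, v)) c1 j1 ->
  c2 != 0 -> leading_term (fun u => H (u, 0)) c2 j2 ->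
  (\forall w \near (0 : C, 0 : C), H w = 0 -> w.1 * w.2 = 0) ->
  H (0, 0) != 0.
Proof.
move=> [a [r [M [aM HM]]]] c10 lt1 c20 lt2 /nearCC[r3 r30 Hz].
apply/negP => /eqP H00.
have [r1 r10 low1] := leading_term_lower c10 lt1.
have [r2 r20 low2] := leading_term_lower c20 lt2.
have r0 := aM.1; have M0 := summable2_ge0 aM.
have [s [s0 sr sr1 sr3]] : exists s : R, [/\ 0 < s, 2 * s < r, 2 * s < r1 & 2 * s < r3].
  have [t [t0 tr tr1 tr3]] := exists_small3 r0 r10 r30.
  by exists (t / 2); clear - t0 tr tr1 tr3; split; lra.
(* [d] bounds [H (0, .)] from below on the circle of radius [s]. *)
pose d := nrm c1 / 2 * s ^+ j1.
have d0 : 0 < d by rewrite mulr_gt0 ?exprn_gt0 // divr_gt0 // nrm_gt0.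
have M1 : 0 < 3 * (M + 1) by lra.
(* For [|u| <= t], the slice at [u] differs by at most [d / 3] from the slice at 0. *)
have b0 : 0 < d * r / (3 * (M + 1)) by rewrite divr_gt0 // mulr_gt0.
have [t [t0 ts tr2 td]] := exists_small3 s0 r20 b0.
have {}td : M * (t / r) <= d / 3.
  move: td; rewrite ltr_pdivlMr // => td.
  rewrite mulrA ler_pdivrMr //; nra.
pose u : C := t%:C%C.
have nu : nrm u = t by rewrite nrmC ger0_norm // ltW.
have u0 : u != 0 by rewrite -nrm_gt0 nu.
have lip v : nrm v < r -> nrm (H (u, v) - H (0, v)) <= d / 3.
  move=> vr; apply: le_trans td; rewrite -nu.
  by apply: (@expansion_lipschitz1 H a); rewrite ?nu //; lra.
have d23 : 0 < 2 * d / 3 by lra.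
suff hd : 2 * d / 3 <= nrm (H (u, 0)).
  by have := lip 0; rewrite nrm0 H00 subr0 => /(_ r0); lra.
apply: (@minimum_principle R (fun v => H (u, v)) s) => // [|v vs|v vs].
- apply: (@expansion_approximable H a r M); rewrite ?nu //; lra.
- apply/eqP => Huv.
  have [v0|v0] := eqVneq v 0.
    have := low2 u; rewrite nu => /(_ tr2); rewrite -v0 Huv nrm0 leNgt.
    by rewrite mulr_gt0 ?exprn_gt0 // divr_gt0 // nrm_gt0.
  have tr3 : t < r3 by lra.
  have vr3 : nrm v < r3 by lra.
  have := Hz (u, v); rewrite /= !subr0 nu => /(_ tr3 vr3 Huv)/eqP.
  by rewrite mulf_eq0 (negbTE u0) (negbTE v0).
- have sr1' : s < r1 by lra.
  have sr' : s < r by lra.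
  have := low1 v; rewrite vs -/d => /(_ sr1') dv.
  have := nrm_tri (H (0, v)) (H (u, v)) 0; rewrite !subr0 nrmB.
  by have := lip v; rewrite vs => /(_ sr'); lra.
Qed.

End TwoVariables.

(** * Factoring out monomials *)

Section Factorization.
Variable R : realType.
Local Notation C := (CC R).
Implicit Types (w : C * C) (H : C * C -> C) (a b : nat -> nat -> C) (r M rho : R).

Lemma expansion0 H a r M : expansion H a r M -> (forall k l, a k l = 0) ->
  forall w, in_bidisc w (r / 2) -> H w = 0.
Proof.
move=> [aM HM] a0 w w_r; have r0 := aM.1; apply/eqP; rewrite -nrm_eq0.
rewrite eq_le nrm_ge0 andbT; have t01 : 0 <= r / 2 / r < 1.
  by rewrite divr_ge0 ?ltr_pdivrMr //= ?mul1r; lra.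
apply: (le0_geo (summable2_ge0 aM) t01) => N.
have rr : r / 2 <= r by lra.
have := HM _ w N N N rr w_r (leqnn _) (leqnn _).
rewrite /sum2 big1 ?subr0 // => k _.
by rewrite big1 // => l _; rewrite a0 mul0r.
Qed.

Lemma shift2 (T : nmodType) (F : nat -> nat -> T) i j K L :
  (forall k l, (k < i)%N || (l < j)%N -> F k l = 0) ->
  \sum_(k < i + K) \sum_(l < j + L) F k l =
  \sum_(k < K) \sum_(l < L) F (i + k)%N (j + l)%N.
Proof.
move=> F0; rewrite big_split_ord /= [X in X + _]big1 ?add0r; last first.
  by move=> k _; rewrite big1 // => l _; rewrite F0 // ltn_ord.
apply: eq_bigr => k _; rewrite big_split_ord /= [X in X + _]big1 ?add0r //.
by move=> l _; rewrite F0 // ltn_ord orbT.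
Qed.

(** The monomial is the largest one dividing the power series: [i] and [j] are the
    least indices of a nonzero row and of a nonzero column of coefficients, so
    the quotient is flat along neither axis. *)
Lemma analytic2_divide H : analytic2 H ->
  ~ (\forall w \near (0 : C, 0 : C), H w = 0) ->
  exists i j H1 c1 j1 c2 j2, [/\ analytic2 H1,
    \forall w \near (0 : C, 0 : C), H w = w.1 ^+ i * w.2 ^+ j * H1 w,
    c1 != 0 /\ leading_term (fun v => H1 (0, v)) c1 j1 &
    c2 != 0 /\ leading_term (fun u => H1 (u, 0)) c2 j2].
Proof.
move=> [a [r [M HM]]] Hn0; have aM := HM.1; have r0 := aM.1.
have M0 := summable2_ge0 aM.
have [[k [l akl]]|a0] := pselect (exists k l, a k l != 0); last first.
  exfalso; apply: Hn0; apply/nearCC; exists (r / 2) => [|w]; first by lra.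
  rewrite !subr0 => w1 w2; apply: (expansion0 HM) => [k l|].
    by apply: contrapT => /eqP kl; apply: a0; exists k, l.
  by split; apply: ltW.
have exi : exists i, `[< exists l, a i l != 0 >] by exists k; apply/asboolP; exists l.
have exj : exists j, `[< exists k, a k j != 0 >] by exists l; apply/asboolP; exists k.
case: (ex_minnP exi) => i /asboolP[l0 al0] imin.
case: (ex_minnP exj) => j /asboolP[k0 ak0] jmin.
have az k' l' : (k' < i)%N || (l' < j)%N -> a k' l' = 0.
  move=> kl; apply: contrapT => /eqP akl'; case/orP: kl => h.
    have : (i <= k')%N by apply: imin; apply/asboolP; exists l'.
    by rewrite leqNgt h.
  have : (j <= l')%N by apply: jmin; apply/asboolP; exists k'.
  by rewrite leqNgt h.
pose b k l := a (i + k)%N (j + l)%N.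
have rij : 0 < r ^+ (i + j) by rewrite exprn_gt0.
have bM : summable2 b r (M / r ^+ (i + j)).
  split=> // K L; rewrite ler_pdivlMr //; apply: le_trans (aM.2 (i + K)%N (j + L)%N).
  rewrite /norm2 (@shift2 _ (fun k l => nrm (a k l) * r ^+ (k + l))); last first.
    by move=> k' l' kl; rewrite az // nrm0 mul0r.
  rewrite mulr_suml le_eqVlt; apply/orP; left; apply/eqP.
  apply: eq_bigr => k' _; rewrite mulr_suml; apply: eq_bigr => l' _.
  by rewrite -mulrA -exprD; congr (_ * _ ^+ _); lia.
have [H1 [r' H1M]] := summable2_expansion bM.
have r'0 := H1M.1.1.
have [s [s0 sr sr' _]] := exists_small3 r0 r'0 r0.
have b1 : exists l, b 0%N l != 0.
  exists (l0 - j)%N; rewrite /b addn0 subnKC // leqNgt; apply/negP => lj.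
  by move: al0; rewrite az ?eqxx // lj orbT.
have b2 : exists k, b k 0%N != 0.
  exists (k0 - i)%N; rewrite /b addn0 subnKC // leqNgt; apply/negP => lj.
  by move: ak0; rewrite az ?eqxx // lj.
case: (ex_minnP b1) => l1 bl1 l1min; case: (ex_minnP b2) => k1 bk1 k1min.
exists i, j, H1, (b 0%N l1), l1, (b k1 0%N), k1; split.
- by exists b, r', (M / r ^+ (i + j)).
- apply/nearCC; exists s => // w; rewrite !subr0 => w1 w2.
  have w_s : in_bidisc w s by split; exact: ltW.
  apply/eqP; rewrite -subr_eq0 -nrm_eq0 eq_le nrm_ge0 andbT.
  apply/ler_addgt0Pr => e e0; rewrite add0r.
  have q01 t : s < t -> 0 <= s / t < 1.
    by move=> st; have t0 := lt_trans s0 st; rewrite divr_ge0 ?(ltW s0) ?(ltW t0) //= ltr_pdivrMr // mul1r.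
  have e2 : 0 < e / 2 by lra.
  have M'0 := summable2_ge0 bM.
  pose B := nrm (w.1 ^+ i * w.2 ^+ j).
  have B0 : 0 <= B := nrm_ge0 _.
  have [N1 hN1] := small_geo M0 (q01 _ sr) e2.
  have [N2 hN2] := small_geo (mulr_ge0 B0 M'0) (q01 _ sr') e2.
  pose N := maxn N1 N2.
  have h1 : nrm (H w - sum2 a (i + N) (j + N) w) <= M * (s / r) ^+ N1.
    by apply: (HM.2 _ _ _ _ _ (ltW sr) w_s); rewrite (leq_trans (leq_maxl N1 N2)) ?leq_addl.
  have h2 : nrm (H1 w - sum2 b N N w) <= M / r ^+ (i + j) * (s / r') ^+ N2.
    exact: (H1M.2 _ _ _ _ _ (ltW sr') w_s (leq_maxr _ _) (leq_maxr _ _)).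
  have eS : sum2 a (i + N) (j + N) w = w.1 ^+ i * w.2 ^+ j * sum2 b N N w.
    rewrite /sum2 (@shift2 _ (fun k l => a k l * (w.1 ^+ k * w.2 ^+ l))); last first.
      by move=> k' l' kl; rewrite az // mul0r.
    rewrite mulr_sumr; apply: eq_bigr => k' _; rewrite mulr_sumr.
    by apply: eq_bigr => l' _; rewrite /b !exprD; ring.
  have := nrm_tri (H w) (sum2 a (i + N) (j + N) w) (w.1 ^+ i * w.2 ^+ j * H1 w).
  rewrite {2}eS -mulrBr [nrm (_ * (_ - _))]nrmM -/B (nrmB (sum2 b _ _ _)).
  have := ler_wpM2l B0 h2; rewrite mulrA.
  lra.
- split=> //; apply: (expansion_leading_term H1M) => l' l'l.
  apply: contrapT => /eqP /l1min; rewrite leqNgt l'l //.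
- split=> //; apply: (expansion_leading_term (expansion_swap H1M)) => l' l'l.
  apply: contrapT => /eqP /k1min; rewrite leqNgt l'l //.
Qed.

Lemma near0_diag (P : set (C * C)) : (\forall w \near (0 : C, 0 : C), P w) ->
  exists2 t : C, t != 0 & P (t, t).
Proof.
move=> /nearCC[e e0 eP]; exists (e / 2)%:C%C.
  by rewrite -nrm_gt0 nrmC ger0_norm; lra.
by apply: eP; rewrite /= subr0 nrmC ger0_norm; lra.
Qed.

(** A local Nullstellensatz for zeros contained in the two axes. *)
Lemma analytic2_factor H : analytic2 H ->
  (\forall w \near (0 : C, 0 : C), H w = 0 -> w.1 * w.2 = 0) ->
  exists i j H1, [/\ analytic2 H1, H1 (0, 0) != 0 &
    \forall w \near (0 : C, 0 : C), H w = w.1 ^+ i * w.2 ^+ j * H1 w].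
Proof.
move=> aH Hz.
have Hn0 : ~ \forall w \near (0 : C, 0 : C), H w = 0.
  move=> H0; have [t /eqP t0 /= [h /(_ h)]] := near0_diag (filterI H0 Hz).
  by move=> /eqP; rewrite mulf_eq0 orbb => /eqP.
have [i [j [H1 [c1 [j1 [c2 [j2 [aH1 HE [c10 lt1] [c20 lt2]]]]]]]]] :=
  analytic2_divide aH Hn0.
exists i, j, H1; split=> //; apply: (unit_of_no_zeros aH1 c10 lt1 c20 lt2).
near=> w => H1w.
have : H w = w.1 ^+ i * w.2 ^+ j * H1 w by near: w.
by rewrite H1w mulr0; near: w.
Unshelve. all: by end_near.
Qed.

End Factorization.

(** * Analytic germs and their power series *)

Lemma cvg_exp (K : numFieldType) (T : topologicalType) (F : set_system T)
  (FF : Filter F) (f : T -> K) (l : K) n : f @ F --> l -> (fun x => f x ^+ n) @ F --> l ^+ n.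
Proof.
move=> fl; elim: n => [|n IH].
  exact: cvg_cst.
have -> : (fun x => f x ^+ n.+1) = (fun x => f x * f x ^+ n).
  by apply/funext => x; rewrite exprS.
by rewrite exprS; exact: (@cvgM K T F FF f (fun x => f x ^+ n) l (l ^+ n) fl IH).
Qed.

Section AnalyticGerms.
Variable R : realType.
Local Notation C := (CC R).
Implicit Types (w : C * C) (H : C * C -> C) (a : nat -> nat -> C) (r M rho : R).

Lemma sum2_continuous a K L w : {for w, continuous (sum2 a K L)}.
Proof.
rewrite /prop_for /continuous_at /sum2.
apply: cvg_big => [|k _]; first exact: add_continuous.
apply: cvg_big => [|l _]; first exact: add_continuous.
apply: cvgM; first exact: cvg_cst.
by apply: cvgM; apply: cvg_exp; [exact: cvg_fst|exact: cvg_snd].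
Qed.

Lemma near_bidisc (w0 : C * C) rho : nrm w0.1 < rho -> nrm w0.2 < rho ->
  \forall w \near w0, in_bidisc w rho.
Proof.
move=> w1 w2; apply/nearCC; exists (Num.min (rho - nrm w0.1) (rho - nrm w0.2)).
  by rewrite lt_min !subr_gt0 w1.
move=> w; rewrite !lt_min => /andP[h1 _] /andP[_ h2].
have := nrm_dist w.1 w0.1; have := nrm_dist w.2 w0.2.
by rewrite !ler_norml => /andP[_ ?] /andP[_ ?]; split; lra.
Qed.

Lemma near_near_bidisc rho : 0 < rho ->
  \forall w0 \near (0 : C, 0 : C), nrm w0.1 < rho /\ nrm w0.2 < rho.
Proof. by move=> rho0; apply/nearCC; exists rho => // w; rewrite !subr0. Qed.

Lemma analytic2_continuous H : analytic2 H ->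
  \forall w \near (0 : C, 0 : C), {for w, continuous H}.
Proof.
move=> [a [r [M [aM HM]]]]; have r0 := aM.1; have M0 := summable2_ge0 aM.
have r20 : 0 < r / 2 by lra.
apply: filterS (near_near_bidisc r20) => w0 [w01 w02].
move=> A /nearC[e e0 eA]; have e3 : 0 < e / 3 by lra.
have t01 : 0 <= r / 2 / r < 1.
  by rewrite divr_ge0 ?ltr_pdivrMr //= ?mul1r; lra.
have rr : r / 2 <= r by lra.
have [N hN] := small_geo M0 t01 e3.
have approx w : in_bidisc w (r / 2) -> nrm (H w - sum2 a N N w) < e / 3.
  by move=> w_r; apply: le_lt_trans hN; exact: HM.
have w0_r : in_bidisc w0 (r / 2) by split; exact: ltW.
have : \forall w \near w0, nrm (sum2 a N N w - sum2 a N N w0) < e / 3.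
  apply: (@sum2_continuous a N N w0 [set z : C | nrm (z - sum2 a N N w0) < e / 3]).
  by apply/nearC; exists (e / 3).
apply: filterS2 (near_bidisc w01 w02) => w w_r Sw; apply: eA.
have := approx _ w_r; have := approx _ w0_r.
have := nrm_tri (H w) (sum2 a N N w) (H w0).
have := nrm_tri (sum2 a N N w) (sum2 a N N w0) (H w0).
have := nrmB (H w0) (sum2 a N N w0); move: Sw.
move: (sum2 a N N w) (sum2 a N N w0) (H w) (H w0) => S1 S0 H1 H0 ? ->; lra.
Qed.

Lemma cvg_eq (u1 u2 : nat -> C) (l : C) : u1 =1 u2 -> u1 @ \oo --> l -> u2 @ \oo --> l.
Proof. by move=> /funext ->. Qed.

Definition row2 w : Cn R 2 := \row_j (if j == ord0 then w.1 else w.2).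

Lemma row20 w : row2 w ord0 ord0 = w.1. Proof. by rewrite mxE. Qed.
Lemma row21 w : row2 w ord0 ord_max = w.2. Proof. by rewrite mxE. Qed.

Lemma ord2P (P : 'I_2 -> Prop) : P ord0 -> P ord_max -> forall j, P j.
Proof.
move=> P0 P1 [[|[|//]] j2]; first by congr P: P0; apply: val_inj.
by congr P: P1; apply: val_inj.
Qed.

Lemma row2E (x : Cn R 2) : x = row2 (x ord0 ord0, x ord0 ord_max).
Proof. by apply/rowP; apply: ord2P; rewrite ?row20 ?row21. Qed.

Lemma sum_ffun2 (T : nmodType) N (G : nat -> nat -> T) :
  \sum_(al : {ffun 'I_2 -> 'I_N}) G (al ord0) (al ord_max) =
  \sum_(k < N) \sum_(l < N) G k l.
Proof.
rewrite pair_big /=.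
rewrite (reindex (fun p : 'I_N * 'I_N => [ffun i : 'I_2 => if i == ord0 then p.1 else p.2])).
  by apply: eq_bigr => p _; rewrite !ffunE.
exists (fun al : {ffun 'I_2 -> 'I_N} => (al ord0, al ord_max)) => [[k l] _|al _].
  by rewrite !ffunE.
by apply/ffunP; apply: ord2P; rewrite ffunE.
Qed.

Lemma sum_ffun1 (T : nmodType) N (G : nat -> T) :
  \sum_(al : {ffun 'I_1 -> 'I_N}) G (al ord0) = \sum_(k < N) G k.
Proof.
rewrite (reindex (fun k : 'I_N => [ffun i : 'I_1 => k])).
  by apply: eq_bigr => p _; rewrite !ffunE.
exists (fun al : {ffun 'I_1 -> 'I_N} => al ord0) => [k _|al _]; first by rewrite ffunE.
by apply/ffunP => i; rewrite ffunE (ord1 i).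
Qed.

Lemma near_row2 (x : Cn R 2) (P : set (Cn R 2)) :
  (\forall z \near x, P z) <-> (\forall w \near (0 : C, 0 : C), P (x + row2 w)).
Proof.
split.
  move=> /nearCn[e e0 eP]; apply/nearCC; exists e => // w w1 w2; apply: eP.
  rewrite /= !subr0 in w1 w2.
  by apply: ord2P; rewrite mxE ?row20 ?row21 addrAC subrr add0r.
move=> /nearCC[e e0 eP]; apply/nearCn; exists e => // z zx.
rewrite -(subrKC x z) (row2E (z - x)); apply: eP; rewrite /= subr0 !mxE.
  exact: zx.
exact: zx.
Qed.

Lemma realC_ge0 (x : C) : 0 <= x -> x = (complex.Re x)%:C%C.
Proof. by move=> /ger0_Im; case: x => a b /= ->. Qed.

Lemma lift0_ord2 : lift ord0 ord0 = ord_max :> 'I_2.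
Proof. exact: val_inj. Qed.

Lemma norm_termE (c : C) r (n : nat) : `|c| * r%:C%C ^+ n = (nrm c * r ^+ n)%:C%C.
Proof. by rewrite nrmE rmorphM rmorphXn. Qed.

(** Multi-indices are functions on ['I_2]; the estimates on power series are for double
    series summed over rectangles. *)
Lemma analytic_at2P (x : Cn R 2) (h : Cn R 2 -> C) :
  analytic_at x h <-> exists a r M, summable2 a r M /\
    \forall w \near (0 : C, 0 : C), (fun N => sum2 a N N w) @ \oo --> h (x + row2 w).
Proof.
split.
  move=> [a [r [M [r0 aM lim]]]].
  pose a2 k l := a (fun i : 'I_2 => if i == ord0 then k else l).
  have aE N (al : {ffun 'I_2 -> 'I_N}) : a (fun i => al i) = a2 (al ord0) (al ord_max).
    by congr a; apply/funext; apply: ord2P.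
  exists a2, (complex.Re r), (complex.Re M).
  have rE := realC_ge0 (ltW r0); set r' := complex.Re r in rE *.
  have r'0 : 0 < r' by move: r0; rewrite rE ltcR.
  have bound N : norm2 a2 N N r' <= complex.Re M.
    have := aM N; rewrite (eq_bigr (fun al : {ffun 'I_2 -> 'I_N} =>
      (nrm (a2 (al ord0) (al ord_max)) * r' ^+ (al ord0 + al ord_max))%:C%C)); last first.
      by move=> al _; rewrite aE rE norm_termE big_ord_recl big_ord1 lift0_ord2.
    rewrite -(rmorph_sum (real_complex R)) /=.
    rewrite (sum_ffun2 N (fun k l => nrm (a2 k l) * r' ^+ (k + l))).
    by rewrite lecE => /andP[_].
  split.
    split=> // K L; apply: le_trans (bound (maxn K L)).
    rewrite /norm2 (widen2 (fun k l => nrm (a2 k l) * r' ^+ (k + l)) (leq_maxl K L) (leq_maxr K L)).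
    apply: ler_sum => k _; apply: ler_sum => l _; case: ifP => // _.
    by rewrite mulr_ge0 ?nrm_ge0 ?exprn_ge0 // ltW.
  move/near_row2: lim; apply: filterS => w.
  apply: cvg_eq => N; rewrite /sum2.
  rewrite -(sum_ffun2 N (fun k l => a2 k l * (w.1 ^+ k * w.2 ^+ l))).
  apply: eq_bigr => al _; rewrite aE big_ord_recl big_ord1 lift0_ord2.
  by rewrite ![(x + _) _ _]mxE row20 row21 ![x _ _ + _]addrC !addrK.
move=> [a [r [M [[r0 aM] lim]]]].
exists (fun al => a (al ord0) (al ord_max)), r%:C%C, M%:C%C; split.
- by rewrite ltcR.
- move=> N; rewrite (eq_bigr (fun al : {ffun 'I_2 -> 'I_N} =>
    (nrm (a (al ord0) (al ord_max)) * r ^+ (al ord0 + al ord_max))%:C%C)); last first.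
    by move=> al _; rewrite norm_termE big_ord_recl big_ord1 lift0_ord2.
  rewrite -(rmorph_sum (real_complex R)) /= lecR.
  rewrite (sum_ffun2 N (fun k l => nrm (a k l) * r ^+ (k + l))); exact: aM.
- apply/near_row2; move: lim; apply: filterS => w.
  apply: cvg_eq => N; rewrite /sum2.
  rewrite -(sum_ffun2 N (fun k l => a k l * (w.1 ^+ k * w.2 ^+ l))).
  apply: eq_bigr => al _; rewrite big_ord_recl big_ord1.
  by rewrite lift0_ord2 ![(x + _) _ _]mxE row20 row21 ![x _ _ + _]addrC !addrK.
Qed.

Lemma analytic_at_analytic2 (x : Cn R 2) h : analytic_at x h ->
  analytic2 (fun w => h (x + row2 w)).
Proof.
move=> /analytic_at2P[a [r [M [aM /nearCC[e e0 lim]]]]]; have r0 := aM.1.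
have m0 : 0 < Num.min r e by rewrite lt_min r0.
exists a, (Num.min r e / 2), M; apply: (expansion_of_limit aM).
  have : Num.min r e <= r by rewrite ge_min lexx.
  lra.
move=> w [w1 w2]; apply: lim; rewrite /= subr0; apply: le_lt_trans;
  try exact: w1; try exact: w2; have : Num.min r e <= e by [rewrite ge_min lexx orbT]; lra.
Qed.

Lemma analytic_onT (x : Cn R 2) h : analytic_on [set: Cn R 2] x h <-> analytic_at x h.
Proof.
split; last by move=> hx; exists h; split=> //; near=> z.
move=> [F [/analytic_at2P[a [r [M [aM lim]]]] /near_row2 hF]].
apply/analytic_at2P; exists a, r, M; split; first exact: aM.
by apply: filterS2 lim hF => w lim_w /(_ Logic.I) ->.
Unshelve. all: by end_near.
Qed.

Lemma analytic_at_translate (x c : Cn R 2) h :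
  analytic_at x h <-> analytic_at (x - c) (h \o (fun z => z + c)).
Proof.
split => /analytic_at2P[a [r [M [aM lim]]]]; apply/analytic_at2P; exists a, r, M;
  (split; first exact: aM); apply: filterS lim => w /=.
  by have -> : x - c + row2 w + c = x + row2 w by rewrite addrAC subrK.
by have -> : x - c + row2 w + c = x + row2 w by rewrite addrAC subrK.
Qed.

Definition swap_coords (z : Cn R 2) : Cn R 2 := row2 (z ord0 ord_max, z ord0 ord0).

Lemma swap_coordsK : involutive swap_coords.
Proof. by move=> z; rewrite /swap_coords row20 row21 -row2E. Qed.

Lemma near0_swap (P : set (C * C)) :
  (\forall w \near (0 : C, 0 : C), P w) -> \forall w \near (0 : C, 0 : C), P (swap w).
Proof.
by move=> /nearCC[e e0 eP]; apply/nearCC; exists e => // w w1 w2; apply: eP.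
Qed.

Lemma analytic_at_swap (x : Cn R 2) h :
  analytic_at x h -> analytic_at (swap_coords x) (h \o swap_coords).
Proof.
move=> /analytic_at2P[a [r [M [aM lim]]]]; apply/analytic_at2P.
exists (fun k l => a l k), r, M; split.
  split; first exact: aM.1.
  move=> K L; apply: le_trans (aM.2 L K); rewrite /norm2 exchange_big le_eqVlt.
  by apply/orP; left; apply/eqP; apply: eq_bigr => k _; apply: eq_bigr => l _; rewrite addnC.
move/near0_swap: lim; apply: filterS => w.
have -> : (h \o swap_coords) (swap_coords x + row2 w) = h (x + row2 (swap w)).
  congr h; rewrite /swap_coords !mxE /=; apply/rowP.
  by apply: ord2P; rewrite !mxE.
apply: cvg_eq => N; rewrite /sum2 exchange_big.
by apply: eq_bigr => k _; apply: eq_bigr => l _; rewrite /= [w.2 ^+ _ * _]mulrC.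
Qed.

Lemma analytic_at_affine (x : Cn R 2) (alpha beta : C) :
  analytic_at x (fun z => alpha + beta * z ord0 ord0).
Proof.
apply/analytic_at2P; pose c := alpha + beta * x ord0 ord0.
pose a (k l : nat) : C := if l == 0%N then nth 0 [:: c; beta] k else 0.
have sumE (T : nmodType) (F : nat -> nat -> T) K L :
    (forall k l, a k l = 0 -> F k l = 0) ->
    \sum_(k < K.+2) \sum_(l < L.+1) F k l = F 0%N 0%N + F 1%N 0%N.
  move=> F0; have rowE k : \sum_(l < L.+1) F k l = F k 0%N.
    by rewrite big_ord_recl big1 ?addr0 // => l _; apply: F0.
  rewrite (eq_bigr (fun k : 'I_K.+2 => F k 0%N)); last by move=> k _; exact: rowE.
  rewrite !big_ord_recl big1 ?addr0 // => k _.
  by apply: F0; rewrite /a /= nth_nil.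
exists a, 1, (nrm c + nrm beta); split.
  split=> // K L.
  have KK : (K <= K.+2)%N by lia.
  rewrite /norm2 (widen2 (fun k l => nrm (a k l) * 1 ^+ (k + l)) KK (leqnSn L)).
  apply: le_trans (_ : norm2 a K.+2 L.+1 1 <= _).
    apply: ler_sum => k _; apply: ler_sum => l _; case: ifP => // _.
    by rewrite mulr_ge0 ?nrm_ge0 ?exprn_ge0.
  rewrite /norm2 (sumE _ (fun k l => nrm (a k l) * 1 ^+ (k + l))); last first.
    by move=> k l ->; rewrite nrm0 mul0r.
  by rewrite !expr1n !mulr1 /a /=.
near=> w; apply/cvgC => e e0; exists 2%N => -[|[|N]] // _.
rewrite /sum2 (sumE _ (fun k l => a k l * (w.1 ^+ k * w.2 ^+ l))); last first.
  by move=> k l ->; rewrite mul0r.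
rewrite /a /= !mxE /= !expr0 !expr1 !mulr1 /c.
have -> : alpha + beta * x ord0 ord0 + beta * w.1 -
  (alpha + beta * (x ord0 ord0 + w.1)) = 0 by ring.
by rewrite nrm0.
Unshelve. all: by end_near.
Qed.

Lemma analytic_at_coord0 (x : Cn R 2) : analytic_at x (fun z => z ord0 ord0).
Proof.
have := analytic_at_affine x 0 1.
by congr analytic_at; apply/funext => z; rewrite add0r mul1r.
Qed.

Lemma analytic2_cst (c : C) : analytic2 (fun=> c).
Proof.
have := analytic_at_analytic2 (analytic_at_affine 0 c 0).
by congr analytic2; apply/funext => w; rewrite mul0r addr0.
Qed.

(** Results on two variables then apply to parametrized curves. *)
Lemma analytic_at1_analytic2 (h : Cn R 1 -> C) : analytic_at 0 h ->
  analytic2 (fun w => h (const_mx w.1)).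
Proof.
move=> [a [r [M [r0 aM lim]]]].
pose b (k l : nat) : C := if l == 0%N then a (fun=> k) else 0.
have rE := realC_ge0 (ltW r0); set r' := complex.Re r in rE *.
have r'0 : 0 < r' by move: r0; rewrite rE ltcR.
have aE N (al : {ffun 'I_1 -> 'I_N}) : a (fun i => al i) = a (fun=> al ord0).
  by congr a; apply/funext => i; rewrite (ord1 i).
have rowE (T : nmodType) (F : nat -> nat -> T) k L :
    (forall l, F k l.+1 = 0) -> \sum_(l < L.+1) F k l = F k 0%N.
  by move=> F0; rewrite big_ord_recl big1 ?addr0 // => l _; exact: F0.
have bound K L : norm2 b K L r' <= complex.Re M.
  apply: (@le_trans _ _ (norm2 b K L.+1 r')).
    apply: ler_sum => k _; rewrite big_ord_recr /= lerDl.
    by rewrite mulr_ge0 ?nrm_ge0 ?exprn_ge0 // ltW.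
  have := aM K; rewrite (eq_bigr (fun al : {ffun 'I_1 -> 'I_K} =>
    (nrm (a (fun=> al ord0)) * r' ^+ al ord0)%:C%C)); last first.
    by move=> al _; rewrite aE rE norm_termE big_ord1.
  rewrite -(rmorph_sum (real_complex R)) /=.
  rewrite (sum_ffun1 K (fun k => nrm (a (fun=> k)) * r' ^+ k)) lecE => /andP[_].
  apply: le_trans; rewrite le_eqVlt; apply/orP; left; apply/eqP; rewrite /norm2.
  apply: eq_bigr => k _; rewrite (rowE _ (fun k l => nrm (b k l) * r' ^+ (k + l))).
    by rewrite addn0.
  by move=> l; rewrite nrm0 mul0r.
move/nearCn: lim => [e e0 lim].
have m0 : 0 < Num.min r' e by rewrite lt_min r'0.
exists b, (Num.min r' e / 2), (complex.Re M).
apply: (@expansion_of_limit R _ b r'); first by split.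
  have : Num.min r' e <= r' by rewrite ge_min lexx.
  lra.
move=> w [w1 w2].
have we : forall i, nrm ((const_mx w.1 : Cn R 1) ord0 i - (0 : Cn R 1) ord0 i) < e.
  move=> j; rewrite !mxE subr0; apply: le_lt_trans w1 _.
  have : Num.min r' e <= e by rewrite ge_min lexx orbT.
  lra.
apply: cvg_eq (lim _ we) => N; rewrite /sum2.
(* The germ is read as a series in two variables in which the second one does not occur. *)
transitivity (\sum_(k < N) a (fun=> k) * w.1 ^+ k).
  rewrite -(sum_ffun1 N (fun k => a (fun=> k) * w.1 ^+ k)).
  by apply: eq_bigr => al _; rewrite aE big_ord1 !mxE subr0.
apply: eq_bigr => k _; case: N k => [[]//|N] k.
rewrite (rowE _ (fun k l => b k l * (w.1 ^+ k * w.2 ^+ l))) ?expr0 ?mulr1 //.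
by move=> l; rewrite mul0r.
Qed.

Lemma analytic2_slice_at H : analytic2 H ->
  analytic_at (0 : Cn R 1) (fun t => H (t ord0 ord0, 0)).
Proof.
move=> /analytic2_swap[a [r [M [aM HM]]]]; have r0 := aM.1.
exists (fun al => a 0%N (al ord0)), r%:C%C, M%:C%C; split.
- by rewrite ltcR.
- move=> N; rewrite (eq_bigr (fun al : {ffun 'I_1 -> 'I_N} =>
    (nrm (a 0%N (al ord0)) * r ^+ al ord0)%:C%C)); last first.
    by move=> al _; rewrite norm_termE big_ord1.
  rewrite -(rmorph_sum (real_complex R)) /= lecR.
  rewrite (sum_ffun1 N (fun l => nrm (a 0%N l) * r ^+ l)).
  by apply: le_trans (aM.2 1%N N); rewrite /norm2 big_ord1.
- apply/nearCn; exists (r / 2) => [|t /(_ ord0)]; first by lra.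
  rewrite mxE subr0 => tr; apply/cvgC => e e0.
  have t_r : in_bidisc (0, t ord0 ord0) (r / 2) by split; rewrite /= ?nrm0; lra.
  have t01 : 0 <= r / 2 / r < 1.
    by rewrite divr_ge0 ?ltr_pdivrMr //= ?mul1r; lra.
  have rr : r / 2 <= r by lra.
  have [N hN] := small_geo (summable2_ge0 aM) t01 e0.
  exists N => n Nn.
  have := HM _ (0, t ord0 ord0) N n.+1 n rr t_r (leqW Nn) Nn.
  rewrite sum2_poly1 horner_poly nrmB => h; apply: le_lt_trans hN.
  apply: le_trans h; rewrite /swap /= le_eqVlt; apply/orP; left; apply/eqP.
  congr (nrm (_ - _)); rewrite -(sum_ffun1 n (fun l => a 0%N l * t ord0 ord0 ^+ l)).
  by apply: eq_bigr => al _; rewrite big_ord1 mxE subr0.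
Qed.

End AnalyticGerms.

(** * Charts and vanishing orders on a surface *)

(** The subset of [A] defined by [P] is open and closed in [A]. *)
Lemma connected_locally_constant (T : topologicalType) (A : set T) (P : T -> Prop) :
  connected A -> (forall y, A y -> P y -> \forall z \near y, A z -> P z) ->
  (forall y, A y -> ~ P y -> \forall z \near y, A z -> ~ P z) ->
  forall y, A y -> P y -> forall z, A z -> P z.
Proof.
move=> cA Popen Pclosed y Ay Py.
suff : A `&` P = A by move=> AP z; rewrite -AP => -[].
apply: cA; first by exists y.
  exists [set z | A z -> P z]°; first exact: open_interior.
  apply/seteqP; split=> z [Az Pz]; split=> //; first exact: Popen.
  exact: (interior_subset Pz).
exists (~` [set z | A z -> ~ P z]°); first by rewrite closedC; exact: open_interior.
apply/seteqP; split=> z [Az Pz]; split=> //.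
  by move=> /interior_subset/(_ Az).
by apply: contrapT => nP; apply: Pz; exact: Pclosed.
Qed.

Section ContinuityAtAPoint.
Variables (R : realType) (T : topologicalType).
Implicit Types (f : T -> CC R) (x : T).

Lemma near_nrm_lt f x (e : R) : {for x, continuous f} -> 0 < e ->
  \forall z \near x, nrm (f z - f x) < e.
Proof.
move=> cf e0; apply: (cf [set c : CC R | nrm (c - f x) < e]).
by apply/nearC; exists e.
Qed.

Lemma near_nrm_ge f x : {for x, continuous f} -> f x != 0 ->
  \forall z \near x, nrm (f x) / 2 <= nrm (f z).
Proof.
rewrite -nrm_gt0 => cf fx; have e0 : 0 < nrm (f x) / 2 by lra.
apply: filterS (near_nrm_lt cf e0) => z.
by have := nrm_dist (f z) (f x); rewrite ler_norml => /andP[+ _]; lra.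
Qed.

Lemma near_nrm_le f x : {for x, continuous f} ->
  \forall z \near x, nrm (f z) <= nrm (f x) + 1.
Proof.
move=> cf; apply: filterS (near_nrm_lt cf ltr01) => z.
by have := nrm_dist (f z) (f x); rewrite ler_norml => /andP[_]; lra.
Qed.

Lemma near_neq0 f x : {for x, continuous f} -> f x != 0 -> \forall z \near x, f z != 0.
Proof.
move=> cf fx; apply: filterS (near_nrm_ge cf fx) => z.
by rewrite -!nrm_gt0; apply: lt_le_trans; rewrite divr_gt0 // nrm_gt0.
Qed.

End ContinuityAtAPoint.

Section Charts.
Variables (R : realType) (Y : fspace R).
Local Notation C := (CC R).
Implicit Types (y z : Y) (i : Y -> Cn R 2) (w : C * C) (u v h : Y -> C) (E : set Y).

Definition local_chart i (U : set Y) (W : set (Cn R 2)) (s : Cn R 2 -> Y) : Prop :=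
  [/\ open U, open W, (forall z, U z -> W (i z) /\ s (i z) = z),
      (forall x, W x -> U (s x) /\ i (s x) = x) &
      [/\ forall z, U z -> {for z, continuous i},
          forall x, W x -> {for x, continuous s} &
          forall z h, U z -> hol z h <-> analytic_at (i z) (h \o s)]].

Lemma local_modelTP y i :
  local_model [set: Cn R 2] y i <-> exists U W s, local_chart i U W s /\ U y.
Proof.
split.
  move=> [U [W [s [[oU Uy] [oW +] sK + hs]]]]; rewrite setTI => iU [].
  rewrite !continuous_open_subspace // => ci cs.
  exists U, W, s; split=> //; split=> //.
  - by move=> z Uz; split; [rewrite -iU; exists z|exact: sK].
  - by move=> x; rewrite -{1}iU => -[z Uz <-]; rewrite sK.
  - split.
    + by move=> z Uz; apply: ci; exact/mem_set.
    + by move=> x Wx; apply: cs; exact/mem_set.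
    + by move=> z h Uz; rewrite hs // analytic_onT.
move=> [U [W [s [[oU oW iK sK [ci cs hs]] Uy]]]]; exists U, W, s; split=> //.
- rewrite setTI; split=> //; apply/seteqP; split=> [_ [z Uz <-]|x Wx].
    by case: (iK z Uz).
  by exists (s x); case: (sK x Wx).
- by move=> z /iK[].
- rewrite setTI !continuous_open_subspace //; split=> [z /set_mem/ci//|x /set_mem/cs//].
- by move=> z h Uz; rewrite analytic_onT hs.
Qed.

(** Translations and the exchange of coordinates preserve charts. *)
Lemma local_chart_comp i U W s (tau tau' : Cn R 2 -> Cn R 2) :
  cancel tau tau' -> cancel tau' tau -> continuous tau -> continuous tau' ->
  (forall (x : Cn R 2) (h : Cn R 2 -> C),
     analytic_at x h <-> analytic_at (tau x) (h \o tau')) ->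
  local_chart i U W s -> local_chart (tau \o i) U (tau' @^-1` W) (s \o tau').
Proof.
move=> tK tK' ct ct' an [oU oW iK sK [ci cs hs]]; split.
- exact: oU.
- by apply: open_comp oW => x _; exact: ct'.
- by move=> z Uz; rewrite /= /preimage /= tK; exact: iK.
- by move=> x Wx /=; have [? ->] := sK _ Wx; rewrite tK'.
split.
- by move=> z Uz; apply: continuous_comp; [exact: ci|exact: ct].
- by move=> x Wx; apply: continuous_comp; [exact: ct'|exact: cs].
- by move=> z h Uz; rewrite hs // an.
Qed.

Lemma translate_continuous (c : Cn R 2) : continuous (fun x : Cn R 2 => x + c).
Proof.
move=> x A /nearCn[e e0 eA]; apply/nearCn; exists e => // z zx; apply: eA => j.
by rewrite !mxE opprD addrACA subrr addr0.
Qed.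

Lemma coordinates_near y i : coordinates y i ->
  \forall z \near y, coordinates z (fun z' => i z' - i z).
Proof.
move=> [/local_modelTP[U [W [s [ch Uy]]]] _].
have oU : open U by case: ch.
near=> z; split; last exact: subrr.
apply/local_modelTP; exists U, ((fun x => x + i z) @^-1` W), (s \o (fun x => x + i z)).
split; last by near: z; exact: open_nbhs_nbhs.
apply: (@local_chart_comp i U W s (fun x => x - i z)) ch.
- by move=> x; exact: subrK.
- by move=> x; exact: addrK.
- exact: translate_continuous.
- exact: translate_continuous.
- by move=> x h; exact: analytic_at_translate.
Unshelve. all: by end_near.
Qed.

Lemma swap_coords_continuous : continuous (@swap_coords R).
Proof.
move=> x A /nearCn[e e0 eA]; apply/nearCn; exists e => // z zx; apply: eA.
by apply: ord2P; rewrite /swap_coords !(row20, row21); exact: zx.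
Qed.

Lemma coordinates_swap y i : coordinates y i -> coordinates y (@swap_coords R \o i).
Proof.
move=> [/local_modelTP[U [W [s [ch Uy]]]] iy0]; split; last first.
  by rewrite /= iy0; apply/rowP; apply: ord2P; rewrite !mxE.
apply/local_modelTP; exists U, (@swap_coords R @^-1` W), (s \o @swap_coords R).
split; last exact: Uy.
apply: local_chart_comp ch.
- exact: swap_coordsK.
- exact: swap_coordsK.
- exact: swap_coords_continuous.
- exact: swap_coords_continuous.
- move=> x h; split; first exact: analytic_at_swap.
  move=> /analytic_at_swap; rewrite swap_coordsK.
  by congr (analytic_at x _); apply/funext => z /=; rewrite swap_coordsK.
Qed.

Lemma fst_coord_swap i : fst_coord (@swap_coords R \o i) = snd_coord i.
Proof. by apply/funext => z; rewrite /fst_coord /= row20. Qed.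
Lemma snd_coord_swap i : snd_coord (@swap_coords R \o i) = fst_coord i.
Proof. by apply/funext => z; rewrite /snd_coord /= row21. Qed.

(** A chart at [y] in terms of germs: [s] is the inverse of [(u, v)], and only what
    holds near [y] and near the origin is kept. *)
Definition chart y u v (s : C * C -> Y) : Prop :=
  [/\ s (0, 0) = y, \forall z \near y, s (u z, v z) = z,
      \forall w \near (0 : C, 0 : C), u (s w) = w.1 /\ v (s w) = w.2,
      (\forall z \near y, {for z, continuous u} /\ {for z, continuous v}) /\
      (\forall w \near (0 : C, 0 : C), {for w, continuous s}) &
      forall h, hol y h -> analytic2 (h \o s)].

Lemma row2_continuous : continuous (@row2 R).
Proof.
move=> w A /nearCn[e e0 eA]; apply/nearCC; exists e => // z z1 z2; apply: eA.
by apply: ord2P; rewrite !(row20, row21).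
Qed.

Lemma coord_continuous j : continuous (fun x : Cn R 2 => x ord0 j : C).
Proof.
move=> x A /nearC[e e0 eA]; apply/nearCn; exists e => // z zx; apply: eA.
exact: zx.
Qed.

Lemma coordinates_chart y i : coordinates y i ->
  exists s, chart y (fst_coord i) (snd_coord i) s.
Proof.
move=> [/local_modelTP[U [W [s [[oU oW iK sK [ci cs hs]] Uy]]]] iy0].
have W0 : W 0 by rewrite -iy0; case: (iK y Uy).
have r0 : row2 (0, 0) = 0 :> Cn R 2 by apply/rowP; apply: ord2P; rewrite !mxE.
have nU : \forall z \near y, U z by exact: open_nbhs_nbhs.
have nW : \forall w \near (0 : C, 0 : C), W (row2 w).
  have /near_row2 : \forall x \near (0 : Cn R 2), W x by exact: open_nbhs_nbhs.
  by apply: filterS => w; rewrite add0r.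
exists (s \o @row2 R); split.
- by rewrite /= r0 -iy0; case: (iK y Uy).
- by apply: filterS nU => z /iK[_]; rewrite /= -row2E.
- by apply: filterS nW => w /sK[_ /= e]; rewrite /fst_coord /snd_coord e row20 row21.
- split.
    apply: filterS nU => z Uz; split.
      exact: (@continuous_comp _ _ _ i (fun x => x ord0 ord0) z (ci _ Uz)
               (coord_continuous (x := i z))).
    exact: (@continuous_comp _ _ _ i (fun x => x ord0 ord_max) z (ci _ Uz)
               (coord_continuous (x := i z))).
  apply: filterS nW => w Ww.
  exact: (@continuous_comp _ _ _ (@row2 R) s w (row2_continuous (x := w)) (cs _ Ww)).
- move=> h /hs -/(_ Uy); rewrite iy0 => /analytic_at_analytic2.
  by congr analytic2; apply/funext => w; rewrite /= add0r.
Qed.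

Lemma coordinates_hol y i : coordinates y i -> hol y (fst_coord i).
Proof.
move=> [/local_modelTP[U [W [s [[oU oW iK sK [ci cs hs]] Uy]]]] iy0].
apply/hs => //; apply/analytic_onT; exists (fun x => x ord0 ord0).
split; first exact: analytic_at_coord0.
have : \forall x \near i y, W x by apply: open_nbhs_nbhs; split=> //; case: (iK y Uy).
by apply: filterS => x /sK[_ /= e] _; rewrite /fst_coord e.
Qed.

Section OneChart.
Variables (y : Y) (u v : Y -> C) (s : C * C -> Y) (ch : chart y u v s).

Lemma chart0 : u y = 0 /\ v y = 0.
Proof. by case: ch => <- _ /nbhs_singleton. Qed.

Lemma chart_cvg : (u z, v z) @[z --> y] --> (0 : C, 0 : C).
Proof.
case: ch => _ _ _ [/nbhs_singleton[cu cv] _] _; have [u0 v0] := chart0.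
rewrite /prop_for /continuous_at u0 in cu; rewrite /prop_for /continuous_at v0 in cv.
exact: cvg_pair cu cv.
Qed.

(** The neighbourhoods of [y] are those of the origin read in the chart. *)
Lemma chart_near (P : set Y) :
  (\forall z \near y, P z) <-> (\forall w \near (0 : C, 0 : C), P (s w)).
Proof.
case: (ch) => s0 us su [/nbhs_singleton[cu cv] /nbhs_singleton cs] _; have [u0 v0] := chart0.
split=> [|hP]; first by rewrite -{1}s0; exact: cs.
have : \forall z \near y, P (s (u z, v z)).
  exact: (chart_cvg hP).
by apply: filterS2 us => z ->.
Qed.

Lemma chart_pull (P : set Y) :
  (\forall z \near y, P z) -> \forall w \near (0 : C, 0 : C), P (s w).
Proof. by move/chart_near. Qed.

Lemma chart_inj : \forall z \near y, u z = 0 -> v z = 0 -> z = y.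
Proof. by case: ch => s0 us _ _ _; apply: filterS us => z + uz vz; rewrite uz vz s0. Qed.

Lemma chart_factor h : hol y h -> (\forall z \near y, h z = 0 -> u z * v z = 0) ->
  exists a b H1, [/\ analytic2 H1, H1 (0, 0) != 0 &
    \forall z \near y, h z = u z ^+ a * v z ^+ b * H1 (u z, v z)].
Proof.
case: (ch) => s0 us su _ hs hy hz; have ah := hs h hy.
have hz' : \forall w \near (0 : C, 0 : C), (h \o s) w = 0 -> w.1 * w.2 = 0.
  move/chart_near: hz; apply: filterS2 su => w /= [-> ->]; exact.
have [a [b [H1 [aH1 H10 hE]]]] := analytic2_factor ah hz'.
exists a, b, H1; split=> //; apply/chart_near.
by apply: filterS2 su hE => w [-> ->] /= ->; case: w.
Qed.

Lemma chart_unit H : analytic2 H -> H (0, 0) != 0 ->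
  (\forall z \near y, H (u z, v z) != 0) /\
  (\forall z \near y, {for z, continuous (fun z => H (u z, v z))}).
Proof.
move=> aH H0; have cH := analytic2_continuous aH; split.
  have : \forall w \near (0 : C, 0 : C), H w != 0.
    exact: near_neq0 (nbhs_singleton cH) H0.
  exact: chart_cvg.
have cHy : \forall z \near y, {for (u z, v z), continuous H}.
  exact: (chart_cvg cH).
case: ch => _ _ _ [cuv _] _; apply: filterS2 cuv cHy => z [cu cv] cHz.
apply: (@continuous_comp _ _ _ (fun z => (u z, v z)) H); last exact: cHz.
exact: cvg_pair cu cv.
Qed.

End OneChart.

Lemma near0_ray (P : set (C * C)) (c : C * C) :
  (\forall w \near (0 : C, 0 : C), P w) ->
  exists2 t : C, t != 0 & P (t * c.1, t * c.2).
Proof.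
move=> /nearCC[e e0 eP].
have A0 : 0 < nrm c.1 + nrm c.2 + 1.
  by have := nrm_ge0 c.1; have := nrm_ge0 c.2; lra.
pose t := e / (nrm c.1 + nrm c.2 + 1).
have t0 : 0 < t by rewrite divr_gt0.
have te : t * (nrm c.1 + nrm c.2 + 1) = e by rewrite divfK // gt_eqF.
have nt : nrm (t%:C%C : C) = t by rewrite nrmC ger0_norm // ltW.
exists t%:C%C; first by rewrite -nrm_gt0 nt.
have c1 := nrm_ge0 c.1; have c2 := nrm_ge0 c.2.
by apply: eP; rewrite /= subr0 nrmM nt -te; nra.
Qed.

(** Two reduced equations of one curve are comparable. In the chart of [u], the other
    equation is [u ^+ a * v ^+ b] times a unit; the axis [v = 0] is not in the
    zero set, so [b = 0], and [a > 0] since it vanishes at the centre. *)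
Lemma defining_functions_le y i i' : coordinates y i -> coordinates y i' ->
  (\forall z \near y, fst_coord i' z = 0 <-> fst_coord i z = 0) ->
  exists2 K : R, 0 < K &
    \forall z \near y, nrm (fst_coord i' z) <= K * nrm (fst_coord i z).
Proof.
move=> ci ci' same; have [s ch] := coordinates_chart ci.
have [s' ch'] := coordinates_chart ci'.
set u := fst_coord i in same ch *; set v := snd_coord i in ch.
set u' := fst_coord i' in same ch' *.
have hz : \forall z \near y, u' z = 0 -> u z * v z = 0.
  by apply: filterS same => z hz /hz ->; rewrite mul0r.
have [a [b [H [aH H0 hE]]]] := chart_factor ch (coordinates_hol ci' : hol y u') hz.
have [Hn0 cH] := chart_unit ch aH H0.
have [_ _ su _ _] := ch.
case: b hE => [|b] hE; last first.
  have [t t0] := near0_ray (1, 0) (filterI su (chart_pull ch (filterI hE same))).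
  move=> [/= [-> ->] []]; rewrite mulr1 mulr0 [0 ^+ b.+1]exprS mul0r mulr0 mul0r => u'0.
  by move=> [/(_ u'0) t00 _]; move: t0; rewrite t00 eqxx.
case: a hE => [|a] hE.
  have [] := nbhs_singleton (filterI hE Hn0); rewrite (chart0 ch').1 !expr0 mul1r mul1r.
  by move=> <-; rewrite eqxx.
pose B := nrm (H (u y, v y)) + 1.
have B0 : 0 < B by rewrite /B; have := nrm_ge0 (H (u y, v y)); lra.
exists B => //; have [u0 v0] := chart0 ch.
have nH : \forall z \near y, nrm (H (u z, v z)) <= B.
  exact: near_nrm_le (nbhs_singleton cH).
have nu : \forall z \near y, nrm (u z) <= 1.
  have [_ _ _ [/nbhs_singleton[cu _] _] _] := ch.
  have := near_nrm_lt cu ltr01; rewrite u0.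
  by apply: filterS => z; rewrite subr0 => /ltW.
near=> z.
have -> : u' z = u z ^+ a.+1 * v z ^+ 0 * H (u z, v z) by near: z.
rewrite expr0 mulr1 exprS !nrmM nrmX mulrC.
have uz : nrm (u z) <= 1 by near: z.
have ua : nrm (u z) ^+ a <= 1 by rewrite exprn_ile1 ?nrm_ge0.
have Hz : nrm (H (u z, v z)) <= B by near: z.
apply: ler_pM; rewrite ?mulr_ge0 ?exprn_ge0 ?nrm_ge0 //.
by rewrite ler_piMr ?nrm_ge0.
Unshelve. all: by end_near.
Qed.

(** Where another branch [v = 0] of the zeros of [h] crosses [E], the cofactor [F]
    vanishes along it; it is only controlled off that branch. [F] is merely
    continuous, so that the property passes to the nearby points of [E] with
    the same [F]. *)
Definition vanishing_order E y h (m : nat) : Prop :=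
  exists i (F : Y -> C), [/\ coordinates y i, local_zero_set E y (fst_coord i),
    \forall z \near y, h z = fst_coord i z ^+ m * F z &
    \forall z \near y, snd_coord i z != 0 -> F z != 0 /\ {for z, continuous F}].

(** Compare the two expressions of [h] near a point [(0, t)] with [t != 0], where both
    cofactors are bounded and bounded below, as the first coordinate tends
    to 0. *)
Lemma vanishing_order_unique E y h m m' : vanishing_order E y h m ->
  vanishing_order E y h m' -> m = m'.
Proof.
wlog mm : m m' / (m < m')%N => [wl|].
  move=> hm hm'; case: (ltngtP m m') => [lt|gt|//]; first exact: wl lt hm hm'.
  exact/esym/(wl _ _ gt hm' hm).
move=> [i [F [ci Ei hE cF]]] [i' [F' [ci' Ei' hE' cF']]]; exfalso.
have [s ch] := coordinates_chart ci; have [s' ch'] := coordinates_chart ci'.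
set u := fst_coord i in Ei hE ch; set v := snd_coord i in cF ch.
set u' := fst_coord i' in Ei' hE' ch'; set v' := snd_coord i' in cF' ch'.
have same : \forall z \near y, u' z = 0 <-> u z = 0.
  by apply: filterS2 Ei Ei' => z -> ->.
have [K K0 uK] := defining_functions_le ci ci' same.
have [_ _ su [cuv cs] _] := ch.
have inj' := chart_inj ch'.
have [u0 v0] := chart0 ch.
have near_axis : \forall z \near y,
    [/\ \forall z' \near z, h z' = u z' ^+ m * F z',
        \forall z' \near z, h z' = u' z' ^+ m' * F' z',
        \forall z' \near z, nrm (u' z') <= K * nrm (u z') &
        [/\ v z != 0 -> F z != 0 /\ {for z, continuous F},
            v' z != 0 -> F' z != 0 /\ {for z, continuous F'},
            u' z = 0 <-> u z = 0 & u' z = 0 -> v' z = 0 -> z = y]].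
  near=> z; split; last split; near: z.
  - exact: near_join hE.
  - exact: near_join hE'.
  - exact: near_join uK.
  - exact: cF.
  - exact: cF'.
  - exact: same.
  - exact: inj'.
have [t t0 /=] := near0_ray (0, 1)
  (filterI (filterI cs (near_join su)) (chart_pull ch near_axis)).
rewrite mulr0 mulr1 => -[[cst sut] [hEt hEt' uKt [cFt cFt' samet injt]]].
have [ut vt] := nbhs_singleton sut.
set z0 := s (0, t) in cst hEt hEt' uKt cFt cFt' samet injt ut vt.
have u't : u' z0 = 0 by apply/samet.
have v't : v' z0 != 0.
  by apply/eqP => /(injt u't) z0y; move: t0; rewrite -[t]vt z0y v0 eqxx.
have [F0 cF0] : F z0 != 0 /\ {for z0, continuous F} by apply: cFt; rewrite vt.
have [_ cF'0] := cFt' v't.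
have d0 : 0 < nrm (F z0) by rewrite nrm_gt0.
pose B := nrm (F' z0) + 1.
have B0 : 0 < B by rewrite /B; have := nrm_ge0 (F' z0); lra.
have nF := near_nrm_ge cF0 F0.
have nF' : \forall z \near z0, nrm (F' z) <= B by exact: near_nrm_le.
have /cst : \forall z \near z0, [/\ h z = u z ^+ m * F z, h z = u' z ^+ m' * F' z,
    nrm (u' z) <= K * nrm (u z), nrm (F z0) / 2 <= nrm (F z) & nrm (F' z) <= B].
  by near=> z; split; near: z.
rewrite -/(near _ _) => /(filterI sut) /nearCC[e e0 eP].
have KB : 0 < K ^+ m' * B by rewrite mulr_gt0 // exprn_gt0.
have bound0 : 0 < nrm (F z0) / 2 / (K ^+ m' * B) by rewrite !divr_gt0.
have [x [x0 x1 xe xF]] := exists_small3 ltr01 e0 bound0.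
have nx : nrm (x%:C%C : C) = x by rewrite nrmC ger0_norm // ltW.
have := eP (x%:C%C, t); rewrite /= subr0 nx subrr nrm0 => /(_ xe e0).
move=> [[ux _]] [h1 h2 h3 h4 h5].
move: h1; rewrite h2 => /(congr1 (@nrm R)); rewrite !nrmM !nrmX => h1.
move: h3 h1; rewrite ux /= nx => h3 h1.
have e1 : nrm (u' (s (x%:C%C, t))) ^+ m' * nrm (F' (s (x%:C%C, t))) <= (K * x) ^+ m' * B.
  rewrite ler_pM ?exprn_ge0 ?nrm_ge0 // lerXn2r ?nnegrE ?nrm_ge0 //.
  by rewrite mulr_ge0 // ltW.
have e2 : x ^+ m * (nrm (F z0) / 2) <= x ^+ m * nrm (F (s (x%:C%C, t))).
  by rewrite ler_wpM2l // exprn_ge0 // ltW.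
have e3 : (K * x) ^+ m' * B <= x ^+ m * (x * (K ^+ m' * B)).
  rewrite exprMn [_ * x ^+ m']mulrC -[X in X <= _]mulrA [X in _ <= X]mulrA -exprSr.
  by rewrite ler_wpM2r ?(ltW KB) // ler_wiXn2l // ltW.
have : x ^+ m * (nrm (F z0) / 2) <= x ^+ m * (x * (K ^+ m' * B)).
  by apply: le_trans e2 _; rewrite -h1; apply: le_trans e1 e3.
rewrite ler_pM2l ?exprn_gt0 //.
by move: xF; rewrite ltr_pdivlMr // ltNge => /negP.
Unshelve. all: by end_near.
Qed.

Lemma vanishing_order_near E y h m : vanishing_order E y h m ->
  \forall z \near y, E z -> vanishing_order E z h m.
Proof.
move=> voy; case: (voy) => i [F [ci Ei hE cF]].
have [s ch] := coordinates_chart ci; have inj := chart_inj ch.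
have [_ _ _ [cuv _] _] := ch.
near=> z => Ez.
have uz : fst_coord i z = 0 by apply/(near (_ : local_zero_set E y (fst_coord i)) z).
have [vz|vz] := eqVneq (snd_coord i z) 0.
  have -> : z = y by move: uz vz; near: z.
  exact: voy.
have fE : fst_coord (fun z' => i z' - i z) = fst_coord i.
  by apply/funext => z'; rewrite /fst_coord !mxE -[i z ord0 ord0]/(fst_coord i z) uz subr0.
exists (fun z' => i z' - i z), F; rewrite fE; split.
- by near: z; exact: coordinates_near.
- by near: z; exact: (near_join Ei).
- by near: z; exact: (near_join hE).
- have cv : {for z, continuous (snd_coord i)} by near: z; apply: filterS cuv => ? [].
  have nv := near_neq0 cv vz.
  have nF : \forall z' \near z, snd_coord i z' != 0 -> F z' != 0 /\ {for z', continuous F}.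
    by near: z; exact: (near_join cF).
  by apply: filterS2 nv nF => z' + /[swap] _ => /[swap]; apply.
Unshelve. all: by end_near.
Qed.

Lemma vanishing_order_constant E h y y' m m' : connected E ->
  (forall z, E z -> exists k, vanishing_order E z h k) ->
  E y -> vanishing_order E y h m -> E y' -> vanishing_order E y' h m' -> m = m'.
Proof.
move=> cE ex Ey voy Ey' voy'.
apply: (vanishing_order_unique _ voy').
apply: (@connected_locally_constant _ E (fun z => vanishing_order E z h m) cE
         _ _ y Ey voy y' Ey') => z Ez voz.
  exact: vanishing_order_near.
have [k vk] := ex z Ez; have := vanishing_order_near vk.
apply: filterS => z' vz' /vz' {}vz' vm.
by apply: voz; rewrite (vanishing_order_unique vm vz').
Qed.

End Charts.

(** * Components of a normal crossings curve *)

Section ConnectedComponents.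
Variable T : topologicalType.

Lemma connectedU1 (A : set T) z : connected A -> closure A z -> connected (A `|` [set z]).
Proof.
move=> cA Az B [b Bb] [U oU BU] [F clF BF].
have subF : A `<=` F -> B = A `|` [set z].
  move=> AF; have Fz : F z by apply: clF; exact: (closure_subset AF).
  by rewrite BF; apply/seteqP; split=> [x []//|x []Ax]; split; [left|exact: AF|right|rewrite Ax].
have [[a [Aa Ba]]|AB] := pselect (A `&` B !=set0).
  apply: subF => x Ax; suff : (A `&` B) x by rewrite BF => -[_ []].
  suff -> : A `&` B = A by [].
  apply: cA; first by exists a.
    by exists U => //; rewrite BU setIA; congr (_ `&` _); apply/seteqP; split=> [x' []|x' ?] //; split=> //; left.
  by exists F => //; rewrite BF setIA; congr (_ `&` _); apply/seteqP; split=> [x' []|x' ?] //; split=> //; left.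
have Uz : U z.
  move: Bb; rewrite BU => -[[Ab Ub|->//]]; exfalso; apply: AB.
  by exists b; split=> //; rewrite BU; split=> //; left.
have [x [Ax Ux]] := Az U (open_nbhs_nbhs (conj oU Uz)).
by exfalso; apply: AB; exists x; split=> //; rewrite BU; split=> //; left.
Qed.

Lemma connected_component_closure (A : set T) y z :
  A z -> closure (connected_component A y) z -> connected_component A y z.
Proof.
move=> Az clz; have [Ay|nAy] := pselect (A y); last first.
  by move: clz; rewrite connected_component_out // closure0.
have cU := connectedU1 (@component_connected _ A y) clz.
apply: (connected_component_max _ _ cU); last by right.
  by left; exact: connected_component_refl.
by move=> x [/connected_component_sub//|->].
Qed.

End ConnectedComponents.

Section CrossingPairs.
Variables (R : realType) (Y : fspace R).
Local Notation C := (CC R).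
Implicit Types (y z : Y) (i : Y -> Cn R 2) (h F G : Y -> C) (D E : set Y).
Implicit Types (m n b d : nat).

(** The local form of a function whose zeros lie on the axes of the coordinates. *)
Definition factors y i h m b : Prop := exists H : C * C -> C,
  [/\ analytic2 H, H (0, 0) != 0 & \forall z \near y,
    h z = fst_coord i z ^+ m * snd_coord i z ^+ b * H (fst_coord i z, snd_coord i z)].

Lemma factors_exist y i h : coordinates y i -> hol y h ->
  (\forall z \near y, h z = 0 -> fst_coord i z * snd_coord i z = 0) ->
  exists m b, factors y i h m b.
Proof.
move=> ci hy hz; have [s ch] := coordinates_chart ci.
by have [m [b [H HP]]] := chart_factor ch hy hz; exists m, b, H.
Qed.

Lemma factors_swap y i h m b : factors y i h m b ->
  factors y (@swap_coords R \o i) h b m.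
Proof.
move=> [H [aH H0 hE]]; exists (H \o @swap R); split.
- exact: analytic2_swap.
- exact: H0.
by apply: filterS hE => z ->; rewrite fst_coord_swap snd_coord_swap /=; ring.
Qed.

Lemma factors_zero y i h m b : coordinates y i -> factors y i h m b ->
  \forall z \near y, snd_coord i z != 0 -> h z = 0 <-> (0 < m)%N /\ fst_coord i z = 0.
Proof.
move=> ci [H [aH H0 hE]]; have [s ch] := coordinates_chart ci.
have [Hn0 _] := chart_unit ch aH H0.
apply: filterS2 hE Hn0 => z -> Hz vz; split=> [/eqP|[m0 ->]].
  by rewrite !mulf_eq0 !expf_eq0 (negbTE Hz) (negbTE vz) andbF !orbF => /andP[? /eqP].
by rewrite expr0n -[m]prednK //= !mul0r.
Qed.

Lemma factors_vanishing_order E y i h m b : coordinates y i ->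
  local_zero_set E y (fst_coord i) -> factors y i h m b -> vanishing_order E y h m.
Proof.
move=> ci Ei [H [aH H0 hE]]; have [s ch] := coordinates_chart ci.
have [Hn0 cH] := chart_unit ch aH H0; have [_ _ _ [cuv _] _] := ch.
exists i, (fun z => snd_coord i z ^+ b * H (fst_coord i z, snd_coord i z)); split.
- exact: ci.
- exact: Ei.
- by apply: filterS hE => z ->; rewrite mulrA.
near=> z => vz; split.
  by rewrite mulf_neq0 ?expf_neq0 //; near: z.
have [_ cv] : {for z, continuous (fst_coord i)} /\ {for z, continuous (snd_coord i)}.
  by near: z.
have cHz : {for z, continuous (fun z => H (fst_coord i z, snd_coord i z))} by near: z.
exact: (@cvgM C Y (nbhs z) _ (fun z => snd_coord i z ^+ b)
  (fun z => H (fst_coord i z, snd_coord i z)) _ _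
  (@cvg_exp C Y (nbhs z) _ (snd_coord i) (snd_coord i z) b cv) cHz).
Unshelve. all: by end_near.
Qed.

Lemma chart_axis y u v s (P : set Y) (ch : @chart R Y y u v s) :
  (\forall z \near y, P z) -> exists z, [/\ P z, u z = 0 & v z != 0].
Proof.
have [_ _ su _ _] := ch.
move=> /(chart_pull ch) nP; have [t t0] := near0_ray (0, 1) (filterI su nP).
rewrite mulr0 mulr1 => -[[ut vt] Pt].
by exists (s (0, t)); split; rewrite ?ut ?vt.
Qed.

Lemma coordinates_axis y i (P : set Y) : coordinates y i -> (\forall z \near y, P z) ->
  exists z, [/\ P z, fst_coord i z = 0 & snd_coord i z != 0].
Proof. by move=> /coordinates_chart[s ch]; exact: chart_axis ch. Qed.

Lemma factors_pos y i h m b : coordinates y i -> factors y i h m b ->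
  (\forall z \near y, fst_coord i z = 0 -> h z = 0) -> (0 < m)%N.
Proof.
move=> ci fa hz.
have [z [[zz hz'] uz vz]] := coordinates_axis ci (filterI (factors_zero ci fa) hz).
by have [] := (zz vz).1 (hz' uz).
Qed.

Lemma coordinates_at0 y i : coordinates y i -> fst_coord i y = 0 /\ snd_coord i y = 0.
Proof. by move=> [_ iy0]; rewrite /fst_coord /snd_coord iy0 !mxE. Qed.

Lemma smooth_curve_at_in D y : smooth_curve_at D y -> D y.
Proof.
by move=> [i [ci /nbhs_singleton[_]]]; apply; case: (coordinates_at0 ci).
Qed.

Lemma smooth_curve_at_recenter D y i : coordinates y i ->
  \forall z \near y, fst_coord i z = 0 -> local_zero_set D z (fst_coord i) ->
    [/\ smooth_curve_at D z, coordinates z (fun z' => i z' - i z) &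
      fst_coord (fun z' => i z' - i z) = fst_coord i].
Proof.
move=> ci; apply: filterS (coordinates_near ci) => z ciz uz Dz.
have fE : fst_coord (fun z' => i z' - i z) = fst_coord i.
  by apply/funext => z'; rewrite /fst_coord !mxE -[i z ord0 ord0]/(fst_coord i z) uz subr0.
by split=> //; exists (fun z' => i z' - i z); rewrite fE.
Qed.

(** The ray from [z] to [y] in the axis stays, except for its end [y], inside the smooth
    part of [D]. *)
Lemma closure_cc_ray y i D : coordinates y i ->
  (\forall z \near y, fst_coord i z = 0 -> snd_coord i z != 0 -> smooth_curve_at D z) ->
  \forall z \near y, fst_coord i z = 0 -> snd_coord i z != 0 ->
    closure (connected_component [set z | smooth_curve_at D z] z) y.
Proof.
move=> ci reg; have [s ch] := coordinates_chart ci.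
have [s0 us su [/nbhs_singleton[cu cv] cs] _] := ch.
have [u0 v0] := coordinates_at0 ci.
set u := fst_coord i in reg ch us su cu u0 *.
set v := snd_coord i in reg ch us su cv v0 *.
have [e e0 eP] := (nearCC _ _).1 (filterI (filterI su cs) (chart_pull ch reg)).
have nv := near_nrm_lt cv e0; rewrite v0 in nv.
apply: filterS2 us nv => z; rewrite subr0 => sz vz uz vz0.
(* The half-open ray, for [0 < t <= 1]. *)
pose gam (t : R) := s (0, t%:C%C * v z).
have nt (t : R) : 0 < t <= 1 -> nrm (t%:C%C * v z) < e.
  move=> /andP[t0 t1]; rewrite nrmM nrmC ger0_norm ?(ltW t0) //.
  by apply: le_lt_trans vz; rewrite ler_piMl ?nrm_ge0.
have gP (t : R) : 0 < t <= 1 ->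
    {for (0, t%:C%C * v z), continuous s} /\ smooth_curve_at D (gam t).
  move=> t01; have := eP (0, t%:C%C * v z); rewrite /= !subr0 nrm0 => /(_ e0 (nt t t01)).
  move=> [[[ug vg] cst]]; rewrite /gam ug vg /= => /(_ erefl) sm; split=> //; apply: sm.
  rewrite mulf_neq0 // -nrm_gt0 nrmC ger0_norm; case/andP: t01 => //.
  by move=> /ltW.
pose S := gam @` `]0, 1]%classic.
have cS : connected S.
  apply: connected_continuous_connected.
    by apply/connected_intervalP; exact: interval_is_interval.
  apply: continuous_in_subspaceT => t /set_mem /=; rewrite in_itv /= => t01.
  have [cst _] := gP t t01.
  apply: (@continuous_comp _ _ _ (fun t : R => (0, t%:C%C * v z) : C * C) s) cst.
  move=> A /nearCC[e' e'0 eA]; apply/nbhs_ballP; exists (e' / (nrm (v z) + 1)) => /=.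
    by rewrite divr_gt0 //; have := nrm_ge0 (v z); lra.
  move=> t' tt'; apply: eA; rewrite /= ?subrr ?nrm0 //.
  rewrite -mulrBl -rmorphB nrmM nrmC distrC.
  move: tt'; rewrite /ball /= ltr_pdivlMr; last by have := nrm_ge0 (v z); lra.
  by have := normr_ge0 (t - t'); have := nrm_ge0 (v z); nra.
have zS : S z.
  exists 1; first by rewrite /= in_itv /= ltr01 lexx.
  by rewrite /gam rmorph1 mul1r -[RHS]sz uz.
have Sreg : S `<=` [set z | smooth_curve_at D z].
  by move=> _ [t + <-]; rewrite /= in_itv /= => /gP[].
have SC := connected_component_max zS Sreg cS.
move=> B By; have /nearCC[e' e'0 eB] : \forall w \near (0 : C, 0 : C), B (s w).
  exact: (chart_pull ch).
pose t := Num.min 1 (e' / (nrm (v z) + 1)).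
have vz1 : 0 < nrm (v z) + 1 by have := nrm_ge0 (v z); lra.
have t0 : 0 < t by rewrite lt_min ltr01 divr_gt0.
have t1 : t <= 1 by rewrite ge_min lexx.
have te : t * (nrm (v z) + 1) <= e' by rewrite -ler_pdivlMr // ge_min lexx orbT.
exists (gam t); split; first by apply: SC; exists t => //; rewrite /= in_itv /= t0.
apply: eB; rewrite /= subr0 ?nrm0 // nrmM nrmC ger0_norm ?(ltW t0) //; nra.
Qed.

(** On a resolution, [D] is the exceptional curve and [F], [G] are the pull-backs of
    the two functions. The conditions are symmetric in [F] and [G], so statements
    on edges that enter and on edges that leave a component follow from each
    other. *)
Definition crossing_pair D F G : Prop :=
  [/\ compact D /\ closed D,
      forall y, D y -> hol y F /\ hol y G,
      forall y, D y -> \forall z \near y, D z <-> F z = 0 /\ G z = 0,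
      forall y, D y -> exists i, coordinates y i /\
        \forall z \near y, F z * G z = 0 -> fst_coord i z * snd_coord i z = 0 &
      forall E, irreducible_component D E -> forall y, E y -> smooth_curve_at E y].

Lemma crossing_pairC D F G : crossing_pair D F G -> crossing_pair D G F.
Proof.
move=> [cD hol nD nc sm]; split=> //.
- by move=> y /hol[].
- by move=> y /nD; apply: filterS => z ->; split=> -[].
- move=> y /nc[i [ci nci]]; exists i; split=> //.
  by apply: filterS nci => z + GF; apply; rewrite mulrC.
Qed.

Definition adapted F G E y i m b n d : Prop :=
  [/\ coordinates y i, local_zero_set E y (fst_coord i),
      factors y i F m b & factors y i G n d].

Lemma adaptedC F G E y i m b n d : adapted F G E y i m b n d ->
  adapted G F E y i n d m b.
Proof. by case. Qed.

Section OnePair.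
Variables (D : set Y) (F G : Y -> C) (cp : crossing_pair D F G).
Let reg := [set z | smooth_curve_at D z].

Lemma component_sub E : irreducible_component D E -> E `<=` D.
Proof.
move=> [y [_ ->]]; have [[_ clD] _ _ _ _] := cp.
have CD : connected_component reg y `<=` D.
  by move=> z /connected_component_sub; exact: smooth_curve_at_in.
by move=> z /(closure_subset CD)/clD.
Qed.

Lemma component_connected_set E : irreducible_component D E -> connected E.
Proof.
by move=> [y [_ ->]]; apply: connected_closure; exact: component_connected.
Qed.

Lemma component_compact E : irreducible_component D E -> compact E.
Proof.
move=> cE; have [[coD _] _ _ _ _] := cp.
apply: (subclosed_compact _ coD); last exact: component_sub.
by case: cE => y [_ ->]; exact: closed_closure.
Qed.

Lemma component_nonempty E : irreducible_component D E -> exists y, E y.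
Proof.
move=> [y [sy ->]]; exists y; apply: subset_closure.
exact: connected_component_refl.
Qed.

(** The point [z] is in the closure of the connected component that defines [E], hence
    in this component, and connected components that meet coincide. *)
Lemma component_at E z : irreducible_component D E -> E z -> smooth_curve_at D z ->
  E = closure (connected_component reg z).
Proof.
move=> [y [sy ->]] clz sz; congr closure.
by apply/same_connected_component/connected_component_closure.
Qed.

Lemma crossing_coordinates_factors y i : D y -> coordinates y i ->
  (\forall z \near y, F z * G z = 0 -> fst_coord i z * snd_coord i z = 0) ->
  exists m b n d, factors y i F m b /\ factors y i G n d.
Proof.
move=> Dy ci nci; have [_ /(_ y Dy)[hF hG] _ _ _] := cp.
have [|m [b fF]] := factors_exist ci hF.
  by apply: filterS nci => z + Fz; apply; rewrite Fz mul0r.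
have [|n [d fG]] := factors_exist ci hG.
  by apply: filterS nci => z + Gz; apply; rewrite Gz mulr0.
by exists m, b, n, d.
Qed.

(** If [E] were the cross [u * v = 0], its defining coordinate would vanish to
    order at least 2 at [y]; since [u] and [v] are Lipschitz functions of the
    coordinates adapted to [E], this is impossible. *)
Lemma component_branch E y i : irreducible_component D E -> E y -> coordinates y i ->
  (\forall z \near y, F z * G z = 0 -> fst_coord i z * snd_coord i z = 0) ->
  local_zero_set E y (fst_coord i) \/ local_zero_set E y (snd_coord i).
Proof.
move=> cE Ey ci nci; have ED := component_sub cE.
have [_ _ nD _ /(_ E cE y Ey)[i1 [ci1 Ei1]]] := cp.
have {}nD := nD y (ED y Ey).
have [s ch] := coordinates_chart ci.
have E_uv : \forall z \near y, fst_coord i1 z = 0 -> fst_coord i z * snd_coord i z = 0.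
  near=> z => u1z.
  have Ez : E z by apply/(near Ei1 z).
  have [Fz _] : F z = 0 /\ G z = 0 by apply/(near nD z) => //; exact: ED.
  by apply: (near nci z) => //; rewrite Fz mul0r.
have [a [b [H [aH H0 hE]]]] := chart_factor ch (coordinates_hol ci1) E_uv.
have [Hn0 cH] := chart_unit ch aH H0.
case: a b hE => [|a] [|b] hE.
- exfalso; have [] := nbhs_singleton (filterI hE Hn0).
  by rewrite (coordinates_at0 ci1).1 !expr0 !mul1r => <-; rewrite eqxx.
- right; near=> z; rewrite (near Ei1 z) // (near hE z) // expr0 mul1r.
  split=> [/eqP|->]; last by rewrite exprS !mul0r.
  by rewrite mulf_eq0 expf_eq0 /= (negbTE (near Hn0 z _)) // orbF => /eqP.
- left; near=> z; rewrite (near Ei1 z) // (near hE z) // expr0 mulr1.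
  split=> [/eqP|->]; last by rewrite exprS !mul0r.
  by rewrite mulf_eq0 expf_eq0 /= (negbTE (near Hn0 z _)) // orbF => /eqP.
exfalso; have [s1 ch1] := coordinates_chart ci1.
have [s10 _ su1 _ hs1] := ch1.
have au := hs1 _ (coordinates_hol ci).
have := hs1 _ (coordinates_hol (coordinates_swap ci)); rewrite fst_coord_swap => av.
have [Ku [ru [Ku0 ru0 lipu]]] := analytic2_lipschitz au.
have [Kv [rv [Kv0 rv0 lipv]]] := analytic2_lipschitz av.
rewrite /= s10 (coordinates_at0 ci).1 in lipu; rewrite /= s10 (coordinates_at0 ci).2 in lipv.
pose B := nrm (H (fst_coord i y, snd_coord i y)) + 1.
have B0 : 0 < B by rewrite /B; have := nrm_ge0 (H (fst_coord i y, snd_coord i y)); lra.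
have nH : \forall z \near y, nrm (H (fst_coord i z, snd_coord i z)) <= B.
  exact: near_nrm_le (nbhs_singleton cH).
have [_ _ _ [/nbhs_singleton[cu cv] _] _] := ch.
have nu1 : \forall z \near y, nrm (fst_coord i z) <= 1 /\ nrm (snd_coord i z) <= 1.
  have := near_nrm_lt cu ltr01; have := near_nrm_lt cv ltr01.
  rewrite (coordinates_at0 ci).1 (coordinates_at0 ci).2; apply: filterS2 => z.
  by rewrite !subr0 => /ltW ? /ltW.
have nbox : \forall z \near y, fst_coord i1 z = fst_coord i z ^+ a.+1 *
      snd_coord i z ^+ b.+1 * H (fst_coord i z, snd_coord i z) /\
    (nrm (H (fst_coord i z, snd_coord i z)) <= B /\
     (nrm (fst_coord i z) <= 1 /\ nrm (snd_coord i z) <= 1)).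
  by near=> z; split; [|split]; near: z.
have [e e0 eP] := (nearCC _ _).1 (filterI su1 (chart_pull ch1 nbox)).
(* At the point with coordinates [(t, 0)] adapted to [E], the equation of [E] gives [t <= A * t ^ 2]. *)
pose A := Ku * Kv * B; have A0 : 0 <= A by rewrite !mulr_ge0 // ltW.
have A1 : 0 < A + 1 by lra.
have A1V : 0 < 1 / (A + 1) by rewrite divr_gt0.
have r0 : 0 < Num.min ru rv by rewrite lt_min ru0.
have [t [t0 + te tA]] := exists_small3 r0 e0 A1V.
rewrite lt_min => /andP[/ltW tu /ltW tv].
rewrite ltr_pdivlMr // in tA.
have nt : nrm (t%:C%C : C) = t by rewrite nrmC ger0_norm // ltW.
have bt : in_bidisc (t%:C%C : C, 0 : C) t by split; rewrite /= ?nt ?nrm0 // ltW.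
have := lipu _ t tu bt; have := lipv _ t tv bt; rewrite /= !subr0.
have := eP (t%:C%C, 0); rewrite /= !subr0 nt nrm0 => /(_ te e0).
set z := s1 (t%:C%C, 0) => -[[u1z _] [hz [Hz [uz1 vz1]]]] vz uz.
move: hz; rewrite u1z => /(congr1 (@nrm R)); rewrite nt !nrmM !nrmX => tE.
move: tE Hz uz1 vz1 vz uz; move: (nrm_ge0 (fst_coord i z)) (nrm_ge0 (snd_coord i z)).
move: (nrm_ge0 (H (fst_coord i z, snd_coord i z))).
set x := nrm (fst_coord i z); set x' := nrm (snd_coord i z); set q := nrm (H _).
move=> q0 x0 x'0 tE qB x1 x'1 xv xu.
have xa : x ^+ a.+1 <= Ku * t.
  by apply: le_trans xu; rewrite exprS ler_piMr // exprn_ile1.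
have xb : x' ^+ b.+1 <= Kv * t.
  by apply: le_trans xv; rewrite exprS ler_piMr // exprn_ile1.
have : t <= Ku * t * (Kv * t) * B.
  rewrite tE; apply: ler_pM => //; first by rewrite mulr_ge0 ?exprn_ge0.
  rewrite -tE; apply: ler_pM; rewrite ?exprn_ge0 //.
have -> : Ku * t * (Kv * t) * B = t * (t * A) by rewrite /A; ring.
by rewrite -{1}[t]mulr1 ler_pM2l //; lra.
Unshelve. all: by end_near.
Qed.

(** Where [v != 0], each of [F] and [G] vanishes exactly on [u = 0]. *)
Lemma axis_smooth y i m b n d : D y -> coordinates y i ->
  factors y i F m b -> factors y i G n d -> (0 < m)%N -> (0 < n)%N ->
  \forall z \near y, fst_coord i z = 0 -> snd_coord i z != 0 -> smooth_curve_at D z.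
Proof.
move=> Dy ci fF fG m0 n0; have [_ _ /(_ y Dy) nD _ _] := cp.
have zF := factors_zero ci fF; have zG := factors_zero ci fG.
have [s ch] := coordinates_chart ci; have [_ _ _ [cuv _] _] := ch.
have nz : \forall z \near y, snd_coord i z != 0 -> D z <-> fst_coord i z = 0.
  near=> z => vz; have Fz := (near zF z _) vz; have Gz := (near zG z _) vz.
  rewrite (near nD z) //; split=> [[+ _]|uz]; first by rewrite Fz // => -[].
  by split; [apply/Fz|apply/Gz].
near=> z => uz vz.
have rec : fst_coord i z = 0 -> local_zero_set D z (fst_coord i) ->
    [/\ smooth_curve_at D z, coordinates z (fun z' => i z' - i z) &
      fst_coord (fun z' => i z' - i z) = fst_coord i].
  by near: z; exact: smooth_curve_at_recenter.
suff Dz : local_zero_set D z (fst_coord i) by have [] := rec uz Dz.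
have cv : {for z, continuous (snd_coord i)} by near: z; apply: filterS cuv => ? [].
have nz' : \forall z' \near z, snd_coord i z' != 0 -> D z' <-> fst_coord i z' = 0.
  by near: z; exact: near_join nz.
by apply: filterS2 (near_neq0 cv vz) nz' => z' + h; exact.
Unshelve. all: by end_near.
Qed.

Lemma component_factors_pos E y i m b n d : irreducible_component D E -> E y ->
  adapted F G E y i m b n d -> (0 < m)%N /\ (0 < n)%N.
Proof.
move=> cE Ey [ci Ei fF fG]; have ED := component_sub cE.
have [_ _ /(_ y (ED y Ey)) nD _ _] := cp.
have zFG : \forall z \near y, fst_coord i z = 0 -> F z = 0 /\ G z = 0.
  by apply: filterS2 nD Ei => z nDz Eiz /Eiz /ED /nDz.
by split; [apply: factors_pos ci fF _|apply: factors_pos ci fG _];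
  apply: filterS zFG => z h /h[].
Qed.

Lemma component_unique_branch E1 E2 y i :
  irreducible_component D E1 -> irreducible_component D E2 -> E1 y -> coordinates y i ->
  (\forall z \near y, F z * G z = 0 -> fst_coord i z * snd_coord i z = 0) ->
  local_zero_set E1 y (fst_coord i) -> local_zero_set E2 y (fst_coord i) -> E1 = E2.
Proof.
move=> c1 c2 E1y ci nci E1i E2i; have Dy := component_sub c1 E1y.
have [m [b [n [d [fF fG]]]]] := crossing_coordinates_factors Dy ci nci.
have [m0 n0] := component_factors_pos c1 E1y (And4 ci E1i fF fG).
have sm := axis_smooth Dy ci fF fG m0 n0.
have [z [[smz [E1z E2z]] uz vz]] := coordinates_axis ci (filterI sm (filterI E1i E2i)).
rewrite (component_at c1 (E1z.2 uz) (smz uz vz)).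
by rewrite (component_at c2 (E2z.2 uz) (smz uz vz)).
Qed.

Lemma adapted_exists E y : irreducible_component D E -> E y ->
  exists i m b n d, adapted F G E y i m b n d /\
   (\forall z \near y, F z * G z = 0 -> fst_coord i z * snd_coord i z = 0).
Proof.
move=> cE Ey; have Dy := component_sub cE Ey.
have [_ _ _ /(_ y Dy)[i [ci nci]] _] := cp.
wlog Ei : i ci nci / local_zero_set E y (fst_coord i) => [wl|].
  have [Ei|Ei] := component_branch cE Ey ci nci; first exact: (wl i).
  apply: (wl (@swap_coords R \o i)); rewrite ?fst_coord_swap ?snd_coord_swap //.
    exact: coordinates_swap.
  by apply: filterS nci => z h /h; rewrite mulrC.
have [m [b [n [d [fF fG]]]]] := crossing_coordinates_factors Dy ci nci.
by exists i, m, b, n, d.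
Qed.

(** Along [v = 0] both functions vanish, so this axis lies in [D]; the
    component that it spans near [y] contains [y] in its closure. *)
Lemma crossing_neighbor E y i m b n d : irreducible_component D E -> E y ->
  adapted F G E y i m b n d ->
  (\forall z \near y, F z * G z = 0 -> fst_coord i z * snd_coord i z = 0) ->
  (0 < b)%N -> (0 < d)%N ->
  exists E', [/\ irreducible_component D E', E' y, E <> E' &
                 local_zero_set E' y (snd_coord i)].
Proof.
move=> cE Ey [ci Ei fF fG] nci b0 d0; have Dy := component_sub cE Ey.
have ci' := coordinates_swap ci.
have sm := axis_smooth Dy ci' (factors_swap fF) (factors_swap fG) b0 d0.
have ray := closure_cc_ray ci' sm.
have [z [[smz [rayz Eiz]] uz vz]] := coordinates_axis ci' (filterI sm (filterI ray Ei)).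
have cz : connected_component reg z z by apply/connected_component_refl/smz.
have E'y := rayz uz vz.
exists (closure (connected_component reg z)).
have cE' : irreducible_component D (closure (connected_component reg z)).
  by exists z; split=> //; exact: smz.
have nE : ~ E z.
  by move=> /Eiz; move: vz; rewrite snd_coord_swap => /eqP.
have EE' : E <> closure (connected_component reg z).
  by move=> EE'; apply: nE; rewrite EE'; exact: subset_closure.
split=> //.
have [E'i|//] := component_branch cE' E'y ci nci.
by case: EE'; exact: component_unique_branch cE cE' Ey ci nci Ei E'i.
Qed.

(** A component that meets a small neighbourhood of [y] contains a point of one of the
    axes where [D] is smooth, hence the ray from that point to [y]. *)
Lemma near_components y : D y ->
  \forall z \near y, forall E, irreducible_component D E -> E z -> E y.
Proof.
move=> Dy; have [_ _ /(_ y Dy) nD /(_ y Dy)[i [ci nci]] _] := cp.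
have [m [b [n [d [fF fG]]]]] := crossing_coordinates_factors Dy ci nci.
have key j m' b' n' d' : coordinates y j -> factors y j F m' b' -> factors y j G n' d' ->
    \forall z \near y, smooth_curve_at D z -> fst_coord j z = 0 -> snd_coord j z != 0 ->
      closure (connected_component reg z) y.
  move=> cj fF' fG'; have zF := factors_zero cj fF'; have zG := factors_zero cj fG'.
  have [/andP[m0 n0]|mn] := boolP ((0 < m')%N && (0 < n')%N).
    have ray := closure_cc_ray cj (axis_smooth Dy cj fF' fG' m0 n0).
    by apply: filterS ray => z h _.
  near=> z => /smooth_curve_at_in Dz uz vz; exfalso.
  have [zFz zGz] : (F z = 0 <-> (0 < m')%N /\ fst_coord j z = 0) /\
      (G z = 0 <-> (0 < n')%N /\ fst_coord j z = 0).
    by split; move: vz; near: z.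
  have [/zFz[m0 _] /zGz[n0 _]] : F z = 0 /\ G z = 0 by move: Dz; near: z; apply: filterS nD => ? [].
  by move: mn; rewrite m0 n0.
have k1 := key _ _ _ _ _ ci fF fG.
have k2 := key _ _ _ _ _ (coordinates_swap ci) (factors_swap fF) (factors_swap fG).
rewrite fst_coord_swap snd_coord_swap in k2.
have [s ch] := coordinates_chart ci; have inj := chart_inj ch.
have good : \forall z \near y, smooth_curve_at D z ->
    closure (connected_component reg z) y.
  near=> z => smz; have Dz := smooth_curve_at_in smz.
  have [Fz _] : F z = 0 /\ G z = 0 by apply/(near nD z).
  have /eqP : fst_coord i z * snd_coord i z = 0.
    by apply: (near nci z) => //; rewrite Fz mul0r.
  rewrite mulf_eq0; have [uz _|uz /= /eqP vz] := eqVneq (fst_coord i z) 0.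
    have [vz|vz] := eqVneq (snd_coord i z) 0.
      have zy : z = y by apply: (near inj z).
      by rewrite -zy; apply: subset_closure; exact: connected_component_refl.
    exact: (near k1 z).
  exact: (near k2 z).
apply: filterS (near_join good) => z goodz E cE Ez.
case: (cE) => x [smx EE].
have [z' [Cz' gz']] : (connected_component reg x `&` [set z | smooth_curve_at D z ->
    closure (connected_component reg z) y]) !=set0.
  by move: Ez; rewrite EE; apply.
have smz' : smooth_curve_at D z' by exact: connected_component_sub Cz'.
have -> : E = closure (connected_component reg z').
  by apply: (component_at cE _ smz'); rewrite EE; exact: subset_closure.
exact: gz'.
Unshelve. all: by end_near.
Qed.

Lemma finite_components_at y : D y ->
  finite_set [set E | irreducible_component D E /\ E y].
Proof.
move=> Dy; have [_ _ _ /(_ y Dy)[i [ci nci]] _] := cp.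
have nci' : \forall z \near y, F z * G z = 0 ->
    fst_coord (@swap_coords R \o i) z * snd_coord (@swap_coords R \o i) z = 0.
  by apply: filterS nci => z h /h; rewrite fst_coord_swap snd_coord_swap mulrC.
pose S j := [set E | [/\ irreducible_component D E, E y & local_zero_set E y (fst_coord j)]].
have fS j : coordinates y j -> (\forall z \near y, F z * G z = 0 ->
    fst_coord j z * snd_coord j z = 0) -> finite_set (S j).
  move=> cj ncj; have [[E0 [cE0 E0y E0j]]|none] := pselect (S j !=set0).
    apply: (sub_finite_set _ (finite_set1 E0)) => E [cE Ey Ej].
    exact: component_unique_branch cE cE0 Ey cj ncj Ej E0j.
  by apply: (sub_finite_set _ (finite_set0 _)) => E SE; apply: none; exists E.
apply: (@sub_finite_set _ _ (S i `|` S (@swap_coords R \o i))).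
  move=> E [cE Ey]; have [Ei|Ei] := component_branch cE Ey ci nci; [left|right] => //.
  by split=> //; rewrite fst_coord_swap.
rewrite finite_setU; split; first exact: fS.
by apply: fS => //; exact: coordinates_swap.
Qed.

Lemma finite_components : finite_set [set E | irreducible_component D E].
Proof.
have [[coD _] _ _ _ _] := cp.
(* Finite sets of components, directed by inclusion: locally one of them contains all the components, and compactness makes this global. *)
pose larger : set_system (set (set Y)) := [set A | exists S0 : set (set Y),
  finite_set S0 /\ forall S, finite_set S -> S0 `<=` S -> A S].
have fl : Filter larger.
  split.
  - by exists set0; split; [exact: finite_set0|].
  - move=> A B [S1 [f1 h1]] [S2 [f2 h2]]; exists (S1 `|` S2); split.
      by rewrite finite_setU.
    by move=> S fS SS; split; [apply: h1|apply: h2] => // E SE; apply: SS; [left|right].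
  - by move=> A B AB [S1 [f1 h1]]; exists S1; split=> // S fS SS; exact/AB/h1.
move/compact_near_coveringP: coD => /(_ _ larger
  (fun S y => forall E, irreducible_component D E -> E y -> S E) fl).
case.
  move=> y Dy; exists ([set z | forall E, irreducible_component D E -> E z -> E y],
    [set S | [set E | irreducible_component D E /\ E y] `<=` S]).
    split; first exact: near_components.
    exists [set E | irreducible_component D E /\ E y]; split => //.
    exact: finite_components_at.
  by move=> [z S] [/= hz hS] E cE Ez; apply: hS; split=> //; exact: hz Ez.
move=> S [fS /(_ S fS (@subset_refl _ _))] DS; apply: sub_finite_set fS => E cE.
have [y Ey] := component_nonempty cE.
exact: DS (component_sub cE Ey) E cE Ey.
Qed.

End OnePair.
End CrossingPairs.

(** * The maximum principle on a component *)

Section Balance.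
Variables (R : realType) (Y : fspace R).
Local Notation C := (CC R).
Implicit Types (y z : Y) (i : Y -> Cn R 2) (h F G : Y -> C) (D E : set Y).
Implicit Types (m n b d : nat).

Lemma nrm_continuous : continuous (@nrm R).
Proof.
move=> x A /nbhs_ballP[e /= e0 eA]; apply/nearC; exists e => // z zx; apply: eA.
by rewrite /ball /=; apply: le_lt_trans (nrm_dist _ _) _; rewrite nrmB.
Qed.

(** The vanishing orders of [F] and [G] are locally constant along the connected set [E]. *)
Lemma component_orders D F G E : crossing_pair D F G -> irreducible_component D E ->
  exists m n, [/\ (0 < m)%N, (0 < n)%N &
    forall y i m' b n' d, E y -> adapted F G E y i m' b n' d -> m' = m /\ n' = n].
Proof.
move=> cp cE; have [y Ey] := component_nonempty cE.
have [i [m [b [n [d [ad _]]]]]] := adapted_exists cp cE Ey.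
have [m0 n0] := component_factors_pos cp cE Ey ad.
exists m, n; split=> // y' i' m' b' n' d' Ey' [ci' Ei' fF' fG'].
have cnE := component_connected_set cE; have [ci Ei fF fG] := ad.
split; [apply: (vanishing_order_constant cnE (h := F) _ Ey')|
        apply: (vanishing_order_constant cnE (h := G) _ Ey')].
- by move=> z /(adapted_exists cp cE)[j [k [b1 [n1 [d1 [[cj Ej jF jG] _]]]]]]; exists k;
  exact: factors_vanishing_order jF.
- exact: factors_vanishing_order fF'.
- exact: Ey.
- exact: factors_vanishing_order fF.
- by move=> z /(adapted_exists cp cE)[j [k [b1 [n1 [d1 [[cj Ej jF jG] _]]]]]]; exists n1;
  exact: factors_vanishing_order jG.
- exact: factors_vanishing_order fG'.
- exact: Ey.
- exact: factors_vanishing_order fG.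
Qed.

Lemma factors_nc y i h m b : coordinates y i -> factors y i h m b ->
  \forall z \near y, h z = 0 -> fst_coord i z * snd_coord i z = 0.
Proof.
move=> ci [H [aH H0 hE]]; have [s ch] := coordinates_chart ci.
have [Hn0 _] := chart_unit ch aH H0.
apply: filterS2 hE Hn0 => z -> Hz /eqP.
rewrite !mulf_eq0 (negbTE Hz) orbF !expf_eq0 => /orP[] /andP[_ /eqP ->].
  by rewrite mul0r.
by rewrite mulr0.
Qed.

Lemma adapted_nc F G E y i m b n d : adapted F G E y i m b n d ->
  \forall z \near y, F z * G z = 0 -> fst_coord i z * snd_coord i z = 0.
Proof.
move=> [ci _ fF fG]; apply: filterS2 (factors_nc ci fF) (factors_nc ci fG) => z hF hG.
by move=> /eqP; rewrite mulf_eq0 => /orP[/eqP/hF|/eqP/hG].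
Qed.

Lemma avoid0 (c : C) (e : R) : 0 < e -> exists2 c' : C, nrm (c' - c) < e & c' != 0.
Proof.
move=> e0; have [->|c0] := eqVneq c 0; last by exists c; rewrite ?subrr ?nrm0.
exists (e / 2)%:C%C; first by rewrite subr0 nrmC ger0_norm; lra.
by rewrite -nrm_gt0 nrmC ger0_norm; lra.
Qed.

(** The complement of the axes is dense, also at the points near the centre. *)
Lemma off_axes y i : coordinates y i -> \forall z \near y,
  forall P : set Y, (\forall z' \near z, P z') ->
  exists z', [/\ P z', fst_coord i z' != 0 & snd_coord i z' != 0].
Proof.
move=> ci; have [s ch] := coordinates_chart ci.
have [s0 us su [_ cs] _] := ch.
have nsu : \forall w \near (0 : C, 0 : C), {for w, continuous s} /\
    \forall w' \near w, fst_coord i (s w') = w'.1 /\ snd_coord i (s w') = w'.2.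
  by near=> w; split; near: w; [exact: cs|exact: near_join su].
have nsy : \forall z \near y, {for (fst_coord i z, snd_coord i z), continuous s} /\
    \forall w' \near (fst_coord i z, snd_coord i z),
      fst_coord i (s w') = w'.1 /\ snd_coord i (s w') = w'.2.
  exact: (chart_cvg ch nsu).
apply: filterS2 us nsy => z sz [csz suz] P nP.
have nPs : \forall w \near (fst_coord i z, snd_coord i z), P (s w).
  by apply: csz; rewrite sz.
have [e e0 eP] := (nearCC _ _).1 (filterI suz nPs).
have [c1 c1e c10] := avoid0 (fst_coord i z) e0.
have [c2 c2e c20] := avoid0 (snd_coord i z) e0.
have [[e1 e2] Pz] := eP (c1, c2) c1e c2e.
by exists (s (c1, c2)); rewrite e1 e2.
Unshelve. all: by end_near.
Qed.

Section LimitOfQuotient.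
Variables (F G : Y -> C) (m n : nat).

Definition quotient_modulus z : R := nrm (F z) ^+ n / nrm (G z) ^+ m.

(** Both functions vanish on [E], so the modulus of [F ^ n / G ^ m] is defined there as
    a limit from the complement of their zeros, where no choice of coordinates
    enters. *)
Definition limit_modulus z : R :=
  lim (quotient_modulus @ within [set z' | F z' * G z' != 0] (nbhs z)).

(** In coordinates the powers of [u] cancel and [v ^ (d * m)] divides [v ^ (b * n)]. *)
Lemma limit_modulusE y i b d (F1 G1 : C * C -> C) : (0 < m)%N -> (0 < n)%N ->
  coordinates y i -> (d * m <= b * n)%N ->
  analytic2 F1 -> F1 (0, 0) != 0 -> analytic2 G1 -> G1 (0, 0) != 0 ->
  (\forall z \near y, F z = fst_coord i z ^+ m * snd_coord i z ^+ b *
     F1 (fst_coord i z, snd_coord i z)) ->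
  (\forall z \near y, G z = fst_coord i z ^+ n * snd_coord i z ^+ d *
     G1 (fst_coord i z, snd_coord i z)) ->
  let Q z := nrm (snd_coord i z) ^+ (b * n - d * m) *
     nrm (F1 (fst_coord i z, snd_coord i z)) ^+ n /
     nrm (G1 (fst_coord i z, snd_coord i z)) ^+ m in
  (\forall z \near y, limit_modulus z = Q z) /\ {for y, continuous Q}.
Proof.
move=> m0 n0 ci bd aF F10 aG G10 FE GE Q.
have [s ch] := coordinates_chart ci.
have [F1n0 cF1] := chart_unit ch aF F10; have [G1n0 cG1] := chart_unit ch aG G10.
have [_ _ _ [cuv _] _] := ch.
have cQ : \forall z \near y, {for z, continuous Q}.
  apply: filterS2 (filterI cuv cF1) (filterI cG1 G1n0) => z [[cu cv] cF] [cG Gz0].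
  have cn (h : Y -> C) k : {for z, continuous h} -> (fun z => nrm (h z) ^+ k) @ z --> nrm (h z) ^+ k.
    move=> ch'; apply: (@cvg_exp _ Y (nbhs z) _ (fun z => nrm (h z))).
    exact: (@continuous_comp _ _ _ h (@nrm R) z ch' (nrm_continuous (x := h z))).
  apply: (@cvgM R Y (nbhs z) _ (fun z => nrm (snd_coord i z) ^+ (b * n - d * m) *
     nrm (F1 (fst_coord i z, snd_coord i z)) ^+ n)
     (fun z => (nrm (G1 (fst_coord i z, snd_coord i z)) ^+ m)^-1)).
    exact: (@cvgM R Y (nbhs z) _ (fun z => nrm (snd_coord i z) ^+ (b * n - d * m))
     (fun z => nrm (F1 (fst_coord i z, snd_coord i z)) ^+ n) _ _ (cn _ _ cv) (cn _ _ cF)).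
  apply: (@cvgV R Y (nbhs z) _ (fun z => nrm (G1 (fst_coord i z, snd_coord i z)) ^+ m)).
    by rewrite expf_neq0 // nrm_eq0.
  exact: cn cG.
split; last exact: nbhs_singleton cQ.
have qE : \forall z \near y, F z * G z != 0 -> quotient_modulus z = Q z.
  apply: filterS2 (filterI FE GE) G1n0 => z [Fz Gz] G1z0.
  move=> FG0.
  have Fn0 : F z != 0 by apply: contraNneq FG0 => ->; rewrite mul0r.
  have Gn0 : G z != 0 by apply: contraNneq FG0 => ->; rewrite mulr0.
  have u0 : fst_coord i z != 0.
    by move: Fn0; rewrite Fz !mulf_eq0 !negb_or expf_eq0 m0 => /andP[/andP[]].
  have vd0 : snd_coord i z ^+ d != 0.
    by move: Gn0; rewrite Gz !mulf_eq0 !negb_or => /andP[/andP[]].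
  rewrite /quotient_modulus Fz Gz !nrmM !nrmX !exprMn -!exprM.
  rewrite -[in X in X / _ = _](subnK bd) exprD [(n * m)%N]mulnC.
  have U0 : nrm (fst_coord i z) ^+ (m * n) != 0 by rewrite expf_neq0 // nrm_eq0.
  have V0 : nrm (snd_coord i z) ^+ (d * m) != 0.
    by rewrite exprM -nrmX expf_neq0 // nrm_eq0.
  have W0 : nrm (G1 (fst_coord i z, snd_coord i z)) ^+ m != 0 by rewrite expf_neq0 // nrm_eq0.
  rewrite /Q; move: U0 V0 W0.
  move: (nrm (fst_coord i z) ^+ (m * n)) (nrm (snd_coord i z) ^+ (d * m)).
  move: (nrm (G1 _) ^+ m) (nrm (F1 _) ^+ n) (nrm (snd_coord i z) ^+ _) => a1 a2 a3 a4 a5 *.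
  by field; apply/and3P.
have Toff : \forall z \near y, F z * G z = 0 -> fst_coord i z * snd_coord i z = 0.
  have fF : factors y i F m b by exists F1.
  have fG : factors y i G n d by exists G1.
  apply: filterS2 (factors_nc ci fF) (factors_nc ci fG) => z hF hG.
  by move=> /eqP; rewrite mulf_eq0 => /orP[/eqP/hF|/eqP/hG].
near=> z.
have clz : closure [set z' | F z' * G z' != 0] z.
  move=> B Bz; have offz : forall P : set Y, (\forall z' \near z, P z') ->
    exists z', [/\ P z', fst_coord i z' != 0 & snd_coord i z' != 0].
    by near: z; exact: off_axes.
  have Tz : \forall z' \near z, F z' * G z' = 0 -> fst_coord i z' * snd_coord i z' = 0.
    by near: z; exact: near_join Toff.
  have [z' [[Bz' Tz'] uz' vz']] := offz _ (filterI Bz Tz).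
  exists z'; split=> //=; apply/eqP => /Tz'/eqP.
  by rewrite mulf_eq0 (negbTE uz') (negbTE vz').
have PF := @within_nbhs_proper Y [set z' | F z' * G z' != 0] z clz.
have cQz : {for z, continuous Q} by near: z; exact: cQ.
have qz : \forall z' \near z, F z' * G z' != 0 -> quotient_modulus z' = Q z'.
  by near: z; exact: near_join qE.
apply: cvg_lim; first exact: Rhausdorff.
have cw : Q x @[x --> within [set z' | F z' * G z' != 0] (nbhs z)] --> Q z.
  exact: cvg_within_filter cQz.
have qw : {near within [set z' | F z' * G z' != 0] (nbhs z), Q =1 quotient_modulus}.
  by rewrite near_withinE; apply: filterS qz => z' h /h ->.
exact: (cvg_trans (near_eq_cvg qw) cw).
Unshelve. all: by end_near.
Qed.

End LimitOfQuotient.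

(** The hypothesis on the exponents says that [F ^ n / G ^ m] has no pole on [E]. Its
    modulus is continuous on the compact set [E], hence constant by the maximum
    principle; it would vanish where [d * m < b * n], but it does not vanish at
    a general point of [E]. *)
Lemma balance D F G E m n : crossing_pair D F G -> irreducible_component D E ->
  (0 < m)%N -> (0 < n)%N ->
  (forall y i m' b n' d, E y -> adapted F G E y i m' b n' d -> m' = m /\ n' = n) ->
  (forall y i b d, E y -> adapted F G E y i m b n d -> (d * m <= b * n)%N) ->
  forall y i b d, E y -> adapted F G E y i m b n d -> (d * m = b * n)%N.
Proof.
move=> cp cE m0 n0 ord le y0 i0 b0 d0 Ey0 ad0.
pose phi := limit_modulus F G m n.
have ex y : E y -> exists i b d, adapted F G E y i m b n d.
  move=> Ey; have [i [m' [b [n' [d [ad _]]]]]] := adapted_exists cp cE Ey.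
  by have [mE nE] := ord _ _ _ _ _ _ Ey ad; exists i, b, d; rewrite -mE -nE.
have cphi y : E y -> {for y, continuous phi}.
  move=> Ey; have [i [b [d ad]]] := ex y Ey; have bd := le _ _ _ _ Ey ad.
  case: ad => ci Ei [F1 [aF F10 FE]] [G1 [aG G10 GE]].
  have [phiE cQ] := limit_modulusE m0 n0 ci bd aF F10 aG G10 FE GE.
  rewrite /prop_for /continuous_at /phi (nbhs_singleton phiE).
  by apply: cvg_trans cQ; apply: near_eq_cvg; apply: filterS phiE => z ->.
have E0 : E !=set0 by exists y0.
have cwphi : {within E, continuous phi}.
  by apply: continuous_in_subspaceT => y /set_mem; exact: cphi.
have [c /set_mem Ec phimax] := compact_EVT_max E0 (component_compact cp cE) cwphi.
have constant : forall y, E y -> phi y = phi c.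
  apply: (@connected_locally_constant _ E (fun y => phi y = phi c)
    (component_connected_set cE) _ _ c Ec erefl) => y Ey phiy; last first.
    have [lt|lt] : phi y < phi c \/ phi c < phi y by apply/orP; rewrite -neq_lt; apply/eqP.
      have nlt : \forall z \near y, phi z < phi c by exact: cvgr_lt (cphi y Ey) _ lt.
      by apply: filterS nlt => z h _; apply/eqP; rewrite lt_eqF.
    have ngt : \forall z \near y, phi c < phi z by exact: cvgr_gt (cphi y Ey) _ lt.
    by apply: filterS ngt => z h _; apply/eqP; rewrite gt_eqF.
  have [i [b [d ad]]] := ex y Ey; have bd := le _ _ _ _ Ey ad.
  case: ad => ci Ei [F1 [aF F10 FE]] [G1 [aG G10 GE]].
  have [phiE cQ] := limit_modulusE m0 n0 ci bd aF F10 aG G10 FE GE.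
  have [s ch] := coordinates_chart ci; have [G1n0 _] := chart_unit ch aG G10.
  have [s0 _ su [cuv _] _] := ch; have [u0 v0] := coordinates_at0 ci.
  pose a (v : C) := v ^+ (b * n - d * m) * F1 (0, v) ^+ n.
  pose g (v : C) := G1 (0, v) ^+ m.
  have aa : analytic1 a.
    by apply: analytic1M; apply: analytic1X; [exact: analytic1_id|exact: analytic2_slice].
  have ag : analytic1 g by apply: analytic1X; exact: analytic2_slice.
  have g0 : g 0 != 0 by rewrite expf_neq0.
  have phia : \forall z \near y, E z -> g (snd_coord i z) != 0 /\
      phi z * nrm (g (snd_coord i z)) = nrm (a (snd_coord i z)).
    near=> z => Ez; have uz : fst_coord i z = 0 by apply/(near Ei z).
    have Gz : G1 (fst_coord i z, snd_coord i z) != 0 by near: z; exact: G1n0.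
    rewrite /phi (near phiE z) // uz /a /g; rewrite uz in Gz.
    split; first by rewrite expf_neq0.
    by rewrite nrmM !nrmX divfK // expf_neq0 // nrm_eq0.
  have phiy0 : phi y * nrm (g 0) = nrm (a 0).
    by have [_] := nbhs_singleton phia Ey; rewrite v0.
  have [r r0 rP] : exists2 r : R, 0 < r & forall v : C, nrm v < r ->
      nrm (a v) * nrm (g 0) <= nrm (a 0) * nrm (g v).
    have [r r0 rP] := (nearCC _ _).1 (filterI su (chart_pull ch (filterI phia Ei))).
    exists r => // v vr; have := rP (0, v); rewrite /= !subr0 nrm0 => /(_ r0 vr).
    move=> [[us vs] [hE Es]]; have Es' : E (s (0, v)) by apply/Es.
    have [gs] := hE Es'; rewrite vs /= => <-.
    rewrite -phiy0 [leRHS]mulrAC ler_wpM2r ?nrm_ge0 // ler_wpM2r ?nrm_ge0 //.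
    by rewrite phiy; apply: phimax; exact/mem_set.
  have [r' r'0 r'P] := maximum_principle aa ag r0 rP g0.
  have [_ cv] := nbhs_singleton cuv.
  have nv := near_nrm_lt cv r'0; rewrite v0 in nv.
  apply: filterS2 nv phia => z; rewrite subr0 => /r'P e hz Ez.
  have [gz phiz] := hz Ez; rewrite -phiy.
  have gz0 : nrm (g (snd_coord i z)) != 0 by rewrite nrm_eq0.
  have gy0 : nrm (g 0) != 0 by rewrite nrm_eq0.
  apply: (mulIf gz0); apply: (mulIf gy0); rewrite phiz [RHS]mulrAC phiy0.
  by rewrite -!nrmM e.
apply/eqP; rewrite eqn_leq (le _ _ _ _ Ey0 ad0) /= leqNgt; apply/negP => lt.
case: ad0 => ci Ei [F1 [aF F10 FE]] [G1 [aG G10 GE]].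
have [phiE cQ] := limit_modulusE m0 n0 ci (ltnW lt) aF F10 aG G10 FE GE.
have [s ch] := coordinates_chart ci.
have [F1n0 _] := chart_unit ch aF F10; have [G1n0 _] := chart_unit ch aG G10.
have [u0 v0] := coordinates_at0 ci.
have phi0 : phi y0 = 0.
  rewrite /phi (nbhs_singleton phiE) v0 nrm0 expr0n subn_eq0 leqNgt lt /=.
  by rewrite !mul0r.
have [z [[pz [Fz [Gz Ez]]] uz vz]] := coordinates_axis ci
  (filterI phiE (filterI F1n0 (filterI G1n0 Ei))).
have /eqP := constant z (Ez.2 uz); rewrite -(constant y0 Ey0) phi0 /phi pz.
rewrite mulf_eq0 invr_eq0 mulf_eq0 !expf_eq0 !nrm_eq0 (negbTE Fz) (negbTE Gz).
by rewrite (negbTE vz) !andbF.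
Unshelve. all: by end_near.
Qed.

End Balance.

(** * Orders along curves *)

Section Orders.
Variable R : realType.
Local Notation C := (CC R).

Lemma near_t0 (e : R) : 0 < e -> \forall t \near (0 : Cn R 1), nrm ((t : Cn R 1) ord0 ord0) < e.
Proof.
by move=> e0; apply/nearCn; exists e => // t /(_ ord0); rewrite mxE subr0.
Qed.

(** If [k < m], then [a t] would tend to 0 with [t]. *)
Lemma order_eq (k m : nat) (a b : Cn R 1 -> R) :
  {for 0, continuous a} -> {for 0, continuous b} -> 0 < a 0 -> 0 < b 0 ->
  (\forall t \near (0 : Cn R 1),
     nrm ((t : Cn R 1) ord0 ord0) ^+ k * a t = nrm ((t : Cn R 1) ord0 ord0) ^+ m * b t) -> k = m.
Proof.
wlog km : k m a b / (k < m)%N => [wl|].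
  move=> ca cb a0 b0 h; case: (ltngtP k m) => [lt|gt|//]; first exact: wl lt ca cb a0 b0 h.
  by apply/esym/(wl _ _ _ _ gt cb ca b0 a0); apply: filterS h => t ->.
move=> ca cb a0 b0 h; exfalso.
have lta : a 0 / 2 < a 0 by lra.
have ltb : b 0 < b 0 + 1 by lra.
have na : \forall t \near (0 : Cn R 1), a 0 / 2 < a t by exact: cvgr_gt ca _ lta.
have nb : \forall t \near (0 : Cn R 1), b t < b 0 + 1 by exact: cvgr_lt cb _ ltb.
have [e e0 eP] := (nearCn _ _).1 (filterI h (filterI na nb)).
have b10 : 0 < b 0 + 1 by lra.
have ab0 : 0 < a 0 / 2 / (b 0 + 1) by rewrite !divr_gt0.
have [x [x0 x1' xe]] := exists_small3 ltr01 e0 ab0; rewrite ltr_pdivlMr // => xab.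
have x1 := ltW x1'.
have nx : nrm (x%:C%C : C) = x by rewrite nrmC ger0_norm // ltW.
have [|+ [at_ bt]] := eP (const_mx x%:C%C).
  by move=> j; rewrite !mxE subr0 nx.
rewrite mxE nx -(subnK (ltnW km)) addnC exprD -mulrA => /(mulfI _) e1.
have {}e1 := e1 (lt0r_neq0 (exprn_gt0 k x0)).
have xmk : x ^+ (m - k) <= x.
  by rewrite -{2}[x]expr1 ler_wiXn2l ?(ltW x0) // subn_gt0.
have : x ^+ (m - k) * b (const_mx x%:C%C) <= x * (b 0 + 1).
  have [bt0|bt0] := leP 0 (b (const_mx x%:C%C)).
    by apply: ler_pM; rewrite ?exprn_ge0 ?(ltW x0) ?(ltW bt).
  apply: (@le_trans _ _ 0); last by rewrite mulr_ge0 ?(ltW x0) ?(ltW b10).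
  by rewrite mulr_ge0_le0 ?exprn_ge0 ?(ltW x0) ?(ltW bt0).
rewrite -e1; lra.
Qed.

Lemma analytic_at1_continuous (w : Cn R 1 -> C) : analytic_at 0 w -> {for 0, continuous w}.
Proof.
move=> /analytic_at1_analytic2/analytic2_continuous/nbhs_singleton cw.
have c0 : const_mx (0 : C) = 0 :> Cn R 1 by apply/matrixP => a b; rewrite !mxE.
move=> A; rewrite -{1}c0 => /(cw A)/nearCC[e e0 eA].
apply/nearCn; exists e => // t /(_ ord0); rewrite mxE subr0 => te.
have -> : t = const_mx (t ord0 ord0) by apply/matrixP => a b; rewrite !ord1 mxE.
by apply: (eA ((t : Cn R 1) ord0 ord0, 0)); rewrite /= subr0 // nrm0.
Qed.

Lemma continuous_nrm (T : topologicalType) (w : T -> C) x :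
  {for x, continuous w} -> {for x, continuous (fun t => nrm (w t))}.
Proof.
move=> cw; exact: (@continuous_comp _ _ _ w (@nrm R) x cw (@nrm_continuous R (w x))).
Qed.

Lemma has_order_nrm (u : Cn R 1 -> C) k : has_order u k ->
  exists a : Cn R 1 -> R, [/\ {for 0, continuous a}, 0 < a 0 &
    \forall t \near (0 : Cn R 1), nrm (u t) = nrm ((t : Cn R 1) ord0 ord0) ^+ k * a t].
Proof.
move=> [w [aw w0 uE]]; exists (fun t => nrm (w t)); split.
- exact: continuous_nrm (analytic_at1_continuous aw).
- by rewrite nrm_gt0; apply/eqP.
- by apply: filterS uE => t ->; rewrite nrmM nrmX.
Qed.

(** The curve is transverse to [u = 0], so [u] has modulus comparable to that of the
    parameter along it. *)
Lemma has_order_along (Y : fspace R) y i (h : Y -> C) m (c : Cn R 1 -> Y) k :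
  coordinates y i -> factors y i h m 0 -> c 0 = y -> {for 0, continuous c} ->
  has_order (fst_coord i \o c) 1 -> has_order (h \o c) k -> k = m.
Proof.
move=> ci [H [aH H0 hE]] c0 cc /has_order_nrm[a1 [ca1 a10 u1]] /has_order_nrm[a2 [ca2 a20 h2]].
have [s ch] := coordinates_chart ci; have [Hn0 cH] := chart_unit ch aH H0.
pose q t := nrm (H (fst_coord i (c t), snd_coord i (c t))).
apply: (@order_eq k m a2 (fun t => a1 t ^+ m * q t)) => //.
- apply: (@cvgM R _ (nbhs (0 : Cn R 1)) _ (fun t => a1 t ^+ m) q).
    exact: cvg_exp ca1.
  apply: continuous_nrm.
  apply: (@continuous_comp _ _ _ c (fun z => H (fst_coord i z, snd_coord i z)) 0 cc).
  by rewrite c0; exact: nbhs_singleton cH.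
- by rewrite mulr_gt0 ?exprn_gt0 // nrm_gt0 c0; exact: nbhs_singleton Hn0.
have hEc : \forall t \near (0 : Cn R 1), h (c t) = fst_coord i (c t) ^+ m *
    snd_coord i (c t) ^+ 0 * H (fst_coord i (c t), snd_coord i (c t)).
  by apply: (cc [set z | h z = fst_coord i z ^+ m * snd_coord i z ^+ 0 *
    H (fst_coord i z, snd_coord i z)]); rewrite c0.
apply: filterS2 (filterI u1 h2) hEc => t [/= u1t h2t] hEt.
by rewrite -h2t hEt expr0 mulr1 nrmM nrmX u1t expr1 exprMn mulrA.
Qed.

End Orders.

Section SmoothPoints.
Variables (R : realType) (Y : fspace R).
Local Notation C := (CC R).
Implicit Types (y z : Y) (i : Y -> Cn R 2) (h F G : Y -> C) (D E : set Y).
Implicit Types (m n b d : nat).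

(** A positive exponent [b] would put the axis [v = 0] in [Z]. *)
Lemma factors_single y i h m b (Z : set Y) : coordinates y i -> factors y i h m b ->
  (\forall z \near y, h z = 0 -> Z z) -> local_zero_set Z y (fst_coord i) -> b = 0%N.
Proof.
move=> ci fh hZ Zi; apply/eqP; rewrite -leqn0 leqNgt; apply/negP => b0.
have ci' := coordinates_swap ci.
have [z [[[zz hz] Ziz] uz vz]] := coordinates_axis ci'
  (filterI (filterI (factors_zero ci' (factors_swap fh)) hZ) Zi).
have Zz := hz ((zz vz).2 (conj b0 uz)).
by move: vz; rewrite snd_coord_swap (Ziz.1 Zz) eqxx.
Qed.

(** The axis [v = 0] is the curvetta; restricting a factorization to it is taking a slice. *)
Lemma chart_curve y i : coordinates y i -> exists c : Cn R 1 -> Y,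
  [/\ @holomorphic_at R (affine R 1) Y c 0, c 0 = y,
      \forall t \near (0 : Cn R 1), fst_coord i (c t) = (t : Cn R 1) ord0 ord0 &
      forall h m, factors y i h m 0 -> has_order (h \o c) m].
Proof.
move=> ci; have [s ch] := coordinates_chart ci; have [s0 us su [_ cs] hs] := ch.
have cE : \forall t \near (0 : Cn R 1), fst_coord i (s ((t : Cn R 1) ord0 ord0, 0)) = (t : Cn R 1) ord0 ord0 /\
    snd_coord i (s ((t : Cn R 1) ord0 ord0, 0)) = 0.
  move/nearCC: su => [e e0 eP]; apply: filterS (near_t0 e0) => t te.
  by apply: (eP ((t : Cn R 1) ord0 ord0, 0)); rewrite /= subr0 // nrm0.
have c00 : (0 : Cn R 1) ord0 ord0 = 0 by rewrite mxE.
have cc : {for 0, continuous (fun t : Cn R 1 => s ((t : Cn R 1) ord0 ord0, 0))}.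
  move=> A; rewrite /= c00 => /(nbhs_singleton cs)/nearCC[e e0 eA].
  apply: filterS (near_t0 e0) => t te.
  by apply: (eA ((t : Cn R 1) ord0 ord0, 0)); rewrite /= subr0 // nrm0.
exists (fun t => s ((t : Cn R 1) ord0 ord0, 0)); split.
- split; first exact: cc.
  by move=> h; rewrite /= c00 s0 => /hs; exact: analytic2_slice_at.
- by rewrite c00.
- by apply: filterS cE => t [].
move=> h m [H [aH H0 hE]]; exists (fun t => H ((t : Cn R 1) ord0 ord0, 0)); split.
- exact: analytic2_slice_at.
- by rewrite c00; apply/eqP.
have hEc : \forall t \near (0 : Cn R 1), h (s ((t : Cn R 1) ord0 ord0, 0)) =
    fst_coord i (s ((t : Cn R 1) ord0 ord0, 0)) ^+ m * snd_coord i (s ((t : Cn R 1) ord0 ord0, 0)) ^+ 0 *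
    H (fst_coord i (s ((t : Cn R 1) ord0 ord0, 0)), snd_coord i (s ((t : Cn R 1) ord0 ord0, 0))).
  by apply: (cc [set z | h z = fst_coord i z ^+ m * snd_coord i z ^+ 0 *
    H (fst_coord i z, snd_coord i z)]); rewrite /= c00 s0.
by apply: filterS2 cE hEc => t [-> ->] /= ->; rewrite expr0 mulr1.
Qed.

Lemma factors_fst y i : coordinates y i -> factors y i (fst_coord i) 1 0.
Proof.
move=> ci; exists (fun=> 1); split; [exact: analytic2_cst|exact: oner_neq0|].
by near=> z; rewrite expr1 expr0 !mulr1.
Unshelve. all: by end_near.
Qed.

End SmoothPoints.

(** * Hironaka quotients on a resolution *)

Section StrictTransform.
Variables (R : realType) (Y : fspace R) (D : set Y) (F G : Y -> CC R).
Hypothesis cp : crossing_pair D F G.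

(** Zeros of [F] off [D] near [y] can only lie on [v = 0], and that branch is in [D]
    exactly when [G] also vanishes on it. *)
Lemma strict_transform_branch E y i m b n d : irreducible_component D E -> E y ->
  adapted F G E y i m b n d ->
  closure ([set z | F z = 0] `\` D) y <-> (0 < b)%N /\ d = 0%N.
Proof.
move=> cE Ey ad; have [ci Ei fF fG] := ad; have ED := component_sub cp cE.
have [_ _ /(_ y (ED y Ey)) nD _ _] := cp.
have ncF := factors_nc ci fF; have ci' := coordinates_swap ci.
have zF' := factors_zero ci' (factors_swap fF); have zG' := factors_zero ci' (factors_swap fG).
rewrite fst_coord_swap snd_coord_swap in zF' zG'.
split=> [cl|[b0 d0] B By]; last first.
  have [z [[[zFz zGz] [Bz Dz]] vz uz]] := coordinates_axis ci'
    (filterI (filterI zF' zG') (filterI By nD)).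
  rewrite fst_coord_swap in vz; rewrite snd_coord_swap in uz.
  exists z; split=> //; split; first by apply/(zFz uz).
  by move=> /Dz[_] /(zGz uz)[]; rewrite d0.
apply: contrapT => nbd.
suff FD : \forall z \near y, F z = 0 -> D z.
  by have [z [[Fz nDz] /(_ Fz)]] := cl _ FD.
apply: filterS2 (filterI zF' zG') (filterI ncF (filterI Ei nD)).
move=> z [zFz zGz] [nc [Eiz nDz]] Fz.
have [uz|uz] := eqVneq (fst_coord i z) 0; first by apply/ED/Eiz.
have [b0 vz] := (zFz uz).1 Fz.
have d0 : (0 < d)%N by rewrite lt0n; apply/eqP => d0; apply: nbd.
by apply/nDz; split=> //; apply/(zGz uz).
Qed.

End StrictTransform.

Section Resolution.
Variables (R : realType) (X Y : fspace R) (p : X) (f g : X -> CC R) (pi : Y -> X).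
Hypotheses (hausX : hausdorff_space X) (fin : finite_germ p f g)
  (good : good_resolution p pi f g).
Local Notation C := (CC R).
Local Notation D := (exceptional p pi).
Local Notation F := (f \o pi).
Local Notation G := (g \o pi).
Implicit Types (y z : Y) (i : Y -> Cn R 2) (E : set Y) (m n b d : nat).

(** The other common zeros near [p] are finitely many. *)
Lemma isolated_common_zero : \forall x \near p, f x = 0 -> g x = 0 -> x = p.
Proof.
case: fin => _ _ [U [V [[oU Up] [oV V0] _ _ /(_ _ V0) finU]]].
have cl : closed ((U `&` [set x | (f x, g x) = (0, 0)]) `\` [set p]).
  move/hausdorff_accessible/accessible_finite_set_closed: hausX; apply.
  exact: finite_setD.
have np : \forall x \near p, ~ ((U `&` [set x | (f x, g x) = (0, 0)]) `\` [set p]) x.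
  by apply: open_nbhs_nbhs; split; [exact: closed_openC|case=> _; apply].
have nU : \forall x \near p, U x by exact: open_nbhs_nbhs.
apply: filterS2 np nU => x nx Ux fx gx; apply: contrapT => xp; apply: nx.
by split=> //; split=> //=; rewrite fx gx.
Qed.

Lemma resolution_crossing_pair : crossing_pair D F G.
Proof.
case: good => [[_ holpi proper [[clD _] _] _] nc sm].
case: (fin) => [[hf hg] [fp gp] _].
split.
- by split; [apply: proper; exact: compact_set1|].
- by move=> y Dy; have [_ h] := holpi y; split; apply: h; rewrite Dy.
- move=> y Dy; have [cpi _] := holpi y.
  have : \forall z \near y, f (pi z) = 0 -> g (pi z) = 0 -> pi z = p.
    apply: (cpi [set x | f x = 0 -> g x = 0 -> x = p]).
    by rewrite Dy; exact: isolated_common_zero.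
  by apply: filterS => z h; split=> [Dz|[]]; [rewrite /= Dz|exact: h].
- move=> y /nc[i [ci [Ti|Ti]]]; exists i; split=> //; apply: filterS Ti => z Tz.
    by move=> /Tz ->; rewrite mul0r.
  by move=> /Tz.
- exact: sm.
Qed.
Let cp := resolution_crossing_pair.

Lemma vanishing_at_centre y i (h : Y -> C) m : coordinates y i -> factors y i h m 0 ->
  h y = 0 -> (0 < m)%N.
Proof.
move=> ci [H [aH H0 hE]] hy0; rewrite lt0n; apply/eqP => m0.
have [s ch] := coordinates_chart ci; have [Hn0 _] := chart_unit ch aH H0.
have [] := nbhs_singleton (filterI hE Hn0); rewrite hy0 m0 !expr0 !mul1r => <-.
by rewrite eqxx.
Qed.

(** The equation of [E] vanishes only on the total transform, so in coordinates adapted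
    to the latter it is a power of the first coordinate times a unit. *)
Lemma total_transform_eq_component E y i : component p pi E -> E y -> coordinates y i ->
  local_zero_set E y (fst_coord i) -> smooth_curve_at (total_transform pi f g) y ->
  local_zero_set (total_transform pi f g) y (fst_coord i).
Proof.
move=> cE Ey ci Ei [j [cj Tj]]; have ED := component_sub cp cE.
have [fp gp] : f p = 0 /\ g p = 0 by case: fin.
have DT z : D z -> total_transform pi f g z by rewrite /total_transform /= => ->; rewrite fp mul0r.
have uT : \forall z \near y, fst_coord i z = 0 -> total_transform pi f g z.
  by apply: filterS Ei => z Eiz /Eiz /ED /DT.
have uz : \forall z \near y, fst_coord i z = 0 -> fst_coord j z * snd_coord j z = 0.
  by apply: filterS2 uT Tj => z h Tz /h /Tz ->; rewrite mul0r.
have [a [b fu]] := factors_exist cj (coordinates_hol ci) uz.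
have b0 := factors_single cj fu uT Tj; rewrite b0 in fu.
have a0 := vanishing_at_centre cj fu (coordinates_at0 ci).1.
case: fu => H [_ _ uE]; apply: filterS2 (filterI uT Tj) uE => z [uTz Tz] uEz.
split=> // /Tz jz; rewrite uEz jz expr0n -[a]prednK //= !mul0r //.
Qed.

Lemma smooth_point_orders E y i m n : component p pi E -> E y -> coordinates y i ->
  local_zero_set E y (fst_coord i) ->
  local_zero_set (total_transform pi f g) y (fst_coord i) ->
  (forall y i m' b n' d, E y -> adapted F G E y i m' b n' d -> m' = m /\ n' = n) ->
  factors y i F m 0 /\ factors y i G n 0.
Proof.
move=> cE Ey ci Ei Ti ord; have Dy := component_sub cp cE Ey.
have nci : \forall z \near y, F z * G z = 0 -> fst_coord i z * snd_coord i z = 0.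
  by apply: filterS Ti => z Tz /Tz ->; rewrite mul0r.
have [m' [b [n' [d [fF fG]]]]] := crossing_coordinates_factors cp Dy ci nci.
have b0 : b = 0%N.
  apply: factors_single ci fF _ Ti; near=> z => /= Fz.
  by rewrite /total_transform /= Fz mul0r.
have d0 : d = 0%N.
  apply: factors_single ci fG _ Ti; near=> z => /= Gz.
  by rewrite /total_transform /= Gz mulr0.
rewrite b0 in fF; rewrite d0 in fG.
by have [<- <-] := ord _ _ _ _ _ _ Ey (And4 ci Ei fF fG).
Unshelve. all: by end_near.
Qed.

(** Near any point of [E], the other points of the axis [u = 0] avoid the other branch. *)
Lemma smooth_point_exists E : component p pi E -> exists y i,
  [/\ E y, coordinates y i, local_zero_set E y (fst_coord i) &
      local_zero_set (total_transform pi f g) y (fst_coord i)].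
Proof.
move=> cE; have [y Ey] := component_nonempty cE.
have [i [m [b [n [d [ad _]]]]]] := adapted_exists cp cE Ey.
have [m0 n0] := component_factors_pos cp cE Ey ad.
have [ci Ei fF fG] := ad.
have nT : \forall z \near y, snd_coord i z != 0 ->
    total_transform pi f g z <-> fst_coord i z = 0.
  apply: filterS2 (factors_zero ci fF) (factors_zero ci fG) => z hF hG vz.
  have {}hF := hF vz; have {}hG := hG vz.
  split=> [/eqP|uz]; last first.
    by have /= e := hF.2 (conj m0 uz); rewrite /total_transform /= e mul0r.
  by rewrite mulf_eq0 => /orP[/eqP/hF[]|/eqP/hG[]].
have [s ch] := coordinates_chart ci; have [_ _ _ [cuv _] _] := ch.
have cv : \forall z \near y, {for z, continuous (snd_coord i)}.
  by apply: filterS cuv => z [].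
have [z [[[Ez nTz] [cvz rec]] uz vz]] := coordinates_axis ci
  (filterI (filterI (near_join Ei) (near_join nT))
           (filterI cv (smooth_curve_at_recenter E ci))).
have [_ ciz fE] := rec uz Ez.
exists z, (fun z' => i z' - i z); rewrite fE; split=> //.
  by apply/(nbhs_singleton Ez).
by apply: filterS2 (near_neq0 cvz vz) nTz => z' h; apply.
Qed.

Lemma hironaka_quotientE E m n : component p pi E ->
  (forall y i m' b n' d, E y -> adapted F G E y i m' b n' d -> m' = m /\ n' = n) ->
  hironaka_quotient pi f g E = m%:R / n%:R.
Proof.
move=> cE ord; rewrite /hironaka_quotient; set S := [set q | _].
have Sq q : S q -> q = m%:R / n%:R.
  move=> [c [k [l [[[cc _] Ec sT [i [ci Ei u1]]] ok ol ->]]]].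
  have Ti := total_transform_eq_component cE Ec ci Ei sT.
  have [fF fG] := smooth_point_orders cE Ec ci Ei Ti ord.
  by rewrite (has_order_along ci fF erefl cc u1 ok) (has_order_along ci fG erefl cc u1 ol).
apply: Sq; apply: xgetPex.
have [y [i [Ey ci Ei Ti]]] := smooth_point_exists cE.
have [fF fG] := smooth_point_orders cE Ey ci Ei Ti ord.
have [c [hc c0 _ co]] := chart_curve ci.
exists (m%:R / n%:R), c, m, n; split; [|exact: co fF|exact: co fG|by []].
split; rewrite ?c0 //; first by exists i.
by exists i; split=> //; exact: co (factors_fst ci).
Qed.

Lemma component_quotient E : component p pi E -> exists m n,
  [/\ (0 < m)%N, (0 < n)%N,
      forall y i m' b n' d, E y -> adapted F G E y i m' b n' d -> m' = m /\ n' = n &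
      hironaka_quotient pi f g E = m%:R / n%:R].
Proof.
move=> cE; have [m [n [m0 n0 ord]]] := component_orders cp cE.
by exists m, n; split=> //; exact: hironaka_quotientE.
Qed.

Lemma quotient_gt0 E : component p pi E -> 0 < hironaka_quotient pi f g E.
Proof.
by move=> /component_quotient[m [n [m0 n0 _ ->]]]; rewrite divr_gt0 ?ltr0n.
Qed.

Lemma quotient_lt m n b d : (0 < n)%N -> (0 < d)%N ->
  (m%:R / n%:R < b%:R / d%:R :> R) = (d * m < b * n)%N.
Proof.
move=> n0 d0; rewrite ltr_pdivrMr ?ltr0n // mulrAC ltr_pdivlMr ?ltr0n //.
by rewrite -!natrM ltr_nat mulnC.
Qed.

(** Near [y] the component [E'] is [v = 0], so the exponents [b] and [d] are the orders
    along [E'], once the coordinates are exchanged. *)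
Lemma neighbor_adapted E E' y i m b n d : component p pi E -> component p pi E' ->
  E <> E' -> E y -> E' y -> adapted F G E y i m b n d ->
  adapted F G E' y (@swap_coords R \o i) b m d n.
Proof.
move=> cE cE' EE' Ey E'y ad; have nci := adapted_nc ad; have [ci Ei fF fG] := ad.
have [E'i|E'i] := component_branch cp cE' E'y ci nci.
  by case: EE'; apply: (component_unique_branch cp cE cE' Ey ci nci Ei E'i).
split; [exact: coordinates_swap|by rewrite fst_coord_swap|exact: factors_swap..].
Qed.

Lemma neighbor_quotient E E' y i m b n d : component p pi E -> component p pi E' ->
  E <> E' -> E y -> E' y -> adapted F G E y i m b n d ->
  [/\ (0 < b)%N, (0 < d)%N & hironaka_quotient pi f g E' = b%:R / d%:R].
Proof.
move=> cE cE' EE' Ey E'y ad; have ad' := neighbor_adapted cE cE' EE' Ey E'y ad.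
have [b0 d0] := component_factors_pos cp cE' E'y ad'.
have [m' [n' [_ _ ord ->]]] := component_quotient cE'.
by have [<- <-] := ord _ _ _ _ _ _ E'y ad'.
Qed.

Lemma strict_transform_f E y i m b n d : component p pi E -> E y ->
  adapted F G E y i m b n d -> strict_transform p pi f y <-> (0 < b)%N /\ d = 0%N.
Proof. exact: (strict_transform_branch cp). Qed.

Lemma strict_transform_g E y i m b n d : component p pi E -> E y ->
  adapted F G E y i m b n d -> strict_transform p pi g y <-> (0 < d)%N /\ b = 0%N.
Proof.
by move=> cE Ey /adaptedC; exact: (strict_transform_branch (crossing_pairC cp)).
Qed.

Section OneComponent.
Variables (E : set Y) (m n : nat) (cE : component p pi E).
Hypotheses (m0 : (0 < m)%N) (n0 : (0 < n)%N)
  (ord : forall y i m' b n' d, E y -> adapted F G E y i m' b n' d -> m' = m /\ n' = n).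
Let qE : hironaka_quotient pi f g E = m%:R / n%:R := hironaka_quotientE cE ord.

Lemma adapted_at y : E y -> exists i b d, adapted F G E y i m b n d.
Proof.
move=> Ey; have [i [m' [b [n' [d [ad _]]]]]] := adapted_exists cp cE Ey.
by have [mE nE] := ord Ey ad; exists i, b, d; rewrite -mE -nE.
Qed.

Lemma positive_edge_out y a : positive_edge p pi f g y (Vertex E) a ->
  exists i b d, [/\ E y, adapted F G E y i m b n d & (d * m < b * n)%N].
Proof.
case: a => [E'|z|z] [//= ed wt].
  case: ed => _ cE' EE' Ey E'y; have [i [b [d ad]]] := adapted_at Ey.
  have [b0 d0 qE'] := neighbor_quotient cE cE' EE' Ey E'y ad.
  exists i, b, d; split=> //; move: wt.
  by rewrite /= lte_fin qE qE' quotient_lt.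
case: ed => _ _ Ey st; have [i [b [d ad]]] := adapted_at Ey.
have [b0 d0] := (strict_transform_f cE Ey ad).1 st.
by exists i, b, d; split=> //; rewrite d0 mul0n muln_gt0 b0.
Qed.

Lemma positive_edge_in y a : positive_edge p pi f g y a (Vertex E) ->
  exists i b d, [/\ E y, adapted F G E y i m b n d & (b * n < d * m)%N].
Proof.
case: a => [E'|z|z] [//= ed wt].
  case: ed => cE' _ E'E E'y Ey; have [i [b [d ad]]] := adapted_at Ey.
  have EE' : E <> E' by move=> EE'; apply: E'E.
  have [b0 d0 qE'] := neighbor_quotient cE cE' EE' Ey E'y ad.
  exists i, b, d; split=> //; move: wt.
  by rewrite /= lte_fin qE qE' quotient_lt // mulnC [(d * m)%N]mulnC.
case: ed => _ _ Ey st; have [i [b [d ad]]] := adapted_at Ey.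
have [d0 b0] := (strict_transform_g cE Ey ad).1 st.
by exists i, b, d; split=> //; rewrite b0 mul0n muln_gt0 d0.
Qed.

Lemma out_positive_edge y i b d : E y -> adapted F G E y i m b n d ->
  (d * m < b * n)%N -> exists a, positive_edge p pi f g y (Vertex E) a.
Proof.
move=> Ey ad bd; have b0 : (0 < b)%N by case: (b) bd => //; rewrite mul0n.
have [d0|d0] := posnP d.
  exists (OutTip y); split; last exact: ltry.
  by split=> //; apply/(strict_transform_f cE Ey ad).
have [E' [cE' E'y EE' E'i]] := crossing_neighbor cp cE Ey ad (adapted_nc ad) b0 d0.
have [_ _ qE'] := neighbor_quotient cE cE' EE' Ey E'y ad.
exists (Vertex E'); split; first by [].
by rewrite /= lte_fin qE qE' quotient_lt.
Qed.

Lemma in_positive_edge y i b d : E y -> adapted F G E y i m b n d ->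
  (b * n < d * m)%N -> exists a, positive_edge p pi f g y a (Vertex E).
Proof.
move=> Ey ad bd; have d0 : (0 < d)%N by case: (d) bd => //; rewrite mul0n.
have [b0|b0] := posnP b.
  exists (InTip y); split; last by rewrite /= lte_fin; exact: quotient_gt0.
  by split=> //; apply/(strict_transform_g cE Ey ad).
have [E' [cE' E'y EE' E'i]] := crossing_neighbor cp cE Ey ad (adapted_nc ad) b0 d0.
have [_ _ qE'] := neighbor_quotient cE cE' EE' Ey E'y ad.
exists (Vertex E'); split; first by split=> // E'E; apply: EE'.
by rewrite /= lte_fin qE qE' quotient_lt // mulnC [(m * d)%N]mulnC.
Qed.

(** Without an entering edge, [balance] makes all the edges at [E] unoriented. *)
Lemma edge_in_of_out y a : positive_edge p pi f g y (Vertex E) a ->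
  exists y' a', positive_edge p pi f g y' a' (Vertex E).
Proof.
move=> /positive_edge_out[i [b [d [Ey ad lt]]]]; apply: contrapT => none.
have le y' i' b' d' : E y' -> adapted F G E y' i' m b' n d' -> (d' * m <= b' * n)%N.
  move=> Ey' ad'; rewrite leqNgt; apply/negP => lt'.
  have [a' ed] := in_positive_edge Ey' ad' lt'.
  by apply: none; exists y', a'.
by have := balance cp cE m0 n0 ord le Ey ad; move: lt => /ltn_eqF/eqP.
Qed.

Lemma edge_out_of_in y a : positive_edge p pi f g y a (Vertex E) ->
  exists y' a', positive_edge p pi f g y' (Vertex E) a'.
Proof.
move=> /positive_edge_in[i [b [d [Ey ad lt]]]]; apply: contrapT => none.
have ord' y' i' m' b' n' d' : E y' -> adapted G F E y' i' m' b' n' d' -> m' = n /\ n' = m.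
  by move=> Ey' /adaptedC/(ord Ey')[].
have le y' i' b' d' : E y' -> adapted G F E y' i' n b' m d' -> (d' * n <= b' * m)%N.
  move=> Ey' /adaptedC ad'; rewrite leqNgt; apply/negP => lt'.
  have [a' ed] := out_positive_edge Ey' ad' lt'.
  by apply: none; exists y', a'.
have := balance (crossing_pairC cp) cE n0 m0 ord' le Ey (adaptedC ad).
by move: lt => /ltn_eqF/eqP.
Qed.

End OneComponent.

Lemma vertex_in_of_out E y a : positive_edge p pi f g y (Vertex E) a ->
  exists y' a', positive_edge p pi f g y' a' (Vertex E).
Proof.
move=> ed; have cE : component p pi E by case: a ed => [E'|z|z] [] //= [].
have [m [n [m0 n0 ord _]]] := component_quotient cE.
exact: (edge_in_of_out cE m0 n0 ord ed).
Qed.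

Lemma vertex_out_of_in E y a : positive_edge p pi f g y a (Vertex E) ->
  exists y' a', positive_edge p pi f g y' (Vertex E) a'.
Proof.
move=> ed; have cE : component p pi E by case: a ed => [E'|z|z] [] //= [].
have [m [n [m0 n0 ord _]]] := component_quotient cE.
exact: (edge_out_of_in cE m0 n0 ord ed).
Qed.

Lemma finite_vertices : finite_set [set E | component p pi E].
Proof. exact: (finite_components cp). Qed.

End Resolution.

(** * The dual graph *)

(** Used to bound the lengths of paths with increasing weights. *)
Lemma count_lt (T : eqType) (a1 a2 : pred T) (s : seq T) x :
  subpred a1 a2 -> x \in s -> a2 x -> ~~ a1 x -> (count a1 s < count a2 s)%N.
Proof.
move=> sub + a2x a1x; elim: s => //= y s IH; rewrite inE => /orP[/eqP <-|/IH lt].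
  by rewrite a2x (negbTE a1x) add0n add1n ltnS sub_count.
have : (a1 y <= a2 y)%N by case: (a1 y) (sub y) => // ->.
lia.
Qed.

Section Graph.
Variables (R : realType) (X Y : fspace R) (p : X) (f g : X -> CC R) (pi : Y -> X).
Hypotheses (hausX : hausdorff_space X) (fin : finite_germ p f g)
  (good : good_resolution p pi f g).
Implicit Types (y : Y) (E : set Y) (a b : node Y) (s : seq (Y * node Y)).
Local Notation q := (hironaka_quotient pi f g).
Local Notation wt := (weight pi f g).

Lemma ambient_continuous (k : (node Y + Y)%type) : continuous (fun x : ambient Y => x k).
Proof.
exact: (@proj_continuous {classic (node Y + Y)%type} (fun _ => R) k).
Qed.

Lemma positive_path_cat a s1 s2 : positive_path p pi f g a (s1 ++ s2) <->
  positive_path p pi f g a s1 /\ positive_path p pi f g (last a (map snd s1)) s2.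
Proof.
elim: s1 a => [|[y b] s1 IH] a /=; first by split=> [|[]].
by rewrite IH; split=> [[? []]|[[]]].
Qed.

Lemma path_support_cat a s1 s2 :
  path_support a (s1 ++ s2) =
  path_support a s1 `|` path_support (last a (map snd s1)) s2.
Proof.
elim: s1 a => [|[y b] s1 IH] a /=; first by rewrite set0U.
by rewrite IH setUA.
Qed.

Lemma vertex_seq : exists L : seq (set Y), uniq L /\
  forall E, component p pi E <-> E \in L.
Proof.
have [L LE] := (finite_seqP _).1 (finite_vertices hausX fin good).
exists (undup L); split; first exact: undup_uniq.
move=> E; rewrite mem_undup; split=> [cE|EL].
  by have : [set E | component p pi E] E by []; rewrite LE.
by have : [set` L] E by []; rewrite -LE.
Qed.

(** Weights increase along the path and there are finitely many vertices, so
    that leaving every vertex that is entered leads to a going-out arrow. *)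
Lemma positive_path_forward y a E : positive_edge p pi f g y a (Vertex E) ->
  exists s, positive_path p pi f g (Vertex E) s /\
    exists z, last (Vertex E) (map snd s) = OutTip z.
Proof.
have [L [_ inL]] := vertex_seq.
have [k] := ubnP (count (fun E' => q E < q E') L).
elim: k => // k IH in y a E * => lek ed.
have [y' [b ed']] := vertex_out_of_in hausX fin good ed.
case: b ed' => [E'|z|z] ed'; last 2 first.
- by case: ed'.
- by exists [:: (y', OutTip z)]; split=> //; exists z.
have [[_ cE' _ _ _] lt] := ed'; rewrite /= lte_fin in lt.
have lek' : (count (fun E'' => (q E' < q E'')%R) L < k)%N.
  rewrite -ltnS; apply: leq_ltn_trans lek.
  apply: (@count_lt _ _ _ _ E'); rewrite ?ltxx //; last by apply/inL.
  by move=> E''; exact: lt_trans.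
have [s [ps [z lz]]] := IH y' (Vertex E) E' lek' ed'.
by exists ((y', Vertex E') :: s); split=> //; exists z.
Qed.

Lemma positive_path_backward y b E : positive_edge p pi f g y (Vertex E) b ->
  exists z s, positive_path p pi f g (InTip z) s /\ last (InTip z) (map snd s) = Vertex E.
Proof.
have [L [_ inL]] := vertex_seq.
have [k] := ubnP (count (fun E' => q E' < q E) L).
elim: k => // k IH in y b E * => lek ed.
have [y' [a ed']] := vertex_in_of_out hausX fin good ed.
case: a ed' => [E'|z|z] ed'; last 2 first.
- by exists z, [:: (y', Vertex E)]; split.
- by case: ed'.
have [[cE' _ _ _ _] lt] := ed'; rewrite /= lte_fin in lt.
have lek' : (count (fun E'' => (q E'' < q E')%R) L < k)%N.
  rewrite -ltnS; apply: leq_ltn_trans lek.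
  apply: (@count_lt _ _ _ _ E'); rewrite ?ltxx //; last by apply/inL.
  by move=> E'' /= lt'; exact: lt_trans lt' lt.
have [z [s [ps lz]]] := IH y' (Vertex E) E' lek' ed'.
exists z, (s ++ [:: (y', Vertex E)]); split.
  by apply/positive_path_cat; rewrite lz.
by rewrite map_cat last_cat.
Qed.

Lemma positive_edge_in_arcs y a b : positive_edge p pi f g y a b ->
  segment y a b `<=` maximal_arcs p pi f g.
Proof.
move=> ed x sx.
have [z [s1 [ps1 l1]]] : exists z s, positive_path p pi f g (InTip z) s /\
    last (InTip z) (map snd s) = a.
  case: a ed {sx} => [E|z|z] ed.
  - exact: positive_path_backward ed.
  - by exists z, [::].
  - by case: ed.
have [s2 [ps2 [z' l2]]] : exists s, positive_path p pi f g b s /\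
    exists z, last b (map snd s) = OutTip z.
  case: b ed {sx} => [E|z0|z0] ed.
  - exact: positive_path_forward ed.
  - by case: ed; case: a {l1}.
  - by exists [::]; split=> //; exists z0.
exists (InTip z), (s1 ++ (y, b) :: s2); split.
  split; [|by exists z|].
    by apply/positive_path_cat; rewrite l1; split=> //; split.
  by exists z'; rewrite map_cat last_cat l1.
by rewrite path_support_cat l1 /=; right; left.
Qed.

Lemma segment_sym y a b : segment (R := R) y a b = segment y b a.
Proof.
have sub a' b' : segment (R := R) y a' b' `<=` segment y b' a'.
  move=> _ [t /= + <-]; rewrite in_itv /= => /andP[t0 t1].
  exists (1 - t); first by rewrite /= in_itv /=; apply/andP; split; lra.
  by apply/funext => k; rewrite /edge_point; ring.
by apply/seteqP; split; exact: sub.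
Qed.

Lemma edge_sym y E E' : edge p pi f g y (Vertex E) (Vertex E') ->
  edge p pi f g y (Vertex E') (Vertex E).
Proof. by case=> cE cE' EE' Ey E'y; split=> // /esym. Qed.

Lemma arrow_positive y a b : arrow p pi f g y a b -> positive_edge p pi f g y a b.
Proof.
move=> [ed [[z az]|[z bz]]]; split=> //.
  move: ed; rewrite az; case: b => // E [_ cE _ _]; rewrite /= lte_fin.
  exact: (quotient_gt0 hausX fin good).
by move: ed; rewrite bz; case: a => // E _; exact: ltry.
Qed.

(** An edge between different weights is positively oriented in one of its two
    directions, and arrows always are, since quotients are positive and finite. *)
Lemma off_arcs_edge y a b x : edge p pi f g y a b -> segment y a b x ->
  ~ maximal_arcs p pi f g x ->
  exists E E', [/\ component p pi E, component p pi E', a = Vertex E, b = Vertex E' &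
                   q E = q E'].
Proof.
move=> ed sx off.
have npos : ~ positive_edge p pi f g y a b.
  by move=> /positive_edge_in_arcs/(_ x sx).
case: a b ed sx npos => [E|z|z] [E'|z'|z'] // ed sx npos.
- have [cE cE' _ _ _] := ed; exists E, E'; split=> //.
  apply/eqP; rewrite eq_le !leNgt; apply/andP; split; apply/negP => lt.
    apply: off; apply: (positive_edge_in_arcs (conj (edge_sym ed) _)); last first.
      by rewrite segment_sym; exact: sx.
    by rewrite /= lte_fin.
  by apply: npos; split=> //=; rewrite lte_fin.
- by case: npos; apply: arrow_positive; split=> //; right; exists z'.
- by case: npos; apply: arrow_positive; split=> //; left; exists z.
Qed.

Section WeightFunction.
Variables (L : seq (set Y)) (uL : uniq L)
  (inL : forall E, component p pi E <-> E \in L) (w : R).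

(** Linear on edges, with value 1 on the vertices of weight [w] and 0 on the
    other nodes. *)
Definition weight_indicator (x : ambient Y) : R :=
  \sum_(E <- L | q E == w) x (inl (Vertex E)).

Lemma weight_indicator_continuous : continuous weight_indicator.
Proof.
move=> x; apply: (@cvg_big R (set Y) +%R 0 (fun E => q E == w) _ _ (nbhs x) L
  (fun E (x : ambient Y) => x (inl (Vertex E))) (fun E => x (inl (Vertex E)))).
  exact: add_continuous.
by move=> E _; exact: (@ambient_continuous (inl (Vertex E)) x).
Qed.

Lemma weight_indicator_vertex E : component p pi E ->
  weight_indicator (node_point (Vertex E)) = (q E == w)%:R.
Proof.
move=> /inL EL; rewrite /weight_indicator big_mkcond (bigD1_seq E) //= big1 ?addr0.
  rewrite /node_point indicE mem_set //.
  by case: eqP.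
move=> E' E'E; case: ifP => // _; rewrite /node_point indicE memNset //.
by move=> /= [] EE'; rewrite EE' eqxx in E'E.
Qed.

Lemma weight_indicator_edge y a b t : weight_indicator (edge_point y a b t) =
  (1 - t) * weight_indicator (node_point a) + t * weight_indicator (node_point b).
Proof.
rewrite /weight_indicator !mulr_sumr -big_split /=; apply: eq_bigr => E _.
rewrite /edge_point /node_point [X in _ + X](_ : _ = 0) ?addr0 //.
by rewrite indicE memNset ?mulr0.
Qed.

Lemma weight_indicator_off_arcs x : off_arcs p pi f g x ->
  weight_indicator x = 0 \/ weight_indicator x = 1.
Proof.
have bool01 (c : bool) : c%:R = 0 :> R \/ c%:R = 1 :> R by case: c; [right|left].
move=> [[[E cE ->]|[y [a [b [ed sx]]]]] off].
  by rewrite weight_indicator_vertex.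
have [E [E' [cE cE' aE bE qq]]] := off_arcs_edge ed sx off.
case: sx => t _ <-; rewrite weight_indicator_edge aE bE !weight_indicator_vertex // qq.
by rewrite -mulrDl subrK mul1r.
Qed.

Lemma weight_indicator_closure x : closure (off_arcs p pi f g) x ->
  weight_indicator x = 0 \/ weight_indicator x = 1.
Proof.
pose Z := weight_indicator @^-1` [set 0; 1].
have clZ : closed Z.
  apply: preimage_closed => [y _|]; first exact: weight_indicator_continuous.
  by rewrite -[X in closed X]/([set 0] `|` [set 1]); apply: closedU; exact: closed_eq.
have sub : off_arcs p pi f g `<=` Z by exact: weight_indicator_off_arcs.
by move=> /(closure_subset sub)/clZ.
Qed.

End WeightFunction.

Lemma component_weight_constant (K : set (ambient Y)) E E' : connected K ->
  K `<=` closure (off_arcs p pi f g) -> component p pi E -> component p pi E' ->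
  K (node_point (Vertex E)) -> K (node_point (Vertex E')) -> q E = q E'.
Proof.
move=> cK Koff cE cE' KE KE'; have [L [uL inL]] := vertex_seq.
pose phi := weight_indicator L (q E).
have cphi : continuous phi by exact: weight_indicator_continuous.
have phi01 x : K x -> phi x = 0 \/ phi x = 1.
  by move=> /Koff; exact: weight_indicator_closure.
have phiE : phi (node_point (Vertex E)) = 1.
  by rewrite /phi weight_indicator_vertex // eqxx.
suff : phi (node_point (Vertex E')) = 1.
  rewrite /phi weight_indicator_vertex //; case: eqP => // _ /eqP.
  by rewrite eq_sym oner_eq0.
apply: (@connected_locally_constant _ K (fun x => phi x = 1) cK _ _ _ KE phiE) => // x Kx phix.
  have gt : \forall z \near x, 0 < phi z.
    by apply: (cvgr_gt _ (cphi x)); rewrite phix ltr01.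
  by apply: filterS gt => z z0 /phi01[z00|//]; rewrite z00 ltxx in z0.
have phix0 : phi x = 0 by case: (phi01 x Kx).
have lt : \forall z \near x, phi z < 1.
  by apply: (cvgr_lt _ (cphi x)); rewrite phix0 ltr01.
by apply: filterS lt => z z1 _ z11; rewrite z11 ltxx in z1.
Qed.

End Graph.

Unset Implicit Arguments.

Theorem theorem1 (R : realType) (X Y : fspace R) (p : X) (f g : X -> CC R)
    (pi : Y -> X)
    (hX : normal_surface_germ p)
    (hphi : finite_germ p f g)
    (hpi : good_resolution p pi f g) :
  (forall x : ambient Y, off_arcs_closure p pi f g x ->
     let K := connected_component (off_arcs_closure p pi f g) x in
     forall E F : set Y, component p pi E -> component p pi F ->
       K (node_point (Vertex E)) -> K (node_point (Vertex F)) ->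
       hironaka_quotient pi f g E = hironaka_quotient pi f g F) /\
  (forall (y : Y) (a b : node Y), arrow p pi f g y a b ->
     segment y a b `&` off_arcs p pi f g = set0).
Proof.
have hausX : hausdorff_space X by case: hX => -[].
split=> [x _ K E F cE cF KE KF|y a b ar].
  apply: (component_weight_constant hausX hphi hpi _ _ cE cF KE KF).
    exact: component_connected.
  by move=> z /connected_component_sub[].
apply/seteqP; split=> // x [sx [_]]; apply.
exact: (positive_edge_in_arcs hausX hphi hpi (arrow_positive hausX hphi hpi ar)).
Qed.
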